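(* Let $(M,\Sigma,\pi)$ be a non-planar, r-framed, 2-ruled 4-fold in $\mathbb{R}^8$, with $\Sigma$ a connected real analytic 2-manifold, defined by orthogonal real analytic maps $\phi_1,\phi_2:\Sigma\to\mathcal{S}^7$ and a real analytic map $\psi:\Sigma\to\mathbb{R}^8$ by $$M=\{r_1\phi_1(\sigma)+r_2\phi_2(\sigma)+\psi(\sigma): r_1,r_2\in\mathbb{R},\ \sigma\in\Sigma\}.$$ Then $M$ is Cayley if and only if there exist, locally (i.e. near each point of $\Sigma$), oriented coordinates $(s,t)$ on $\Sigma$ such that $$\frac{\partial\phi_1}{\partial t}=\phi_1\times\phi_2\times\frac{\partial\phi_1}{\partial s}+f\phi_2,\qquad \frac{\partial\phi_2}{\partial t}=\phi_1\times\phi_2\times\frac{\partial\phi_2}{\partial s}-f\phi_1,\qquad \frac{\partial\psi}{\partial t}=\phi_1\times\phi_2\times\frac{\partial\psi}{\partial s}+g_1\phi_1+g_2\phi_2$$ for some real analytic real-valued functions $f,g_1,g_2$ (defined on the domain of the coordinates).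
   Context: Write $d\mathbf{x}_{ijkl}=dx_i\wedge dx_j\wedge dx_k\wedge dx_l$ and let $\Phi$ be the 4-form on $\mathbb{R}^8$ $$\Phi=d\mathbf{x}_{1234}+d\mathbf{x}_{1256}+d\mathbf{x}_{1278}+d\mathbf{x}_{1357}-d\mathbf{x}_{1368}-d\mathbf{x}_{1458}-d\mathbf{x}_{1467}+d\mathbf{x}_{5678}+d\mathbf{x}_{3478}+d\mathbf{x}_{3456}+d\mathbf{x}_{2468}-d\mathbf{x}_{2457}-d\mathbf{x}_{2367}-d\mathbf{x}_{2358}.$$ A 4-dimensional submanifold of $\mathbb{R}^8$ is Cayley if, for a suitable orientation, $\Phi$ restricts to the Riemannian volume form on each of its tangent spaces. The triple cross product $x\times y\times z$ on $\mathbb{R}^8$ is defined by $g(x\times y\times z,w)=\Phi(x,y,z,w)$ for all $w$, with $g$ the Euclidean metric. A 2-ruled 4-fold $(M,\Sigma,\pi)$ in $\mathbb{R}^n$ is an (immersed) 4-dimensional submanifold $M$ with a smooth map $\pi:M\to\Sigma$ to a 2-manifold such that every fibre $\pi^{-1}(\sigma)$ is an affine 2-plane in $\mathbb{R}^n$. An r-framing is a smoothly varying choice of oriented orthonormal basis $(\phi_1(\sigma),\phi_2(\sigma))$ of (the direction of) each $\pi^{-1}(\sigma)$; $M$ is then the image of $\iota_M:\mathbb{R}^2\times\Sigma\to\mathbb{R}^n$, $\iota_M(r_1,r_2,\sigma)=r_1\phi_1(\sigma)+r_2\phi_2(\sigma)+\psi(\sigma)$, with $\pi$ corresponding to projection to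 $\Sigma$. ''Orthogonal'' maps means $g(\phi_1,\phi_2)\equiv0$. $M$ may have singularities, namely points where $\iota_M$ fails to be an immersion, provided these form a nowhere dense subset of each fibre $\mathbb{R}^2\times\{\sigma\}$; ''Cayley'' then refers to the nonsingular part. ''Non-planar'' means that $M$ is not contained in an affine 4-plane. Local coordinates $(s,t)$ on $\Sigma$ are oriented if $\Phi(\phi_1,\phi_2,\partial\iota_M/\partial s,\partial\iota_M/\partial t)>0$ at the points where $\iota_M$ is an immersion. *)

(* Defs.v *)
From HB Require Import structures.
From mathcomp Require Import all_boot all_order all_algebra.
From mathcomp Require Import all_classical all_reals all_analysis.
From mathcomp Require Import ring.

Set Implicit Arguments.
Unset Strict Implicit.
Unset Printing Implicit Defensive.

Import Order.TTheory GRing.Theory Num.Theory.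
Import numFieldNormedType.Exports.

Local Open Scope classical_set_scope.
Local Open Scope ring_scope.

(* The library norm on 'rV[R]_8 is the sup norm, so the Euclidean metric is
   introduced separately. *)
Definition euclid (R : realType) (x y : 'rV[R]_8) : R :=
  \sum_(i < 8) x 0 i * y 0 i.

Definition frame (R : realType) (x y z w : 'rV[R]_8) : 'M[R]_(4, 8) :=
  \matrix_(i < 4) nth 0 [:: x; y; z; w] i.

(* dx_i /\ dx_j /\ dx_k /\ dx_l on the rows of E, with the convention
   (dx_1 /\ dx_2 /\ dx_3 /\ dx_4)(e_1, e_2, e_3, e_4) = 1. The indices i, j, k,
   l range over 1, ..., 8, hence the predecessor. *)
Definition dx (R : realType) (i j k l : nat) (E : 'M[R]_(4, 8)) : R :=
  \det (\matrix_(a < 4, b < 4) E a (inord (nth 0%N [:: i; j; k; l] b).-1)).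

Definition PhiM (R : realType) (E : 'M[R]_(4, 8)) : R :=
    dx 1 2 3 4 E + dx 1 2 5 6 E + dx 1 2 7 8 E + dx 1 3 5 7 E
  - dx 1 3 6 8 E - dx 1 4 5 8 E - dx 1 4 6 7 E
  + dx 5 6 7 8 E + dx 3 4 7 8 E + dx 3 4 5 6 E + dx 2 4 6 8 E
  - dx 2 4 5 7 E - dx 2 3 6 7 E - dx 2 3 5 8 E.

Definition Phi (R : realType) (x y z w : 'rV[R]_8) : R := PhiM (frame x y z w).

(* The triple cross product; tcrossP below is its defining property. *)
Definition tcross (R : realType) (x y z : 'rV[R]_8) : 'rV[R]_8 :=
  \row_j Phi x y z (delta_mx 0 j).

Lemma dx_frame_linear (R : realType) i j k l (x y z : 'rV[R]_8) (a : R)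
    (u v : 'rV[R]_8) :
  dx i j k l (frame x y z (a *: u + v))
  = a * dx i j k l (frame x y z u) + dx i j k l (frame x y z v).
Proof.
rewrite /dx -[X in _ = _ + X]mul1r.
apply: (determinant_multilinear (i0 := ord_max)).
- by apply/rowP => c; rewrite !mxE /= mul1r.
- apply/matrixP => p q; rewrite !mxE.
  by case: p => [[|[|[|p]]] hp].
- apply/matrixP => p q; rewrite !mxE.
  by case: p => [[|[|[|p]]] hp].
Qed.

Lemma Phi_linear (R : realType) (x y z : 'rV[R]_8) (a : R) (u v : 'rV[R]_8) :
  Phi x y z (a *: u + v) = a * Phi x y z u + Phi x y z v.
Proof. by rewrite /Phi /PhiM !dx_frame_linear; ring. Qed.

Lemma tcrossP (R : realType) (x y z u : 'rV[R]_8) :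
  (forall w, euclid u w = Phi x y z w) <-> u = tcross x y z.
Proof.
have euclid_delta (v : 'rV[R]_8) j : euclid v (delta_mx 0 j) = v 0 j.
  rewrite /euclid (bigD1 j) //= big1 ?addr0; last first.
    by move=> i ij; rewrite !mxE (negbTE ij) andbF mulr0.
  by rewrite !mxE !eqxx mulr1.
split=> [h|-> w].
  by apply/rowP => j; rewrite mxE -h euclid_delta.
have Phi0 : Phi x y z 0 = 0.
  have := Phi_linear x y z (-1) 0 0.
  by rewrite scaler0 addr0 mulN1r addNr.
rewrite [in RHS](row_sum_delta w) /euclid.
elim/big_rec2: _ => [|i v s _ ->]; first by rewrite Phi0.
by rewrite Phi_linear mxE mulrC.
Qed.

(* Real analyticity at p of a function of two real variables: near p it is the
   sum of an absolutely convergent power series in (q - p), the terms of total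
   degree n being grouped together. *)
Definition analytic_at (R : realType) (f : R * R -> R) (p : R * R) : Prop :=
  exists (a : nat -> nat -> R) (r : R), 0 < r /\
    forall h k : R, `|h| < r -> `|k| < r ->
      cvgn (series (fun n =>
        \sum_(i < n.+1) `|a i (n - i)%N * h ^+ i * k ^+ (n - i)|)) /\
      series (fun n => \sum_(i < n.+1) a i (n - i)%N * h ^+ i * k ^+ (n - i))
        @ \oo --> f (p.1 + h, p.2 + k).

Record chart (R : realType) (T : topologicalType) := Chart {
  dom : set T ;
  coord : T -> R * R ;
  (* only meaningful on the image coord @` dom *)
  param : R * R -> T ;
  dom_open : open dom ;
  cod_open : open (coord @` dom) ;
  coordK : {in dom, cancel coord param} ;
  coord_continuous : {in dom, continuous coord} ;
  param_continuous : {in coord @` dom, continuous param}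
}.

Definition transition_analytic (R : realType) (T : topologicalType)
    (c d : chart R T) : Prop :=
  forall x, dom c x -> dom d x ->
    analytic_at (fun p => (coord d (param c p)).1) (coord c x) /\
    analytic_at (fun p => (coord d (param c p)).2) (coord c x).

Record analytic_surface (R : realType) := AnalyticSurface {
  surface_space :> topologicalType ;
  atlas : set (chart R surface_space) ;
  surface_hausdorff : hausdorff_space surface_space ;
  surface_second_countable : @second_countable surface_space ;
  atlas_cover : forall x, exists2 c, atlas c & dom c x ;
  atlas_compatible : forall c d, atlas c -> atlas d -> transition_analytic c d
}.

(* Local coordinates: the charts of the maximal atlas. *)
Definition local_coordinates (R : realType) (S : analytic_surface R)
    (c : chart R S) : Prop :=
  forall d, atlas d -> transition_analytic c d /\ transition_analytic d c.

Definition analytic_in (R : realType) (S : analytic_surface R)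
    (c : chart R S) (f : S -> R) : Prop :=
  forall x, dom c x -> analytic_at (f \o param c) (coord c x).

Definition analytic_map (R : realType) (S : analytic_surface R) (n : nat)
    (F : S -> 'rV[R]_n) : Prop :=
  forall c, atlas c -> forall i : 'I_n, analytic_in c (fun x => F x 0 i).

Definition ds (R : realType) (S : analytic_surface R) (c : chart R S)
    (F : S -> 'rV[R]_8) (x : S) : 'rV[R]_8 :=
  'D_((1, 0) : R * R) (F \o param c) (coord c x).

Definition dt (R : realType) (S : analytic_surface R) (c : chart R S)
    (F : S -> 'rV[R]_8) (x : S) : 'rV[R]_8 :=
  'D_((0, 1) : R * R) (F \o param c) (coord c x).

Definition iota_M (R : realType) (S : analytic_surface R)
    (phi1 phi2 psi : S -> 'rV[R]_8) (p : (R * R) * S) : 'rV[R]_8 :=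
  p.1.1 *: phi1 p.2 + p.1.2 *: phi2 p.2 + psi p.2.

(* Rows: the partial derivatives of i with respect to r1, r2, s, t, where
   (s, t) are the coordinates given by c. *)
Definition jacobian (R : realType) (S : analytic_surface R)
    (i : (R * R) * S -> 'rV[R]_8) (c : chart R S) (p : (R * R) * S) :
    'M[R]_(4, 8) :=
  let i_c := fun q : (R * R) * (R * R) => i (q.1, param c q.2) in
  let q := (p.1, coord c p.2) in
  frame ('D_(((1, 0), (0, 0)) : (R * R) * (R * R)) i_c q)
        ('D_(((0, 1), (0, 0)) : (R * R) * (R * R)) i_c q)
        ('D_(((0, 0), (1, 0)) : (R * R) * (R * R)) i_c q)
        ('D_(((0, 0), (0, 1)) : (R * R) * (R * R)) i_c q).

Definition immersion_at (R : realType) (S : analytic_surface R)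
    (i : (R * R) * S -> 'rV[R]_8) (p : (R * R) * S) : Prop :=
  exists c, [/\ atlas c, dom c p.2 & row_free (jacobian i c p)].

Definition nowhere_dense (T : topologicalType) (A : set T) : Prop :=
  interior (closure A) = set0.

Definition singular_set_nowhere_dense (R : realType) (S : analytic_surface R)
    (i : (R * R) * S -> 'rV[R]_8) : Prop :=
  forall x : S, nowhere_dense [set r : R * R | ~ immersion_at i (r, x)].

Definition tangent_frame (R : realType) (S : analytic_surface R)
    (i : (R * R) * S -> 'rV[R]_8) (p : (R * R) * S) (E : 'M[R]_(4, 8)) : Prop :=
  row_free E /\
  exists c, [/\ atlas c, dom c p.2 & (E == jacobian i c p)%MS].

(* An orientation of the nonsingular part of the immersed manifold: o p E says
   that the frame E of the tangent space at p is positive. The first clause says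
   that the positive frames at p form one of the two orientation classes, the
   second that the choice is continuous in p. *)
Definition orientation (R : realType) (S : analytic_surface R)
    (i : (R * R) * S -> 'rV[R]_8) (o : (R * R) * S -> 'M[R]_(4, 8) -> Prop) :
    Prop :=
  (forall p E (A : 'M[R]_4), immersion_at i p -> tangent_frame i p E ->
     A \in unitmx ->
     (o p (A *m E) <-> if 0 < \det A then o p E else ~ o p E)) /\
  (forall c p, atlas c -> dom c p.2 -> immersion_at i p ->
     \forall q \near p, o q (jacobian i c q) <-> o p (jacobian i c p)).

(* A 4-form on an oriented Euclidean 4-space is the volume form iff it takes the
   value 1 on the positive orthonormal frames. *)
Definition cayley (R : realType) (S : analytic_surface R)
    (i : (R * R) * S -> 'rV[R]_8) : Prop :=
  exists2 o, orientation i o &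
    forall p E, immersion_at i p -> tangent_frame i p E ->
      E *m E^T = 1%:M -> o p E -> PhiM E = 1.

Definition planar (R : realType) (S : analytic_surface R)
    (i : (R * R) * S -> 'rV[R]_8) : Prop :=
  exists (a : 'rV[R]_8) (P : 'M[R]_(4, 8)), row_free P /\
    forall p, (i p - a <= P)%MS.

Definition oriented_coordinates (R : realType) (S : analytic_surface R)
    (phi1 phi2 psi : S -> 'rV[R]_8) (c : chart R S) : Prop :=
  let i := iota_M phi1 phi2 psi in
  forall (r : R * R) (x : S), dom c x -> immersion_at i (r, x) ->
    0 < Phi (phi1 x) (phi2 x)
          (ds c (fun y => i (r, y)) x) (dt c (fun y => i (r, y)) x).

(* Main.v *)
Require Import Defs.
From HB Require Import structures.
From mathcomp Require Import all_boot all_order all_algebra.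
From mathcomp Require Import all_classical all_reals all_analysis.
From mathcomp Require Import perm ring lra zify.

Set Implicit Arguments.
Unset Strict Implicit.
Unset Printing Implicit Defensive.

Import Order.TTheory GRing.Theory Num.Theory.
Import numFieldNormedType.Exports.

Local Open Scope classical_set_scope.
Local Open Scope ring_scope.

(* Let J = phi1 x phi2 x -, a complex structure on the orthogonal complement of
   phi1, phi2. M is Cayley exactly when, modulo phi1 and phi2, the derivatives of
   each r1 phi1 + r2 phi2 + psi along Sigma span a J-complex line. In given
   coordinates (x, y), choose r with an immersion point and write
   i_y = al i_x + be J i_x there, with al, be analytic. Since the condition holds
   for all r, either phi1, phi2 and psi satisfy this same equation, or the
   derivatives of phi1 and phi2 lie in the complex line of i_x. In the second
   case the symmetry of second derivatives forces the 4-plane spanned by phi1,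
   phi2, i_x, J i_x to be locally constant, so that M is planar by the identity
   theorem. In the first case a solution S + i T of the Beltrami equation with
   coefficient al + i be, obtained from the Cauchy-Kovalevskaya theorem, provides
   the coordinates. Conversely the equations make the tangent frames
   (phi1, phi2, v, J v) up to multiples of phi1, phi2, on which Phi is positive. *)

(** * Absolutely convergent double series *)

(** Modulo phi1 and phi2 the equation sought, i_t = J i_s, is of Cauchy-Riemann type. For new
    coordinates (S, T) one has i_x = S_x i_s + T_x i_t and i_y = S_y i_s + T_y i_t, so i_y = (al +
    be J) i_x becomes (S + i T)_y = (al + i be) (S + i T)_x. A single change of coordinates must
    normalise phi1, phi2 and psi together, hence one pair al, be has to serve all three;
    non-planarity excludes that it serves only the ruling at the chosen r. The immersion point
    enters twice: there i_x is nonzero modulo phi1 and phi2, so al and be are analytic nearby, and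
    be is nonzero, so (S, T) is invertible.

    The analysis rests on one kind of norm for power series, the sum of the absolute values of the
    coefficients times a weight. Products, substitution, re-expansion, the inverse function theorem
    and the Cauchy-Kovalevskaya series are estimates in such norms. The vanishing order of a
    function is turned into smallness of its norm on a smaller square, which starts every
    contraction. *)

Section sums.
Variable R : realType.
Implicit Types (u v : nat -> R) (F : nat * nat -> R).

(** Absolute summability with an explicit bound. The bound is what gets propagated through sums,
    products and substitutions; [sm] is meaningful only in its presence. *)
Definition abs_le u (M : R) := forall N, \sum_(0 <= n < N) `|u n| <= M.

Definition sm u : R := limn (series u).

Lemma abs_le_cvg u M : abs_le u M -> cvgn (series u).
Proof.
move=> h; apply: normed_cvg; apply: nondecreasing_is_cvgn.
  by apply: nondecreasing_series => n _ _; exact: normr_ge0.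
by exists M => _ [n _ <-]; exact: h.
Qed.

Lemma smP u M : abs_le u M -> series u @ \oo --> sm u.
Proof. by move/abs_le_cvg. Qed.

Lemma sm_eq u l : series u @ \oo --> l -> sm u = l.
Proof. by move=> h; apply/cvg_lim. Qed.

Lemma abs_le_ge0 u M : abs_le u M -> 0 <= M.
Proof. by move/(_ 0); rewrite big_geq. Qed.

Lemma abs_le_trans u M M' : M <= M' -> abs_le u M -> abs_le u M'.
Proof. by move=> hM h N; apply: le_trans hM. Qed.

Lemma abs_le_dom u v M : (forall n, `|u n| <= `|v n|) -> abs_le v M -> abs_le u M.
Proof. by move=> h hv N; apply: le_trans (hv N); apply: ler_sum. Qed.

Lemma abs_leZ u c M : abs_le u M -> abs_le (fun n => c * u n) (`|c| * M).
Proof.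
move=> h N; under eq_bigr do rewrite normrM.
by rewrite -mulr_sumr ler_wpM2l.
Qed.

Lemma cvgn_le u l M : u @ \oo --> l -> (\forall n \near \oo, u n <= M) -> l <= M.
Proof.
move=> h hM; rewrite -(cvg_lim _ h) //; apply: limr_le => //.
by apply/cvg_ex; exists l.
Qed.

Lemma sm_abs u M : abs_le u M -> `|sm u| <= M.
Proof.
move=> h; apply: cvgn_le (cvg_norm (smP h)) _; apply: nearW => n.
by apply: le_trans (h n); exact: ler_norm_sum.
Qed.

Lemma sm0 : sm (fun _ => 0) = 0.
Proof.
apply: sm_eq; rewrite (_ : series _ = cst 0); first exact: cvg_cst.
by apply/funext => n; rewrite /series /= big1.
Qed.

Lemma smD u v M M' : abs_le u M -> abs_le v M' ->
  sm (fun n => u n + v n) = sm u + sm v.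
Proof.
move=> /smP hu /smP hv; apply: sm_eq.
rewrite (_ : series _ = series u \+ series v); first exact: cvgD.
by apply/funext => n; rewrite /series /= big_split.
Qed.

Lemma smZ u c M : abs_le u M -> sm (fun n => c * u n) = c * sm u.
Proof.
move=> /smP hu; apply: sm_eq.
rewrite (_ : series _ = (fun n => c * series u n)).
  by apply: cvgMr.
by apply/funext => n; rewrite /series /= mulr_sumr.
Qed.

Lemma sm_fin u N : (forall n, (N <= n)%N -> u n = 0) -> sm u = \sum_(0 <= n < N) u n.
Proof.
move=> h; apply: sm_eq; apply: cvg_near_cst; near=> n.
rewrite /series /= (@big_cat_nat _ _ _ N) //=; last by near: n; exact: nbhs_infty_ge.
rewrite [X in _ + X]big_nat [X in _ + X]big1 ?addr0 // => i /andP[hi _].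
exact: h.
Unshelve. all: by end_near.
Qed.

Definition rect N K := [seq (m, n) | m <- iota 0 N, n <- iota 0 K].

Lemma mem_rect N K p : (p \in rect N K) = (p.1 < N)%N && (p.2 < K)%N.
Proof.
apply/allpairsP/idP => [[q [h1 h2 ->]]|].
  by move: h1 h2; rewrite !mem_iota /= => -> ->.
by case: p => m n /= /andP[h1 h2]; exists (m, n); rewrite !mem_iota.
Qed.

Lemma uniq_rect N K : uniq (rect N K).
Proof. by apply: allpairs_uniq; rewrite ?iota_uniq // => -[? ?] [? ?]. Qed.

Definition square N := rect N N.

Lemma mem_square N p : (p \in square N) = (p.1 < N)%N && (p.2 < N)%N.
Proof. exact: mem_rect. Qed.

Lemma uniq_square N : uniq (square N).
Proof. exact: uniq_rect. Qed.

Definition square_le F (M : R) := forall N, \sum_(p <- square N) `|F p| <= M.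

(** Unordered summation: convergence along the finite sets of pairs. Row by row summation and
    summation along an enumeration are both compared with it, so they agree with each other. *)
Definition usum F (S : R) := forall e, 0 < e -> exists B,
  forall s, uniq s -> {subset square B <= s} -> `|\sum_(p <- s) F p - S| <= e.

Lemma sum_sub (G : nat * nat -> R) s t : uniq s -> uniq t -> {subset s <= t} ->
  \sum_(p <- t) G p = \sum_(p <- s) G p + \sum_(p <- t | p \notin s) G p.
Proof.
move=> us ut st; rewrite (bigID (mem s)) /=; congr (_ + _).
rewrite -big_filter; apply: perm_big; apply: uniq_perm => //.
  exact: filter_uniq.
by move=> p; rewrite mem_filter; case: (boolP (p \in s)) => // /st ->.
Qed.

Lemma seq_square (s : seq (nat * nat)) : exists N, {subset s <= square N}.
Proof.
elim: s => [|p s [N hN]]; first by exists 0%N.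
exists (maxn N (maxn p.1 p.2).+1) => q; rewrite inE mem_square => /orP[/eqP ->|/hN].
  by rewrite !leq_max !ltnS !leq_max !leqnn !orbT.
by rewrite mem_square => /andP[h1 h2]; rewrite !leq_max h1 h2.
Qed.

Lemma square_le_seq F M s : square_le F M -> uniq s -> \sum_(p <- s) `|F p| <= M.
Proof.
move=> h us; have [N hN] := seq_square s.
apply: le_trans (h N); rewrite (@sum_sub _ s (square N)) ?uniq_square //.
by rewrite lerDl; apply: sumr_ge0.
Qed.

Lemma square_sub N N' : (N <= N')%N -> {subset square N <= square N'}.
Proof.
move=> h p; rewrite !mem_square => /andP[h1 h2].
by rewrite !(leq_trans _ h).
Qed.

Lemma usum_exists F M : square_le F M -> exists S, usum F S.
Proof.
move=> h.
pose a N := \sum_(p <- square N) `|F p|.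
have nd : {homo a : m n / (m <= n)%N >-> m <= n}.
  move=> m n mn; rewrite /a (@sum_sub _ (square m) (square n)) ?uniq_square //; last exact: square_sub.
  by rewrite lerDl; apply: sumr_ge0.
have ca : cvgn a.
  by apply: nondecreasing_is_cvgn => //; exists M => _ [n _ <-]; exact: h.
have key e : 0 < e -> exists B, forall s, uniq s -> {subset square B <= s} ->
    `|\sum_(p <- s) F p - \sum_(p <- square B) F p| <= e.
  move=> e0; have /cvgrPdist_le /(_ _ e0) [B _ hB] := ca.
  exists B => s us hs; rewrite (@sum_sub _ (square B)) ?uniq_square // addrAC subrr add0r.
  apply: le_trans (ler_norm_sum _ _ _) _.
  have := hB B (leqnn _); rewrite /= ger0_norm ?subr_ge0; last exact: nondecreasing_cvgn_le.
  apply: le_trans.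
  have [N hN] := seq_square s.
  rewrite lerBrDl; apply: le_trans (nondecreasing_cvgn_le nd ca N).
  rewrite -(@sum_sub (fun p => `|F p|)) ?uniq_square //.
  rewrite /a (@sum_sub (fun p => `|F p|) s (square N)) ?uniq_square //.
  by rewrite lerDl; apply: sumr_ge0.
pose b N := \sum_(p <- square N) F p.
have cb : cvgn b.
  (* The terms of [c] are nonnegative, so [b] is a difference of two bounded nondecreasing
     sequences. *)
  pose c N := \sum_(p <- square N) (`|F p| + F p).
  have -> : b = (fun N => c N - a N).
    by apply/funext => N; rewrite /b /c /a big_split /= addrAC subrr add0r.
  apply: is_cvgB => //; apply: nondecreasing_is_cvgn.
    move=> m n mn; rewrite /c (@sum_sub _ (square m) (square n)) ?uniq_square //; last exact: square_sub.
    by rewrite lerDl; apply: sumr_ge0 => p _; have := ler_norm (- F p); rewrite normrN; lra.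
  exists (M + M) => _ [n _ <-]; rewrite /c big_split /=.
  by apply: lerD; [exact: h|apply: le_trans (h n); apply: ler_sum => p _; exact: ler_norm].
exists (limn b) => e e0.
have [B hB] := key (e / 2) (divr_gt0 e0 (ltr0Sn _ _)).
exists B => s us hs.
have hb : `|\sum_(p <- square B) F p - limn b| <= e / 2.
  have hc : (fun N => `|\sum_(p <- square B) F p - b N|) @ \oo --> `|\sum_(p <- square B) F p - limn b|.
    by apply: cvg_norm; apply: cvgB => //; exact: cvg_cst.
  apply: cvgn_le hc _.
  near=> N; rewrite distrC; apply: hB; first exact: uniq_square.
  by apply: square_sub; near: N; exact: nbhs_infty_ge.
rewrite -(subrKA (\sum_(q <- square B) F q)).
by apply: le_trans (ler_normD _ _) _; apply: le_trans (lerD (hB _ us hs) hb) _; lra.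
Unshelve. all: by end_near.
Qed.

Definition rows_le F (M : R) := forall N K,
  \sum_(0 <= m < N) \sum_(0 <= n < K) `|F (m, n)| <= M.

Lemma sum_rect (G : nat * nat -> R) N K :
  \sum_(p <- rect N K) G p = \sum_(0 <= m < N) \sum_(0 <= n < K) G (m, n).
Proof. by rewrite big_allpairs /index_iota !subn0. Qed.

Lemma rows_square F M : rows_le F M -> square_le F M.
Proof. by move=> h N; rewrite (sum_rect (fun p => `|F p|) N N). Qed.

Lemma rows_abs_le F M m : rows_le F M -> abs_le (fun n => F (m, n)) M.
Proof.
move=> h N; apply: le_trans (h m.+1 N).
rewrite big_nat_recr //= lerDr; apply: sumr_ge0 => i _; exact: sumr_ge0.
Qed.

Lemma sum_sm N (u : nat -> nat -> R) M : (forall m, abs_le (u m) M) ->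
  (fun K => \sum_(0 <= m < N) \sum_(0 <= n < K) u m n) @ \oo -->
  \sum_(0 <= m < N) sm (u m).
Proof.
move=> h; elim: N => [|N IH].
  under eq_fun do rewrite big_geq //; rewrite big_geq //; exact: cvg_cst.
under eq_fun do rewrite big_nat_recr //=; rewrite big_nat_recr //=.
by apply: cvgD => //; exact: smP (h N).
Qed.

Lemma rows_abs_le_sm F M : rows_le F M -> abs_le (fun m => sm (fun n => F (m, n))) M.
Proof.
move=> h N.
have ha m : abs_le (fun n => `|F (m, n)|) M.
  by apply: abs_le_dom (rows_abs_le m h) => n; rewrite normr_id.
have := @sum_sm N (fun m n => `|F (m, n)|) M ha.
move=> hc; apply: (@le_trans _ _ (\sum_(0 <= m < N) sm (fun n => `|F (m, n)|))).
  apply: ler_sum => m _.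
  apply: cvgn_le (cvg_norm (smP (rows_abs_le m h))) _; apply: nearW => n.
  apply: le_trans (ler_norm_sum _ _ _) _.
  apply: nondecreasing_cvgn_le; last exact/abs_le_cvg/(ha m).
  by apply: nondecreasing_series => k _ _.
by apply: cvgn_le hc _; apply: nearW => K; exact: h.
Qed.

Lemma usum_rows F M S : rows_le F M -> usum F S -> sm (fun m => sm (fun n => F (m, n))) = S.
Proof.
move=> h hS; apply: sm_eq; apply/cvgrPdist_le => e e0.
have [B hB] := hS _ e0.
near=> N; rewrite distrC.
have hc := @sum_sm N (fun m n => F (m, n)) M (fun m => rows_abs_le m h).
have hd : (fun K => `|\sum_(0 <= m < N) \sum_(0 <= n < K) F (m, n) - S|) @ \oo -->
    `|\sum_(0 <= m < N) sm (fun n => F (m, n)) - S|.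
  by apply: cvg_norm; apply: cvgB => //; exact: cvg_cst.
apply: cvgn_le hd _.
near=> K; rewrite -sum_rect; apply: hB; first exact: uniq_rect.
move=> p; rewrite mem_square mem_rect => /andP[h1 h2]; apply/andP; split.
  by apply: leq_trans h1 _; near: N; exact: nbhs_infty_ge.
by apply: leq_trans h2 _; near: K; exact: nbhs_infty_ge.
Unshelve. all: by end_near.
Qed.

(** Enumeration of a double family through the coding of pairs; a number that codes no pair
    contributes 0. *)
Definition unpk F k := if pickle_inv k is Some p then F p else 0.

Definition unpks K : seq (nat * nat) := pmap pickle_inv (iota 0 K).

Lemma sum_unpks (G : nat * nat -> R) K :
  \sum_(0 <= k < K) unpk G k = \sum_(p <- unpks K) G p.
Proof.
rewrite /unpks /index_iota subn0; elim: (iota 0 K) => [|k s IH]; first by rewrite !big_nil.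
rewrite big_cons IH /= /unpk; case: pickle_inv => [p|] /=; last by rewrite add0r.
by rewrite big_cons.
Qed.

Lemma uniq_unpks K : uniq (unpks K).
Proof. by apply: (pmap_uniq (@pickle_invK _)); exact: iota_uniq. Qed.

Lemma norm_unpk F k : `|unpk F k| = unpk (fun p => `|F p|) k.
Proof. by rewrite /unpk; case: pickle_inv => // ; rewrite normr0. Qed.

Lemma abs_le_unpk F M : square_le F M -> abs_le (unpk F) M.
Proof.
move=> h N; under eq_bigr do rewrite norm_unpk.
by rewrite sum_unpks; apply: square_le_seq => //; exact: uniq_unpks.
Qed.

Lemma usum_unpk F M S : square_le F M -> usum F S -> sm (unpk F) = S.
Proof.
move=> h hS; apply: sm_eq; apply/cvgrPdist_le => e e0.
have [B hB] := hS _ e0.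
near=> N; rewrite distrC /series /= sum_unpks; apply: hB; first exact: uniq_unpks.
move=> p hp; rewrite mem_pmap; apply/mapP; exists (pickle p); last by rewrite pickleK_inv.
rewrite mem_iota /= add0n.
have : (pickle p <= \max_(q <- square B) pickle q)%N by exact: leq_bigmax_seq.
move/leq_ltn_trans; apply; near: N; exact: nbhs_infty_gt.
Unshelve. all: by end_near.
Qed.

Lemma sm_unpk F M : rows_le F M ->
  abs_le (unpk F) M /\ sm (unpk F) = sm (fun m => sm (fun n => F (m, n))).
Proof.
move=> h; have hs := rows_square h; have [S hS] := usum_exists hs.
by split; [exact: abs_le_unpk|rewrite (usum_unpk hs hS) (usum_rows h hS)].
Qed.

(** Fubini: transposition preserves every square, hence the unordered sum, to which both iterated
    sums are equal. *)
Lemma sm_swap F M : rows_le F M ->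
  sm (fun m => sm (fun n => F (m, n))) = sm (fun n => sm (fun m => F (m, n))).
Proof.
move=> h; have hs := rows_square h; have [S hS] := usum_exists hs.
rewrite (usum_rows h hS); pose F' p := F (p.2, p.1).
have h' : rows_le F' M by move=> N K; rewrite exchange_big; exact: h.
symmetry; apply: (@usum_rows F' M S h') => e /hS[B hB].
exists B => s us hs'; rewrite -(big_map (fun p => (p.2, p.1)) xpredT F); apply: hB.
  by rewrite map_inj_uniq // => -[? ?] [? ?] /= [-> ->].
move=> p hp; apply/mapP; exists (p.2, p.1); last by case: (p).
by apply: hs'; move: hp; rewrite !mem_square andbC.
Qed.

End sums.

(** * Power series in two variables *)

Section reps.
Variable R : realType.

(* A power series, as an enumeration of its monomials [cf n * x^(ex n) * y^(ey n)]
   in which a monomial may occur several times: sums, products and substitutions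
   are then plain countable unions. [nb w p M] bounds its norm for the weight [w],
   and [lf g p] is the value at [p] of the linear form sending [x^i * y^j] to
   [g i j], which is bounded as soon as [g] is dominated by [w] ([dmd]). *)
Record rep := Rep { cf : nat -> R ; ex : nat -> nat ; ey : nat -> nat }.

Implicit Types (g w : nat -> nat -> R) (p : rep)
  (r s d e x y h k c rho C M : R).

Definition nb w p (M : R) := abs_le (fun n => cf p n * w (ex p n) (ey p n)) M.

Definition lf g p : R := sm (fun n => cf p n * g (ex p n) (ey p n)).

Definition dmd g w (C : R) := 0 <= C /\ forall i j, `|g i j| <= C * `|w i j|.

Lemma dmd_abs_le w p M g C : nb w p M -> dmd g w C ->
  abs_le (fun n => cf p n * g (ex p n) (ey p n)) (C * M).
Proof.
move=> h [C0 hd]; rewrite -[C]ger0_norm //.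
apply: abs_le_dom (abs_leZ C h) => n; rewrite !normrM mulrCA.
by apply: ler_wpM2l => //; rewrite (ger0_norm C0); exact: hd.
Qed.

Lemma lf_bound w p M g C : nb w p M -> dmd g w C -> `|lf g p| <= C * M.
Proof. by move=> h hd; apply: sm_abs; exact: dmd_abs_le h hd. Qed.

Lemma lfD w p M g g' C C' : nb w p M -> dmd g w C -> dmd g' w C' ->
  lf (fun i j => g i j + g' i j) p = lf g p + lf g' p.
Proof.
move=> h hd hd'; rewrite /lf; under eq_fun do rewrite mulrDr.
exact: smD (dmd_abs_le h hd) (dmd_abs_le h hd').
Qed.

Lemma lfZ w p M g a C : nb w p M -> dmd g w C ->
  lf (fun i j => a * g i j) p = a * lf g p.
Proof.
move=> h hd; rewrite /lf; under eq_fun do rewrite mulrCA.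
exact: smZ (dmd_abs_le h hd).
Qed.

Lemma dmdZ g w C a : dmd g w C -> dmd (fun i j => a * g i j) w (`|a| * C).
Proof.
move=> [C0 h]; split=> [|i j]; first exact: mulr_ge0.
by rewrite normrM -mulrA ler_wpM2l.
Qed.

Lemma dmdD g g' w C C' : dmd g w C -> dmd g' w C' ->
  dmd (fun i j => g i j + g' i j) w (C + C').
Proof.
move=> [C0 h] [C0' h']; split=> [|i j]; first exact: addr_ge0.
by rewrite mulrDl; apply: le_trans (ler_normD _ _) _; exact: lerD.
Qed.

Lemma lf_sum w p M (g : nat -> nat -> nat -> R) (C : nat -> R) n : nb w p M ->
  (forall m, dmd (g m) w (C m)) ->
  lf (fun i j => \sum_(0 <= m < n) g m i j) p = \sum_(0 <= m < n) lf (g m) p.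
Proof.
move=> h hd; suff [] : lf (fun i j => \sum_(0 <= m < n) g m i j) p = \sum_(0 <= m < n) lf (g m) p
   /\ exists C', dmd (fun i j => \sum_(0 <= m < n) g m i j) w C' by [].
elim: n => [|n [IH [C' IH']]].
  split.
    rewrite big_geq // /lf -[RHS](sm0 R); congr sm; apply/funext => n.
    by rewrite big_geq // mulr0.
  by exists 0; split=> // i j; rewrite big_geq // normr0 mul0r.
split; last first.
  exists (C' + C n); have := dmdD IH' (hd n).
  by congr dmd; apply/funext => i; apply/funext => j; rewrite big_nat_recr.
rewrite big_nat_recr //= -IH -(lfD h IH' (hd n)); congr lf.
by apply/funext => i; apply/funext => j; rewrite big_nat_recr.
Qed.

(** Sum of countably many series, as the union of their monomials. Numbers that code no pair give
    the monomial 1 with coefficient 0. *)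
Definition rU (P : nat -> rep) : rep :=
  Rep (fun k : nat => if pickle_inv k is Some q then cf (P q.1) q.2 else 0)
      (fun k : nat => if pickle_inv k is Some q then ex (P q.1) q.2 else 0%N)
      (fun k : nat => if pickle_inv k is Some q then ey (P q.1) q.2 else 0%N).

Lemma rU_term P g : (fun k : nat => cf (rU P) k * g (ex (rU P) k) (ey (rU P) k)) =
  unpk (fun q : nat * nat => cf (P q.1) q.2 * g (ex (P q.1) q.2) (ey (P q.1) q.2)).
Proof.
apply/funext => k; rewrite /unpk /=.
by case: pickle_inv => //; rewrite mul0r.
Qed.

Lemma rU_rows P (Mm : nat -> R) M g : abs_le Mm M ->
  (forall m, abs_le (fun n => cf (P m) n * g (ex (P m) n) (ey (P m) n)) (Mm m)) ->
  rows_le (fun q : nat * nat => cf (P q.1) q.2 * g (ex (P q.1) q.2) (ey (P q.1) q.2)) M.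
Proof.
move=> hM h N K; apply: le_trans (hM N); apply: ler_sum => m _ /=.
by apply: le_trans (ler_norm _); exact: h.
Qed.

Lemma nb_rU w P Mm M : abs_le Mm M -> (forall m, nb w (P m) (Mm m)) ->
  nb w (rU P) M.
Proof.
move=> hM h; rewrite /nb rU_term.
by have [] := sm_unpk (rU_rows hM h).
Qed.

Lemma lf_rU w P Mm M g C : abs_le Mm M -> (forall m, nb w (P m) (Mm m)) ->
  dmd g w C -> lf g (rU P) = sm (fun m => lf g (P m)).
Proof.
move=> hM h hd; rewrite /lf rU_term.
have h' m : abs_le (fun n => cf (P m) n * g (ex (P m) n) (ey (P m) n)) (C * Mm m).
  exact: dmd_abs_le (h m) hd.
have hM' : abs_le (fun m => C * Mm m) (C * M).
  by have := abs_leZ C hM; rewrite (ger0_norm hd.1).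
by have [_ ->] := sm_unpk (rU_rows hM' h').
Qed.

(** With this weight [nb] bounds the sum of |c| r^(i + j), the norm of the Banach algebra of series
    converging absolutely on the closed square of radius r. *)
Definition pw (r : R) i j := r ^+ (i + j).
Definition mon (h k : R) i j := h ^+ i * k ^+ j.

Lemma dmd_mon h k r : `|h| <= r -> `|k| <= r -> dmd (mon h k) (pw r) 1.
Proof.
move=> hh hk; split=> // i j; rewrite mul1r /mon /pw normrM !normrX exprD.
have r0 : 0 <= r by apply: le_trans hh.
by rewrite (ger0_norm r0); apply: ler_pM; rewrite ?exprn_ge0 ?lerXn2r ?nnegrE.
Qed.

(* [f] is the sum of a power series of norm at most [M] on the square of radius [r]. *)
Definition pser (r : R) (f : R * R -> R) (M : R) := exists p, nb (pw r) p M /\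
  forall h k, `|h| <= r -> `|k| <= r -> f (h, k) = lf (mon h k) p.

Implicit Types f : R * R -> R.

Lemma pser_bound r f M h k : pser r f M -> `|h| <= r -> `|k| <= r -> `|f (h, k)| <= M.
Proof.
move=> [p [hp hf]] hh hk; rewrite hf // -[M]mul1r.
by apply: lf_bound hp _; exact: dmd_mon.
Qed.

Lemma pser_ge0 r f M : pser r f M -> 0 <= M.
Proof. by move=> [p [/abs_le_ge0]]. Qed.

Lemma pser_ext r f f' M : (forall h k, `|h| <= r -> `|k| <= r -> f (h, k) = f' (h, k)) ->
  pser r f M -> pser r f' M.
Proof. by move=> e [p [hp hf]]; exists p; split=> // h k hh hk; rewrite -e // hf. Qed.

Lemma pser_le r f M M' : M <= M' -> pser r f M -> pser r f M'.
Proof. by move=> e [p [hp hf]]; exists p; split=> //; exact: abs_le_trans hp. Qed.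

Lemma nb_mono s r p M : 0 <= s -> s <= r -> nb (pw r) p M -> nb (pw s) p M.
Proof.
move=> s0 sr; apply: abs_le_dom => n; rewrite !normrM ler_wpM2l // /pw !normrX.
have r0 := le_trans s0 sr.
by rewrite lerXn2r ?nnegrE // !ger0_norm.
Qed.

Lemma pser_mono s r f M : 0 <= s -> s <= r -> pser r f M -> pser s f M.
Proof.
move=> s0 sr [p [hp hf]]; exists p; split; first exact: nb_mono hp.
by move=> h k hh hk; apply: hf; exact: le_trans sr.
Qed.

Lemma pser_monomial r c i j : 0 <= r -> pser r (fun z => c * z.1 ^+ i * z.2 ^+ j) (`|c| * r ^+ (i + j)).
Proof.
move=> r0; exists (Rep (fun n => if n == 0%N then c else 0) (fun _ => i) (fun _ => j)).
split=> [|h k _ _].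
  move=> [|N]; first by rewrite big_geq // mulr_ge0 ?exprn_ge0.
  rewrite big_nat_recl //= big1 => [|n _]; last by rewrite mul0r normr0.
  by rewrite addr0 normrM /pw normrX (ger0_norm r0).
rewrite /lf /= (@sm_fin _ _ 1) => [|[|n]] //; last by rewrite mul0r.
by rewrite big_nat1 /mon /= mulrA.
Qed.

Lemma pser_cst r c : 0 <= r -> pser r (fun=> c) `|c|.
Proof.
move=> r0; apply: pser_le (pser_ext _ (pser_monomial c 0 0 r0)); first by rewrite expr0 mulr1.
by move=> h k _ _; rewrite /= !mulr1.
Qed.

Lemma pser_fst r : 0 <= r -> pser r fst r.
Proof.
move=> r0; have := pser_monomial 1 1 0 r0; rewrite normr1 mul1r expr1.
by apply: pser_ext => h k _ _; rewrite /= mul1r mulr1.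
Qed.

Lemma pser_snd r : 0 <= r -> pser r snd r.
Proof.
move=> r0; have := pser_monomial 1 0 1 r0; rewrite normr1 mul1r expr1.
by apply: pser_ext => h k _ _; rewrite /= mul1r mul1r.
Qed.

Lemma pser_sm r (f : nat -> R * R -> R) Mm M : (forall m, pser r (f m) (Mm m)) ->
  abs_le Mm M -> pser r (fun z => sm (fun m => f m z)) M.
Proof.
move=> /choice [P hP] hM; exists (rU P); split.
  by apply: nb_rU hM _ => m; have [] := hP m.
move=> h k hh hk; rewrite (lf_rU hM _ (dmd_mon hh hk)); last by move=> m; have [] := hP m.
by congr sm; apply/funext => m; have [_ ->] := hP m.
Qed.

Definition radd (u v : rep) : rep := rU (fun m => if m is 0%N then u else if m is 1%N then v else
  Rep (fun=> 0) (fun=> 0%N) (fun=> 0%N)).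

Lemma nb0 w : nb w (Rep (fun=> 0) (fun=> 0%N) (fun=> 0%N)) 0.
Proof. by move=> N; rewrite big1 // => i _; rewrite mul0r normr0. Qed.

Lemma abs_le2 M M' : 0 <= M -> 0 <= M' ->
  abs_le (fun m => if m is 0%N then M else if m is 1%N then M' else 0) (M + M').
Proof.
move=> M0 M0' [|[|N]].
- by rewrite big_geq // addr_ge0.
- by rewrite big_nat1 /= ger0_norm // lerDl.
- rewrite !big_nat_recl //= big1 => [|i _]; last by rewrite normr0.
  by rewrite addr0 !ger0_norm.
Qed.

Lemma nb_radd w (u v : rep) M M' : nb w u M -> nb w v M' -> nb w (radd u v) (M + M').
Proof.
move=> hu hv; apply: nb_rU (abs_le2 (abs_le_ge0 hu) (abs_le_ge0 hv)) _.
by move=> [|[|m]] //; exact: nb0.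
Qed.

Lemma lf_radd w (u v : rep) M M' g C : nb w u M -> nb w v M' -> dmd g w C ->
  lf g (radd u v) = lf g u + lf g v.
Proof.
move=> hu hv hd; rewrite (lf_rU (abs_le2 (abs_le_ge0 hu) (abs_le_ge0 hv)) _ hd); last first.
  by move=> [|[|m]] //; exact: nb0.
rewrite (@sm_fin _ _ 2) => [|[|[|n]]] //.
  by rewrite big_nat_recl // big_nat1.
by move=> _; rewrite /lf /= -[RHS](sm0 R); congr sm; apply/funext => m; rewrite mul0r.
Qed.

Lemma pser_add r f (g : R * R -> R) M M' : pser r f M -> pser r g M' -> pser r (fun z => f z + g z) (M + M').
Proof.
move=> [p [hp hf]] [q [hq hg]]; exists (radd p q); split; first exact: nb_radd.
by move=> h k hh hk; rewrite hf // hg // (lf_radd hp hq (dmd_mon hh hk)).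
Qed.

Lemma pser_mulmono r f M c i j : 0 <= r -> pser r f M ->
  pser r (fun z => c * z.1 ^+ i * z.2 ^+ j * f z) (`|c| * r ^+ (i + j) * M).
Proof.
move=> r0 [p [hp hf]].
exists (Rep (fun n => c * cf p n) (fun n => (i + ex p n)%N) (fun n => (j + ey p n)%N)); split.
  rewrite -[`|c| * _]ger0_norm; last by rewrite mulr_ge0 ?exprn_ge0.
  apply: abs_le_dom (abs_leZ (`|c| * r ^+ (i + j)) hp) => n /=.
  rewrite !normrM /pw !normrX normr_id addnACA exprD (ger0_norm r0).
  by rewrite [X in X <= _](_ : _ = `|c| * r ^+ (i + j) * (`|cf p n| * r ^+ (ex p n + ey p n))) //; ring.
move=> h k hh hk; rewrite hf // /lf -(smZ _ (dmd_abs_le hp (dmd_mon hh hk))).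
by congr sm; apply/funext => n; rewrite /mon /= !exprD; ring.
Qed.

Lemma pser_scale r f M c : 0 <= r -> pser r f M -> pser r (fun z => c * f z) (`|c| * M).
Proof.
move=> r0 h; apply: pser_le (pser_ext _ (pser_mulmono c 0 0 r0 h)); first by rewrite expr0 mulr1.
by move=> x y _ _; rewrite /= !mulr1.
Qed.

Lemma pser_opp r f M : 0 <= r -> pser r f M -> pser r (fun z => - f z) M.
Proof.
move=> r0 h; have := pser_scale (-1) r0 h; rewrite normrN1 mul1r.
by apply: pser_ext => x y _ _; rewrite mulN1r.
Qed.

(** The product is the sum, over the monomials of f, of that monomial times g. This makes the norm
    submultiplicative without any Cauchy product. *)
Lemma pser_mul r f (g : R * R -> R) M M' : 0 <= r -> pser r f M -> pser r g M' -> pser r (fun z => f z * g z) (M * M').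
Proof.
move=> r0 [p [hp hf]] hg.
have h1 n := pser_mulmono (cf p n) (ex p n) (ey p n) r0 hg.
have h2 : abs_le (fun n => `|cf p n| * r ^+ (ex p n + ey p n) * M') (M * M').
  rewrite [M * _]mulrC -[X in X * M](ger0_norm (pser_ge0 hg)).
  apply: abs_le_dom (abs_leZ M' hp) => n.
  by rewrite /pw !normrM normr_id mulrC.
apply: pser_ext (pser_sm h1 h2) => h k hh hk; rewrite hf //= /lf mulrC.
rewrite -(smZ _ (dmd_abs_le hp (dmd_mon hh hk))).
by congr sm; apply/funext => n; rewrite /mon; ring.
Qed.

Lemma pser_exp r f M n : 0 <= r -> pser r f M -> pser r (fun z => f z ^+ n) (M ^+ n).
Proof.
move=> r0 h; elim: n => [|n IH].
  by rewrite expr0 -[X in pser _ _ X]normr1; exact: pser_cst.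
rewrite exprS; apply: pser_ext (pser_mul r0 h IH) => x y _ _.
by rewrite exprS.
Qed.

(** Substituting functions of norm at most [rho] in c x^i y^j gives norm at most |c| rho^(i + j),
    and these bounds sum to that of f. The inner functions may have nonzero constant terms. *)
Lemma pser_comp r rho f (g1 g2 : R * R -> R) M : 0 <= r -> pser rho f M -> pser r g1 rho -> pser r g2 rho ->
  pser r (fun z => f (g1 z, g2 z)) M.
Proof.
move=> r0 [p [hp hf]] h1 h2; have rho0 := pser_ge0 h1.
have h n : pser r (fun z => cf p n * (g1 z ^+ ex p n * g2 z ^+ ey p n)) (`|cf p n * pw rho (ex p n) (ey p n)|).
  rewrite normrM /pw normrX exprD (ger0_norm rho0).
  by apply: pser_scale => //; apply: pser_mul => //; exact: pser_exp.
apply: pser_ext (pser_sm h _) => [x y hx hy|N].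
  by rewrite /= hf // ; [exact: pser_bound h1 _ _|exact: pser_bound h2 _ _].
by under eq_bigr do rewrite normr_id; exact: hp.
Qed.

(** The three parts are the terms of degree 0, 1 and at least 2 in the second d of (d + d)^i. They
    majorise the Taylor expansion of (x + h)^i at x, each degree in h giving a factor e. *)
Lemma pow_expansion (d e x h : R) i : 0 <= d -> 0 <= e <= 1 -> `|x| <= d -> `|h| <= e * d ->
  exists a0 a1 a2 : R, [/\ 0 <= a0, 0 <= a1 & 0 <= a2] /\ a0 + a1 + a2 = (d + d) ^+ i /\
  [/\ `|x ^+ i| <= a0, `|i%:R * x ^+ i.-1 * h| <= e * a1 &
      `|(x + h) ^+ i - x ^+ i - i%:R * x ^+ i.-1 * h| <= e ^+ 2 * a2].
Proof.
move=> d0 /andP[e0 e1] hx hh; elim: i => [|i [a0 [a1 [a2 [[p0 p1 p2] [hs [h0 h1 h2]]]]]]].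
  exists 1, 0, 0; split; first by split.
  split; first by rewrite !addr0 expr0.
  by rewrite !expr0 !mul0r normr1 subrr subr0 normr0 !mulr0.
set al0 := x ^+ i in h0 h1 h2 *; set al1 := i%:R * x ^+ i.-1 * h in h1 h2 *.
set al2 := (x + h) ^+ i - al0 - al1 in h2.
have E1 : i.+1%:R * x ^+ i.+1.-1 * h = x * al1 + h * al0.
  rewrite /al1 /al0 /=; case: (i) => [|k]; first by rewrite /= !mul0r mulr0 add0r mulrC mul1r.
  by rewrite /= exprS -[in LHS]natr1; ring.
have E2 : (x + h) ^+ i.+1 - x ^+ i.+1 - i.+1%:R * x ^+ i.+1.-1 * h = x * al2 + h * al1 + h * al2.
  by rewrite E1 /al2 !exprS -/al0; ring.
exists (d * a0), (d * (a0 + a1)), (d * (a1 + a2 + a2)); split.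
  by split; rewrite mulr_ge0 ?addr_ge0.
split; first by rewrite exprS -hs; ring.
have ed : e * d <= d by rewrite -[leRHS]mul1r ler_wpM2r.
split.
- by rewrite exprS normrM ler_pM.
- rewrite E1; apply: le_trans (ler_normD _ _) _; rewrite [`|x * _|]normrM [`|h * _|]normrM.
  apply: (@le_trans _ _ (d * (e * a1) + e * d * a0)); last by rewrite le_eqVlt; apply/orP; left; apply/eqP; ring.
  by apply: lerD; apply: ler_pM.
- rewrite E2; apply: le_trans (ler_normD _ _) _.
  apply: le_trans (lerD (ler_normD _ _) (lexx _)) _.
  rewrite [`|x * _|]normrM [`|h * al1|]normrM [`|h * al2|]normrM.
  apply: (@le_trans _ _ (d * (e ^+ 2 * a2) + e * d * (e * a1) + d * (e ^+ 2 * a2))); last first.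
    by rewrite le_eqVlt; apply/orP; left; apply/eqP; ring.
  apply: lerD; first by apply: lerD; apply: ler_pM.
  by apply: ler_pM => //; exact: le_trans ed.
Qed.

(** The partial derivatives of a monomial, as linear forms on series. At exponent 0 the truncated
    predecessor is harmless because of the factor 0. *)
Definition dmx (x y : R) i j := i%:R * x ^+ i.-1 * y ^+ j.
Definition dmy (x y : R) i j := x ^+ i * (j%:R * y ^+ j.-1).

(** Cauchy estimate: going from radius d + d to d costs 1 / d. It is the first order part of
    [pow_expansion] with h = d and e = 1. *)
Lemma dmd_dmx d x y : 0 < d -> `|x| <= d -> `|y| <= d -> dmd (dmx x y) (pw (d + d)) d^-1.
Proof.
move=> d0 hx hy; split=> [|i j]; first by rewrite invr_ge0 ltW.
have d0' := ltW d0.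
have h1 : `|d| <= 1 * d by rewrite mul1r ger0_norm.
have e1 : (0 : R) <= (1 : R) <= 1 by rewrite ler01 /=.
have [a0 [a1 [a2 [[p0 p1 p2] [hs [_ k1 _]]]]]] := pow_expansion i d0' e1 hx h1.
have h2 : `|y ^+ j| <= (d + d) ^+ j.
  rewrite normrX lerXn2r ?nnegrE ?addr_ge0 //; apply: le_trans hy _; lra.
rewrite mulrC ler_pdivlMr // /dmx /pw normrX ger0_norm ?addr_ge0 // exprD.
rewrite normrM mulrAC; apply: ler_pM => //; first by rewrite mulr_ge0.
rewrite mul1r normrM (ger0_norm d0') in k1; apply: le_trans k1 _.
by rewrite -hs; lra.
Qed.

Lemma dmd_dmy d x y : 0 < d -> `|x| <= d -> `|y| <= d -> dmd (dmy x y) (pw (d + d)) d^-1.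
Proof.
move=> d0 hx hy; have [h1 h2] := dmd_dmx d0 hy hx; split=> // i j.
by have := h2 j i; rewrite /dmx /dmy /pw [X in `|X|]mulrC addnC.
Qed.

Lemma dmd_rem d e x y h k : 0 < d -> 0 <= e <= 1 -> `|x| <= d -> `|y| <= d ->
  `|h| <= e * d -> `|k| <= e * d ->
  dmd (fun i j => mon (x + h) (y + k) i j + (- 1 * mon x y i j + (- h * dmx x y i j + - k * dmy x y i j)))
    (pw (d + d)) (e ^+ 2).
Proof.
move=> d0 e1 hx hy hh hk; split=> [|i j]; first by rewrite exprn_ge0 //; case/andP: e1.
have [a0 [a1 [a2 [[p0 p1 p2] [hs [k0 k1 k2]]]]]] := pow_expansion i (ltW d0) e1 hx hh.
have [b0 [b1 [b2 [[q0 q1 q2] [ht [l0 l1 l2]]]]]] := pow_expansion j (ltW d0) e1 hy hk.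
case/andP: e1 => e0 e1.
rewrite /pw exprD -hs -ht [in leRHS]ger0_norm; last by rewrite mulr_ge0 // !addr_ge0.
rewrite /mon /dmx /dmy.
move: k0 k1 k2 l0 l1 l2.
set A0 := x ^+ i; set A1 := i%:R * x ^+ i.-1 * h.
set B0 := y ^+ j; set B1 := j%:R * y ^+ j.-1 * k.
have -> : (x + h) ^+ i = A0 + A1 + ((x + h) ^+ i - A0 - A1) by ring.
have -> : (y + k) ^+ j = B0 + B1 + ((y + k) ^+ j - B0 - B1) by ring.
set A2 := (x + h) ^+ i - A0 - A1; set B2 := (y + k) ^+ j - B0 - B1.
have K (a b c : R) : a + b + c - a - b = c by ring.
rewrite !K => k0 k1 k2 l0 l1 l2.
(* The products of total order 0 and 1 cancel; the six that remain all carry a factor e^2. *)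
rewrite [X in `|X|](_ : _ = A0 * B2 + A1 * B1 + A1 * B2 + A2 * B0 + A2 * B1 + A2 * B2); last first.
  by rewrite /A1 /B1; ring.
have e2 : 0 <= e ^+ 2 by rewrite exprn_ge0.
have e21 : e ^+ 2 <= e by rewrite expr2 -[leRHS]mul1r ler_wpM2r.
have e2' : e ^+ 2 <= 1 by exact: le_trans e1.
have E0 : `|A0 * B2| <= e ^+ 2 * (a0 * b2).
  by rewrite normrM mulrCA ler_pM.
have E1 : `|A1 * B1| <= e ^+ 2 * (a1 * b1).
  by rewrite normrM expr2 mulrACA ler_pM.
have E2 : `|A1 * B2| <= e ^+ 2 * (a1 * b2).
  rewrite normrM mulrCA ler_pM //; apply: le_trans k1 _.
  by rewrite -[leRHS]mul1r ler_wpM2r.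
have E3 : `|A2 * B0| <= e ^+ 2 * (a2 * b0) by rewrite normrM mulrA ler_pM.
have E4 : `|A2 * B1| <= e ^+ 2 * (a2 * b1).
  rewrite normrM mulrA ler_pM //; apply: le_trans l1 _.
  by rewrite -[leRHS]mul1r ler_wpM2r.
have E5 : `|A2 * B2| <= e ^+ 2 * (a2 * b2).
  rewrite normrM mulrA ler_pM //; apply: le_trans l2 _.
  by rewrite -[leRHS]mul1r ler_wpM2r.
do 5 (apply: le_trans (ler_normD _ _) _; rewrite -lerBrDr).
have z0 : 0 <= e ^+ 2 * (a0 * b0) by rewrite !mulr_ge0.
have z1 : 0 <= e ^+ 2 * (a0 * b1) by rewrite !mulr_ge0.
have z2 : 0 <= e ^+ 2 * (a1 * b0) by rewrite !mulr_ge0.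
move: E0 E1 E2 E3 E4 E5 z0 z1 z2.
move: `|A0 * B2| `|A1 * B1| `|A1 * B2| `|A2 * B0| `|A2 * B1| `|A2 * B2| (e ^+ 2).
move=> v0 v1 v2 v3 v4 v5 ee; rewrite !mulrDl !mulrDr.
lra.
Qed.

(** Linear forms dominated by the weight are bounded by the norm, so the remainder need only be
    estimated on monomials. Differentiability of series and the values of their derivatives follow
    from this inequality. *)
Lemma lf_taylor d p M e x y h k : 0 < d -> nb (pw (d + d)) p M -> 0 <= e <= 1 ->
  `|x| <= d -> `|y| <= d -> `|h| <= e * d -> `|k| <= e * d ->
  `|lf (mon (x + h) (y + k)) p - lf (mon x y) p - h * lf (dmx x y) p - k * lf (dmy x y) p|
  <= e ^+ 2 * M.
Proof.
move=> d0 hp e1 hx hy hh hk.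
have dd : d <= d + d by lra.
have hm : dmd (mon x y) (pw (d + d)) 1 by apply: dmd_mon; exact: le_trans dd.
have ed : e * d <= d by case/andP: e1 => e0 e1; rewrite -[leRHS]mul1r ler_wpM2r // ltW.
have hm' : dmd (mon (x + h) (y + k)) (pw (d + d)) 1.
  apply: dmd_mon; apply: le_trans (ler_normD _ _) _; apply: lerD => //; exact: le_trans ed.
have hX := dmd_dmx d0 hx hy; have hY := dmd_dmy d0 hx hy.
have := lf_bound hp (dmd_rem d0 e1 hx hy hh hk).
have kX := dmdZ (- h) hX; have kY := dmdZ (- k) hY.
have km := dmdZ (- 1) hm.
rewrite (lfD hp hm' (dmdD km (dmdD kX kY))) (lfD hp km (dmdD kX kY)) (lfD hp kX kY).
rewrite (lfZ _ hp hm) (lfZ _ hp hX) (lfZ _ hp hY).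
by rewrite !mulNr !mul1r !addrA.
Qed.

Definition rdx p := Rep (fun n => cf p n * (ex p n)%:R) (fun n => (ex p n).-1) (ey p).
Definition rdy p := Rep (fun n => cf p n * (ey p n)%:R) (ex p) (fun n => (ey p n).-1).

Lemma lf_rdx x y p : lf (mon x y) (rdx p) = lf (dmx x y) p.
Proof. by congr sm; apply/funext => n; rewrite /mon /dmx /= !mulrA. Qed.

Lemma lf_rdy x y p : lf (mon x y) (rdy p) = lf (dmy x y) p.
Proof. by congr sm; apply/funext => n; rewrite /mon /dmy /=; ring. Qed.

Lemma lf_rdxy g p : lf g (rdx (rdy p)) = lf g (rdy (rdx p)).
Proof. by congr sm; apply/funext => n /=; congr (_ * _); exact: mulrAC. Qed.

Lemma nb_rdx d p M : 0 < d -> nb (pw (d + d)) p M -> nb (pw d) (rdx p) (d^-1 * M).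
Proof.
move=> d0 hp; have hd : `|d| <= d by rewrite ger0_norm // ltW.
have := dmd_abs_le hp (dmd_dmx d0 hd hd).
by apply: abs_le_dom => n; rewrite /= /dmx /pw exprD !mulrA.
Qed.

Lemma nb_rdy d p M : 0 < d -> nb (pw (d + d)) p M -> nb (pw d) (rdy p) (d^-1 * M).
Proof.
move=> d0 hp; have hd : `|d| <= d by rewrite ger0_norm // ltW.
have := dmd_abs_le hp (dmd_dmy d0 hd hd).
apply: abs_le_dom => n; rewrite /= /dmy /pw exprD.
by rewrite [X in `|X| <= _](_ : _ = cf p n * (d ^+ ex p n * ((ey p n)%:R * d ^+ (ey p n).-1))) //; ring.
Qed.

End reps.

(** * Homogeneous parts, order of vanishing and uniqueness of power series *)

Section collect.
Variable R : realType.
Implicit Types (p : rep R) (r h k t d C M : R) (f : R * R -> R).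

Definition hpart (a : nat -> nat -> R) m (h k : R) : R :=
  \sum_(i < m.+1) a i (m - i)%N * h ^+ i * k ^+ (m - i).

Definition hnorm (a : nat -> nat -> R) m : R := \sum_(i < m.+1) `|a i (m - i)%N|.

Lemma hpartZ a m t h k : hpart a m (t * h) (t * k) = t ^+ m * hpart a m h k.
Proof.
rewrite /hpart mulr_sumr; apply: eq_bigr => i _.
have -> : t ^+ m = t ^+ i * t ^+ (m - i) by rewrite -exprD subnKC ?leq_ord.
rewrite !exprMn; ring.
Qed.

Definition dlt (i j i' j' : nat) : R := ((i' == i) && (j' == j))%:R.

Lemma dmd_dlt r i j : 0 < r -> dmd (dlt i j) (pw r) (r ^- (i + j)).
Proof.
move=> r0; split=> [|i' j']; first by rewrite invr_ge0 exprn_ge0 // ltW.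
rewrite /dlt /pw; case: eqP => [->|] /=; last by rewrite normr0 mulr_ge0 // invr_ge0 exprn_ge0 // ltW.
case: eqP => [->|] /=; last by rewrite normr0 mulr_ge0 // invr_ge0 exprn_ge0 // ltW.
by rewrite normr1 ger0_norm ?exprn_ge0 ?(ltW r0) // mulVf // expf_neq0 // gt_eqF.
Qed.

(** The genuine coefficient of x^i y^j, summed over the possibly infinitely many occurrences of this
    monomial in [p]. *)
Definition coll p i j : R := lf (dlt i j) p.

Definition hmon h k m i j : R := (i + j == m)%:R * mon h k i j.

Lemma hpart_coll r p M m h k : 0 < r -> nb (pw r) p M ->
  hpart (coll p) m h k = lf (hmon h k m) p.
Proof.
move=> r0 hp; rewrite /hpart /coll.
transitivity (\sum_(0 <= i < m.+1) lf (fun i' j' => (h ^+ i * k ^+ (m - i)) * dlt i (m - i) i' j') p).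
  rewrite big_mkord; apply: eq_bigr => i _.
  by rewrite (lfZ _ hp (dmd_dlt _ _ r0)); ring.
rewrite -(lf_sum _ hp (fun i => dmdZ _ (dmd_dlt _ _ r0))).
congr lf; apply/funext => i'; apply/funext => j'; rewrite /hmon /mon /dlt.
have [e|ne] := eqVneq (i' + j')%N m.
  have hi : (i' < m.+1)%N by rewrite -e ltnS leq_addr.
  rewrite mul1r big_mkord (bigD1 (Ordinal hi)) //= big1 => [|[i hi'] /eqP ne].
    by rewrite -e addKn !eqxx mulr1 addr0.
  rewrite /= eq_sym; case: eqP => [e'|]; last by rewrite mulr0.
  by case: ne; apply/val_inj.
rewrite mul0r big_mkord big1 // => [[i hi]] _ /=.
case: eqP => [e|]; last by rewrite mulr0.
case: eqP => [e'|]; last by rewrite mulr0.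
by move: ne; rewrite e e' subnKC ?eqxx.
Qed.

Lemma rows_hmon r p M h k : nb (pw r) p M -> `|h| <= r -> `|k| <= r ->
  rows_le (fun q : nat * nat => cf p q.2 * hmon h k q.1 (ex p q.2) (ey p q.2)) M.
Proof.
move=> hp hh hk N K; rewrite exchange_big /=.
have := dmd_abs_le hp (dmd_mon hh hk); rewrite mul1r => /(_ K); apply: le_trans.
apply: ler_sum => n _.
under eq_bigr do rewrite /hmon mulrCA normrM.
rewrite -mulr_suml -[leRHS]mul1r; apply: ler_wpM2r => //.
rewrite big_mkord; have [hN|hN] := ltnP (ex p n + ey p n) N.
  rewrite (bigD1 (Ordinal hN)) //= eqxx normr1 big1 ?addr0 // => i ne.
  by rewrite eq_sym (negbTE (_ : (i : nat) != _)) ?normr0.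
rewrite big1 // => i _; case: eqP => [e|]; last by rewrite normr0.
by have := ltn_ord i; rewrite -e ltnNge hN.
Qed.

(** Grouping by total degree is an exchange of summations: each monomial contributes to exactly one
    degree m. *)
Lemma lf_hpart r p M h k : 0 < r -> nb (pw r) p M -> `|h| <= r -> `|k| <= r ->
  abs_le (fun m => hpart (coll p) m h k) M /\
  lf (mon h k) p = sm (fun m => hpart (coll p) m h k).
Proof.
move=> r0 hp hh hk; have hr := rows_hmon hp hh hk.
have E : (fun m => hpart (coll p) m h k) = (fun m => sm (fun n => cf p n * hmon h k m (ex p n) (ey p n))).
  by apply/funext => m; rewrite (hpart_coll _ _ _ r0 hp).
rewrite E; split; first exact: rows_abs_le_sm hr.
rewrite (sm_swap hr) /=; congr sm; apply/funext => n /=.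
rewrite (@sm_fin _ _ (ex p n + ey p n).+1) => [|m hm]; last first.
  by rewrite /hmon ltn_eqF // mul0r mulr0.
rewrite big_nat_recr //= big_nat big1 => [|m /andP[_ hm]]; last first.
  by rewrite /hmon gtn_eqF // mul0r mulr0.
by rewrite add0r /hmon eqxx mul1r.
Qed.

Lemma coll_bound r p M : 0 < r -> nb (pw r) p M ->
  abs_le (fun m => hnorm (coll p) m * r ^+ m) M.
Proof.
move=> r0 hp.
(* With coefficients replaced by their absolute values and h = k = r, the homogeneous parts of [p']
   bound the terms [hnorm (coll p) m * r ^+ m]. *)
pose p' := Rep (fun n => `|cf p n|) (ex p) (ey p).
have hp' : nb (pw r) p' M by apply: abs_le_dom hp => n; rewrite /= !normrM normr_id.
have hr : `|r| <= r by rewrite ger0_norm // ltW.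
have [h1 _] := lf_hpart r0 hp' hr hr.
apply: abs_le_dom h1 => m.
have hle i j : `|coll p i j| <= coll p' i j.
  have k1 := smP (dmd_abs_le hp (dmd_dlt i j r0)).
  have k2 := smP (dmd_abs_le hp' (dmd_dlt i j r0)).
  have k3 : abs_le (fun n => cf p' n * dlt i j (ex p' n) (ey p' n)) _ := dmd_abs_le hp' (dmd_dlt i j r0).
  apply: cvgn_le (cvg_norm k1) _; apply: nearW => n.
  apply: le_trans (ler_norm_sum _ _ _) _.
  rewrite [leLHS](_ : _ = series (fun n => cf p' n * dlt i j (ex p' n) (ey p' n)) n).
    apply: nondecreasing_cvgn_le; last exact: abs_le_cvg k3.
    by apply: nondecreasing_series => l _ _; apply: mulr_ge0; [exact: normr_ge0|exact: ler0n].
  rewrite /series /=; apply: eq_bigr => l _; rewrite normrM /dlt; congr (_ * _).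
  by rewrite ger0_norm.
rewrite !ger0_norm.
- rewrite /hnorm mulr_suml /hpart; apply: ler_sum => i _.
  rewrite -mulrA -exprD subnKC ?leq_ord //; apply: ler_wpM2r => //.
  by rewrite exprn_ge0 // ltW.
- by apply: sumr_ge0 => i _; rewrite !mulr_ge0 ?exprn_ge0 ?(ltW r0) //; exact: le_trans (hle _ _).
- by rewrite mulr_ge0 ?exprn_ge0 ?(ltW r0) // sumr_ge0.
Qed.

Lemma pser_hpart r a m : 0 <= r -> pser r (fun z => hpart a m z.1 z.2) (hnorm a m * r ^+ m).
Proof.
move=> r0; rewrite /hpart /hnorm mulr_suml.
have h n (b : 'I_n -> R) (c d : 'I_n -> nat) :
    pser r (fun z => \sum_(i < n) b i * z.1 ^+ c i * z.2 ^+ d i) (\sum_(i < n) `|b i| * r ^+ (c i + d i)).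
  elim: n b c d => [|n IH] b c d.
    rewrite big_ord0 -[X in pser _ _ X](normr0 R); apply: pser_ext (pser_cst 0 r0) => x y _ _.
    by rewrite big_ord0.
  rewrite big_ord_recr /=.
  apply: pser_ext (pser_add (IH _ _ _) (pser_monomial (b ord_max) (c ord_max) (d ord_max) r0)) => x y _ _.
  by rewrite big_ord_recr.
have := h m.+1 (fun i => a i (m - i)%N) (fun i => i : nat) (fun i => (m - i)%N).
by under eq_bigr => i _ do rewrite subnKC ?leq_ord //.
Qed.

Lemma pser_collect r f M : 0 < r -> pser r f M -> exists a,
  abs_le (fun m => hnorm a m * r ^+ m) M /\
  forall h k, `|h| <= r -> `|k| <= r ->
    abs_le (fun m => hpart a m h k) M /\ f (h, k) = sm (fun m => hpart a m h k).
Proof.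
move=> r0 [p [hp hf]]; exists (coll p); split; first exact: coll_bound.
by move=> h k hh hk; rewrite hf //; exact: lf_hpart hp _ _.
Qed.

(* Divide by [t ^ m] and let [t] tend to [0], by induction on [m]. *)
Lemma small_coef (b : nat -> R) M C t0 K : abs_le b M -> 0 < t0 ->
  (forall t, 0 < t -> t <= t0 -> `|sm (fun m => t ^+ m * b m)| <= C * t ^+ K) ->
  forall m, (m < K)%N -> b m = 0.
Proof.
move=> hb t00 hC; elim/ltn_ind => m IH mK; apply/eqP; rewrite -normr_eq0 eq_le normr_ge0 andbT.
have M0 := abs_le_ge0 hb.
have C0 : 0 <= C.
  have := hC _ t00 (lexx _); move/(le_trans (normr_ge0 _)).
  by rewrite pmulr_lge0 // exprn_gt0.
have key t : 0 < t -> t <= t0 -> t <= 1 -> `|b m| <= (C + M) * t.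
  move=> tp tt0 t1; have := hC _ tp tt0.
  have h1 : abs_le (fun n => if n == m then t ^+ m * b m else 0) (`|t ^+ m * b m|).
    move=> N; rewrite big_mkord; have [hN|hN] := ltnP m N.
      rewrite (bigD1 (Ordinal hN)) //= eqxx big1 ?addr0 // => i ne.
      by rewrite (negbTE (_ : (i : nat) != m)) // normr0.
    rewrite big1 // => i _; case: eqP => [e|]; last by rewrite normr0.
    by have := ltn_ord i; rewrite e ltnNge hN.
  have h2 : abs_le (fun n => if (m < n)%N then t ^+ n * b n else 0) (t ^+ m.+1 * M).
    rewrite -[t ^+ m.+1]ger0_norm ?exprn_ge0 ?(ltW tp) //.
    apply: abs_le_dom (abs_leZ (t ^+ m.+1) hb) => n; case: ifP => hn; last by rewrite normr0.
    rewrite !normrM; apply: ler_wpM2r => //; rewrite !ger0_norm ?exprn_ge0 ?(ltW tp) //.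
    by apply: ler_wiXn2l => //; exact: ltW.
  rewrite (_ : sm _ = t ^+ m * b m + sm (fun n => if (m < n)%N then t ^+ n * b n else 0)); last first.
    rewrite [X in _ = X + _](_ : _ = sm (fun n => if n == m then t ^+ m * b m else 0)).
      rewrite -(smD h1 h2); congr sm; apply/funext => n.
      by case: (ltngtP n m) => [hn|hn|->]; rewrite ?addr0 ?add0r // IH ?mulr0 // (ltn_trans hn).
    rewrite (@sm_fin _ _ m.+1) => [|n hn]; last by rewrite gtn_eqF.
    rewrite big_nat_recr //= eqxx big_nat big1 ?add0r // => i /andP[_ hi].
    by rewrite ltn_eqF.
  move=> h3; have h4 := sm_abs h2.
  have h5 : t ^+ m * `|b m| <= t ^+ m * ((C + M) * t).
    have -> : t ^+ m * `|b m| = `|t ^+ m * b m| by rewrite normrM [in RHS]ger0_norm // exprn_ge0 // ltW.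
    set S := sm _ in h3 h4.
    have -> : t ^+ m * b m = t ^+ m * b m + S - S by ring.
    apply: le_trans (ler_normB _ _) _; apply: le_trans (lerD h3 h4) _.
    have : t ^+ K <= t ^+ m.+1 by apply: ler_wiXn2l => //; exact: ltW.
    move/(ler_wpM2l C0); rewrite exprS; move: (t ^+ m) => tm; lra.
  by move: h5; rewrite ler_pM2l // exprn_gt0.
rewrite leNgt; apply/negP => bp.
pose t1 := Num.min t0 (Num.min 1 (`|b m| / ((C + M + 1) * 2))).
have CM : 0 < (C + M + 1) * 2 by lra.
have t1p : 0 < t1 by rewrite !lt_min t00 ltr01 divr_gt0.
have := key t1 t1p; rewrite !ge_min lexx /= lexx /= orbT => /(_ isT isT).
have : t1 <= `|b m| / ((C + M + 1) * 2) by rewrite !ge_min lexx !orbT.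
rewrite ler_pdivlMr // => h1 h2; nra.
Qed.

Lemma hpart_small r f M (a : nat -> nat -> R) K C t0 : 0 < r -> 0 < t0 ->
  (forall h k, `|h| <= r -> `|k| <= r ->
    abs_le (fun m => hpart a m h k) M /\ f (h, k) = sm (fun m => hpart a m h k)) ->
  (forall h k t, `|h| <= r -> `|k| <= r -> 0 < t -> t <= t0 -> `|f (t * h, t * k)| <= C * t ^+ K) ->
  forall m h k, (m < K)%N -> hpart a m h k = 0.
Proof.
move=> r0 t00 ha hC m h k mK.
have key x y : `|x| <= r -> `|y| <= r -> hpart a m x y = 0.
  move=> hx hy; have [hb _] := ha _ _ hx hy.
  apply: (@small_coef (fun m => hpart a m x y) M C (Num.min t0 1) K) => //.
    by rewrite lt_min t00 ltr01.
  move=> t tp; rewrite le_min => /andP[tt t1].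
  have hs z : `|z| <= r -> `|t * z| <= r.
    move=> hz; rewrite normrM (gtr0_norm tp); apply: le_trans hz.
    by rewrite -[leRHS]mul1r ler_wpM2r.
  have := hC _ _ _ hx hy tp tt.
  rewrite (ha _ _ (hs _ hx) (hs _ hy)).2; congr (`|_| <= _); congr sm.
  by apply/funext => n; rewrite hpartZ.
(* Homogeneity carries the vanishing from the square of radius r to all arguments. *)
pose s := r / (`|h| + `|k| + 1).
have D : 0 < `|h| + `|k| + 1 by rewrite ltr_wpDl ?addr_ge0.
have sp : 0 < s by rewrite divr_gt0.
have sle z : `|z| <= `|h| + `|k| + 1 -> `|s * z| <= r.
  move=> hz; rewrite normrM (gtr0_norm sp) /s mulrAC ler_pdivrMr //.
  by rewrite ler_pM2l.
have := key (s * h) (s * k) (sle _ _) (sle _ _); rewrite hpartZ.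
have := normr_ge0 h; have := normr_ge0 k => n1 n2.
move=> /(_ _ _)/eqP; rewrite mulf_eq0 expf_eq0 (gt_eqF sp) andbF /= => e.
by apply/eqP/e; lra.
Qed.

(** A form of the Schwarz lemma. The growth bound along rays removes the homogeneous parts of degree
    below K; shrinking the radius by d multiplies every other part by at most d^K. *)
Lemma pser_order r f M K C t0 : 0 < r -> 0 < t0 -> pser r f M ->
  (forall h k t, `|h| <= r -> `|k| <= r -> 0 < t -> t <= t0 -> `|f (t * h, t * k)| <= C * t ^+ K) ->
  forall d, 0 <= d -> d <= 1 -> pser (d * r) f (d ^+ K * M).
Proof.
move=> r0 t00 hA hC d d0 d1; have [a [ha hf]] := pser_collect r0 hA.
have h0 := hpart_small r0 t00 hf hC.
have dr0 : 0 <= d * r by rewrite mulr_ge0 // ltW.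
pose Mm m := if (m < K)%N then 0 else hnorm a m * (d * r) ^+ m.
pose F m := if (m < K)%N then (fun=> 0) else (fun z : R * R => hpart a m z.1 z.2).
have h1 m : pser (d * r) (F m) (Mm m).
  rewrite /F /Mm; case: ifP => _; last exact: pser_hpart.
  by rewrite -[X in pser _ _ X](normr0 R); exact: pser_cst.
have h2 : abs_le Mm (d ^+ K * M).
  rewrite -[d ^+ K]ger0_norm ?exprn_ge0 //.
  apply: abs_le_dom (abs_leZ (d ^+ K) ha) => m; rewrite /Mm; case: ltnP => hm.
    by rewrite normr0.
  rewrite exprMn mulrCA normrM [leRHS]normrM; apply: ler_wpM2r => //.
  rewrite !ger0_norm ?exprn_ge0 //; exact: ler_wiXn2l.
apply: pser_ext (pser_sm h1 h2) => h k hh hk.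
have drr : d * r <= r by rewrite -[leRHS]mul1r ler_wpM2r // ltW.
rewrite (hf _ _ (le_trans hh drr) (le_trans hk drr)).2; congr sm; apply/funext => m.
by rewrite /F; case: ifP => // hm; rewrite h0.
Qed.

(** A function that vanishes near 0 is O(t^K) along rays for every K; K = m + 1 removes the
    homogeneous part of degree m. *)
Lemma pser_zero r f M t0 : 0 < r -> 0 < t0 -> pser r f M ->
  (forall h k, `|h| <= t0 -> `|k| <= t0 -> f (h, k) = 0) ->
  forall h k, `|h| <= r -> `|k| <= r -> f (h, k) = 0.
Proof.
move=> r0 t00 hA h0 h k hh hk; have [a [ha hf]] := pser_collect r0 hA.
rewrite (hf _ _ hh hk).2 -[RHS](sm0 R); congr sm; apply/funext => m.
apply: (@hpart_small r f M a m.+1 0 (t0 / r)) => //; first by rewrite divr_gt0.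
move=> x y t hx hy tp tt; rewrite mul0r h0 ?normr0 //.
  by rewrite normrM (gtr0_norm tp); apply: le_trans (ler_wpM2l (ltW tp) hx) _; rewrite -ler_pdivlMr.
by rewrite normrM (gtr0_norm tp); apply: le_trans (ler_wpM2l (ltW tp) hy) _; rewrite -ler_pdivlMr.
Qed.

End collect.

(** * Analytic functions *)

Lemma diff_quadratic (R : realFieldType) (V W : normedModType R) (f : V -> W)
    (df : {linear V -> W}) (x : V) (C d : R) : continuous df -> 0 <= C -> 0 < d ->
  (forall v, `|v| <= d -> `|f (v + x) - f x - df v| <= C * `|v| ^+ 2) ->
  differentiable f x /\ 'd f x = df :> (V -> W).
Proof.
move=> cont C0 d0 h.
have E : f \o shift x = cst (f x) + df +o_ 0 id.
  apply/eqaddoP => e e0; near=> v.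
  rewrite /= !fctE /= opprD addrA; apply: le_trans (h _ _) _.
    by near: v; exact: nbhs0_le.
  rewrite expr2 mulrA; apply: ler_wpM2r => //.
  have : `|v| <= e / (C + 1) by near: v; apply: nbhs0_le; rewrite divr_gt0 // ltr_wpDl.
  rewrite ler_pdivlMr; last by rewrite ltr_wpDl.
  by rewrite mulrDr mulr1 mulrC; apply: le_trans; rewrite lerDl.
have dE := diff_unique cont E; split=> //.
by apply/diff_locallyP; rewrite dE; split.
Unshelve. all: by end_near.
Qed.

Lemma derive_linear_comb (R : numFieldType) (V W : normedModType R) (f : V -> W)
    (x u v : V) (a b : R) : differentiable f x ->
  'D_(a *: u + b *: v) f x = a *: 'D_u f x + b *: 'D_v f x.
Proof. by move=> df; rewrite !deriveE // linearD !linearZ. Qed.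

Lemma derive_comp (R : numFieldType) (U V W : normedModType R) (f : V -> W)
    (g : U -> V) (x v : U) : differentiable g x -> differentiable f (g x) ->
  'D_v (f \o g) x = 'D_('D_v g x) f (g x).
Proof.
move=> dg df; have dfg := differentiable_comp dg df.
by rewrite !deriveE // diff_comp.
Qed.

Lemma derive_pair (R : numFieldType) (U V W : normedModType R) (f : U -> V)
    (g : U -> W) (x v : U) : differentiable f x -> differentiable g x ->
  'D_v (fun y => (f y, g y)) x = ('D_v f x, 'D_v g x).
Proof.
move=> df dg; have dp : differentiable (fun y => (f y, g y)) x by exact: differentiable_pair.
by rewrite !deriveE // diff_pair.
Qed.

Section analytic.
Variable R : realType.
Implicit Types (r h k t d a b C M : R) (f g : R * R -> R) (z p q : R * R).

Definition pdx f p : R := 'D_((1, 0) : R * R) f p.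
Definition pdy f p : R := 'D_((0, 1) : R * R) f p.

Lemma near_box (P : R * R -> Prop) p :
  (\forall q \near p, P q) <->
  exists2 d, 0 < d & forall h k, `|h| <= d -> `|k| <= d -> P (p.1 + h, p.2 + k).
Proof.
split.
  move/nbhs_ballP => [e /= e0 he]; exists (e / 2); first by rewrite divr_gt0.
  have ee : e / 2 < e by lra.
  move=> h k hh hk; apply: he; split; rewrite /= /ball /= opprD addNKr normrN.
    exact: le_lt_trans ee.
  exact: le_lt_trans ee.
move=> [d d0 hd]; apply/nbhs_ballP; exists d => // q [/= h1 h2].
have := hd (q.1 - p.1) (q.2 - p.2); rewrite !subrKC -surjective_pairing; apply.
  by rewrite distrC ltW.
by rewrite distrC ltW.
Qed.

Definition shf p f := fun z => f (p.1 + z.1, p.2 + z.2).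

(** Analyticity in terms of the norm, on a closed square; [anP] identifies it with [analytic_at]. *)
Definition an f p := exists r M, 0 < r /\ pser r (shf p f) M.

Lemma anP f p : an f p <-> analytic_at f p.
Proof.
split=> [[r [M [r0 hA]]]|[a [r [r0 ha]]]].
  have [a [ha hf]] := pser_collect r0 hA; exists a, r; split=> // h k hh hk.
  have [h1 h2] := hf _ _ (ltW hh) (ltW hk); split.
    apply: (@abs_le_cvg _ _ M); apply: abs_le_dom ha => m.
    rewrite [leLHS]ger0_norm ?sumr_ge0 // ger0_norm; last first.
      by rewrite mulr_ge0 ?exprn_ge0 ?(ltW r0) // sumr_ge0.
    rewrite /hnorm mulr_suml; apply: ler_sum => i _.
    rewrite -mulrA normrM ler_wpM2l // normrM !normrX.
    have -> : r ^+ m = r ^+ i * r ^+ (m - i) by rewrite -exprD subnKC ?leq_ord.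
    have hh' := ltW hh; have hk' := ltW hk.
    by apply: ler_pM; rewrite ?exprn_ge0 ?lerXn2r ?nnegrE ?(ltW r0).
  by have := smP h1; rewrite -h2.
(* At the single point (s, s) the absolute values of the terms are |a i j| s^(i + j), so absolute
   convergence there is a bound on the norm of weight s. *)
pose s := r / 2; have s0 : 0 < s by rewrite divr_gt0.
have sr : s < r by rewrite /s; lra.
have hs : `|s| < r by rewrite gtr0_norm.
have [hc _] := ha s s hs hs.
pose M := limn (series (fun n => \sum_(i < n.+1) `|a i (n - i)%N * s ^+ i * s ^+ (n - i)|)).
have hM : abs_le (fun m => hnorm a m * s ^+ m) M.
  move=> N; rewrite [leLHS](_ : _ = series (fun n => \sum_(i < n.+1) `|a i (n - i)%N * s ^+ i * s ^+ (n - i)|) N).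
    apply: nondecreasing_cvgn_le => //.
    by apply: nondecreasing_series => n _ _; exact: sumr_ge0.
  apply: eq_bigr => n _; rewrite ger0_norm; last first.
    by rewrite mulr_ge0 ?exprn_ge0 ?(ltW s0) // sumr_ge0.
  rewrite /hnorm mulr_suml; apply: eq_bigr => i _.
  by rewrite -mulrA -exprD subnKC ?leq_ord // normrM [in RHS](@ger0_norm _ (s ^+ n)) // exprn_ge0 // ltW.
exists s, M; split=> //; apply: pser_ext (pser_sm (fun m => pser_hpart a m (ltW s0)) hM) => h k hh hk.
have [_ hs'] := ha h k (le_lt_trans hh sr) (le_lt_trans hk sr).
exact: sm_eq.
Qed.

Lemma an_ext f g p : (\forall q \near p, f q = g q) -> an f p -> an g p.
Proof.
move=> /near_box [d d0 hd] [r [M [r0 hA]]].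
exists (Num.min r d), M; split; first by rewrite lt_min r0.
apply: pser_ext (pser_mono _ _ hA); last by rewrite ge_min lexx.
  by move=> h k; rewrite !le_min => /andP[_ hh] /andP[_ hk]; exact: hd.
by rewrite ltW // lt_min r0.
Qed.

(** Re-expansion at a new centre is the substitution of z.1 + w.1 and z.2 + w.2, whose norms are at
    most |z.1| + d and |z.2| + d. *)
Lemma pser_shift r d f M z : 0 <= d -> `|z.1| + d <= r -> `|z.2| + d <= r ->
  pser r f M -> pser d (shf z f) M.
Proof.
move=> d0 h1 h2 hA; apply: (@pser_comp _ _ r _ (fun w => z.1 + w.1) (fun w => z.2 + w.2)) => //.
  by apply: pser_le h1 (pser_add (pser_cst _ d0) (pser_fst d0)).
by apply: pser_le h2 (pser_add (pser_cst _ d0) (pser_snd d0)).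
Qed.

Lemma shf_shf p z f : shf z (shf p f) = shf (p.1 + z.1, p.2 + z.2) f.
Proof. by apply/funext => w; rewrite /shf /= !addrA. Qed.

Lemma an_near f p : an f p -> \forall q \near p, an f q.
Proof.
move=> [r [M [r0 hA]]]; apply/near_box; exists (r / 2); first by rewrite divr_gt0.
move=> h k hh hk; exists (r / 2), M; split; first by rewrite divr_gt0.
rewrite -[X in shf X](_ : (p.1 + (h, k).1, p.2 + (h, k).2) = _) // -shf_shf.
by apply: pser_shift hA; rewrite /=; lra.
Qed.

Lemma an_cst c p : an (fun=> c) p.
Proof. by exists 1, `|c|; split=> //; exact: pser_cst. Qed.

Lemma an_fst p : an fst p.
Proof. by exists 1, (`|p.1| + 1); split=> //; apply: pser_add; [exact: pser_cst|exact: pser_fst]. Qed.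

Lemma an_snd p : an snd p.
Proof. by exists 1, (`|p.2| + 1); split=> //; apply: pser_add; [exact: pser_cst|exact: pser_snd]. Qed.

Lemma an_common f g p : an f p -> an g p -> exists r M M', [/\ 0 < r, pser r (shf p f) M & pser r (shf p g) M'].
Proof.
move=> [r [M [r0 hf]]] [r' [M' [r0' hg]]]; exists (Num.min r r'), M, M'.
have r1 : 0 < Num.min r r' by rewrite lt_min r0.
split=> //; [apply: pser_mono hf|apply: pser_mono hg]; rewrite ?(ltW r1) //.
  by rewrite ge_min lexx.
by rewrite ge_min lexx orbT.
Qed.

Lemma an_add f g p : an f p -> an g p -> an (fun z => f z + g z) p.
Proof.
move=> hf hg; have [r [M [M' [r0 h1 h2]]]] := an_common hf hg.
by exists r, (M + M'); split=> //; exact: pser_add.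
Qed.

Lemma an_mul f g p : an f p -> an g p -> an (fun z => f z * g z) p.
Proof.
move=> hf hg; have [r [M [M' [r0 h1 h2]]]] := an_common hf hg.
by exists r, (M * M'); split=> //; apply: pser_mul => //; exact: ltW.
Qed.

Lemma an_opp f p : an f p -> an (fun z => - f z) p.
Proof.
move=> [r [M [r0 hf]]]; exists r, M; split=> //.
by apply: pser_opp => //; exact: ltW.
Qed.

Lemma an_sub f g p : an f p -> an g p -> an (fun z => f z - g z) p.
Proof. by move=> hf hg; apply: an_add => //; exact: an_opp. Qed.

Lemma an_sum (I : Type) (s : seq I) (P : pred I) (F : I -> R * R -> R) p :
  (forall i, P i -> an (F i) p) -> an (fun z => \sum_(i <- s | P i) F i z) p.
Proof.
move=> h; elim: s => [|i s IH].
  by under eq_fun do rewrite big_nil; exact: an_cst.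
under eq_fun do rewrite big_cons.
by have := h i; case: (P i) => // /(_ isT) hi; exact: an_add.
Qed.

Lemma diff_quad f q a b C d : 0 < d ->
  (forall (h k e : R), 0 <= e <= 1 -> `|h| <= e * d -> `|k| <= e * d ->
    `|f (q.1 + h, q.2 + k) - f q - h * a - k * b| <= e ^+ 2 * C) ->
  differentiable f q /\ forall v, 'D_v f q = v.1 * a + v.2 * b.
Proof.
move=> d0 hq.
pose df (v : R * R) : R := v.1 * a + v.2 * b.
have lin : linear df.
  by move=> c u v; rewrite /df /= /GRing.scale /=; ring.
pose dfM := GRing.isLinear.Build _ _ _ _ df lin.
pose dfL : {linear (R * R)%type -> R} := HB.pack df dfM.
have cont : continuous dfL.
  move=> v; apply: cvgD; apply: cvgMl.
    exact: cvg_fst.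
  exact: cvg_snd.
have C0 : 0 <= C.
  have := hq 0 0 1; rewrite ler01 lexx /= expr1n !mul1r normr0 (ltW d0) => /(_ isT isT isT).
  exact: le_trans.
have [] := @diff_quadratic _ _ _ f dfL q (C / d ^+ 2) d cont _ d0; last first.
- by move=> hd dE; split=> // v; rewrite deriveE // dE.
- move=> v v1; have hv : `|v| = Num.max `|v.1| `|v.2| by rewrite prod_normE.
  have e01 : 0 <= `|v| / d <= 1 by rewrite divr_ge0 ?(ltW d0) //= ler_pdivrMr // mul1r.
  have := hq v.1 v.2 (`|v| / d) e01.
  rewrite divfK ?gt_eqF // {1 2}hv !le_max !lexx orbT => /(_ isT isT).
  rewrite -[(_ + v.1, _)]/(q + v) [q + v]addrC => hle.
  rewrite [X in `|X|](_ : _ = f (v + q) - f q - v.1 * a - v.2 * b); last by rewrite /= /df; ring.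
  by rewrite [leRHS](_ : _ = (`|v| / d) ^+ 2 * C) // expr_div_n; ring.
- by rewrite divr_ge0 // exprn_ge0 // ltW.
Qed.

Lemma rep_diff d f q (P : rep R) M : 0 < d -> nb (pw (d + d)) P M ->
  (forall h k, `|h| <= d + d -> `|k| <= d + d -> f (q.1 + h, q.2 + k) = lf (mon h k) P) ->
  forall h k, `|h| <= d -> `|k| <= d ->
    differentiable f (q.1 + h, q.2 + k) /\
    forall v, 'D_v f (q.1 + h, q.2 + k) = v.1 * lf (dmx h k) P + v.2 * lf (dmy h k) P.
Proof.
move=> d0 hP hf h k hh hk; apply: (@diff_quad _ _ _ _ M d) => // h' k' e e01 hh' hk'.
have ed : e * d <= d by case/andP: e01 => e0 e1; rewrite -[leRHS]mul1r ler_wpM2r // ltW.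
rewrite /= -!addrA !hf.
- by rewrite !addrA; exact: lf_taylor hP e01 hh hk hh' hk'.
- by apply: le_trans hh _; lra.
- by apply: le_trans hk _; lra.
- by apply: le_trans (ler_normD _ _) _; apply: lerD => //; exact: le_trans ed.
- by apply: le_trans (ler_normD _ _) _; apply: lerD => //; exact: le_trans ed.
Qed.

Lemma an_rep f p : an f p -> exists d (P : rep R) M, [/\ 0 < d, nb (pw (d + d)) P M &
  forall h k, `|h| <= d + d -> `|k| <= d + d -> f (p.1 + h, p.2 + k) = lf (mon h k) P].
Proof.
move=> [r [M [r0 [P [hP hf]]]]]; exists (r / 2), P, M.
have -> : r / 2 + r / 2 = r by lra.
by split=> //; rewrite divr_gt0.
Qed.

Lemma an_differentiable f p : an f p -> differentiable f p.
Proof.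
move=> /an_rep [d [P [M [d0 hP hf]]]].
have [] := @rep_diff d f p P M d0 hP hf 0 0; rewrite ?normr0 ?(ltW d0) // !addr0.
by case: p {hf}.
Qed.

Lemma an_continuous f p : an f p -> {for p, continuous f}.
Proof. by move/an_differentiable/differentiable_continuous. Qed.

Lemma an_derive f p v : an f p -> an ('D_v f) p.
Proof.
move=> /an_rep [d [P [M [d0 hP hf]]]].
have hd := rep_diff d0 hP hf.
exists d, (`|v.1| * (d^-1 * M) + `|v.2| * (d^-1 * M)); split=> //.
have hx : pser d (fun z => lf (mon z.1 z.2) (rdx P)) (d^-1 * M).
  by exists (rdx P); split=> //; exact: nb_rdx.
have hy : pser d (fun z => lf (mon z.1 z.2) (rdy P)) (d^-1 * M).
  by exists (rdy P); split=> //; exact: nb_rdy.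
apply: pser_ext (pser_add (pser_scale v.1 (ltW d0) hx) (pser_scale v.2 (ltW d0) hy)) => h k hh hk.
by rewrite /shf /= (hd _ _ hh hk).2 lf_rdx lf_rdy.
Qed.

Lemma an_pdx f p : an f p -> an (pdx f) p.
Proof. exact: an_derive. Qed.

Lemma derive_pd f p (u : R * R) : differentiable f p ->
  'D_u f p = u.1 * pdx f p + u.2 * pdy f p.
Proof.
move=> df; have -> : u = u.1 *: ((1, 0) : R * R) + u.2 *: ((0, 1) : R * R).
  by case: u => a b; congr pair; rewrite /= /GRing.scale /= ?mulr0 ?mulr1 ?addr0 ?add0r.
by rewrite derive_linear_comb //= /GRing.scale /= !mulr0 !mulr1 addr0 add0r.
Qed.

Lemma pd_comp f g1 g2 p (u : R * R) : differentiable f (g1 p, g2 p) ->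
  differentiable g1 p -> differentiable g2 p ->
  'D_u (fun z => f (g1 z, g2 z)) p =
    'D_u g1 p * pdx f (g1 p, g2 p) + 'D_u g2 p * pdy f (g1 p, g2 p).
Proof.
move=> df d1 d2.
have dp : differentiable (fun z => (g1 z, g2 z)) p by exact: differentiable_pair.
by rewrite -[LHS]/('D_u (f \o (fun z => (g1 z, g2 z))) p) derive_comp // derive_pair // derive_pd.
Qed.

(** Termwise, the two orders of differentiation multiply a coefficient by the same two exponents, as
    in [lf_rdxy]. *)
Lemma an_derive_swap f p : an f p -> pdy (pdx f) p = pdx (pdy f) p.
Proof.
move=> /an_rep [d [P [M [d0 hP hf]]]].
have hd := rep_diff d0 hP hf.
have d2 : 0 < d / 2 by rewrite divr_gt0.
have dd : d / 2 + d / 2 = d by lra.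
have hx := nb_rdx d0 hP; have hy := nb_rdy d0 hP; rewrite -dd in hx hy.
have ex h k : `|h| <= d / 2 + d / 2 -> `|k| <= d / 2 + d / 2 ->
    'D_((1, 0) : R * R) f (p.1 + h, p.2 + k) = lf (mon h k) (rdx P).
  by rewrite dd => hh hk; rewrite (hd _ _ hh hk).2 /= mul1r mul0r addr0 lf_rdx.
have ey h k : `|h| <= d / 2 + d / 2 -> `|k| <= d / 2 + d / 2 ->
    'D_((0, 1) : R * R) f (p.1 + h, p.2 + k) = lf (mon h k) (rdy P).
  by rewrite dd => hh hk; rewrite (hd _ _ hh hk).2 /= mul1r mul0r add0r lf_rdy.
have n0 : `|0 : R| <= d / 2 by rewrite normr0 ltW.
have [_ kx] := @rep_diff _ ('D_((1, 0) : R * R) f) p _ _ d2 hx ex 0 0 n0 n0.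
have [_ ky] := @rep_diff _ ('D_((0, 1) : R * R) f) p _ _ d2 hy ey 0 0 n0 n0.
rewrite /pdx /pdy; move: (kx (0, 1)) (ky (1, 0)); rewrite !addr0 -surjective_pairing /= => -> ->.
by rewrite !mul0r !mul1r add0r addr0 -lf_rdx -lf_rdy lf_rdxy.
Qed.

(** The case K = 1 of [pser_order]: the first order Taylor estimate bounds f - f (0, 0) by a
    multiple of t along rays. *)
Lemma pser_small r f M : 0 < r -> pser r f M -> exists M', 0 <= M' /\
  forall d, 0 <= d -> d <= 1 -> pser (d * r) (fun z => f z - f (0, 0)) (d * M').
Proof.
move=> r0 hA; have h0 : `|0 : R| <= r by rewrite normr0 ltW.
have hB := pser_add hA (pser_cst (- f (0, 0)) (ltW r0)).
exists (M + `|- f (0, 0)|); split; first exact: pser_ge0 hB.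
have [P [hP hf]] := hA.
have r2 : 0 < r / 2 by rewrite divr_gt0.
have rr : r / 2 + r / 2 = r by lra.
rewrite -rr in hP hf.
have n0 : `|0 : R| <= r / 2 by rewrite normr0 ltW.
move=> d d0 d1; rewrite -[X in X * (M + _)]expr1.
pose a := lf (dmx 0 0) P; pose b := lf (dmy 0 0) P.
apply: (@pser_order _ r _ _ 1 (r * `|a| + r * `|b| + 2 * M) (1 / 2)) => // h k t hh hk tp tt.
have tr x : `|x| <= r -> `|t * x| <= (2 * t) * (r / 2).
  move=> hx; rewrite normrM (gtr0_norm tp); apply: le_trans (ler_wpM2l (ltW tp) hx) _.
  by rewrite le_eqVlt; apply/orP; left; apply/eqP; field.
have te : 0 <= 2 * t <= 1 by apply/andP; split; lra.
have := lf_taylor r2 hP te n0 n0 (tr _ hh) (tr _ hk).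
have trr x : `|x| <= r -> `|t * x| <= r / 2 + r / 2.
  move=> /tr /le_trans; apply; rewrite rr mulrC -mulrA [2 * t]mulrC.
  have : t * r <= r by rewrite -[leRHS]mul1r ler_wpM2r ?(ltW r0) //; lra.
  lra.
rewrite !add0r -!hf ?trr ?normr0 ?rr ?(ltW r0) // -/a -/b expr1 => hT.
set X := f (t * h, t * k) - f (0, 0) in hT *.
have -> : X = (X - t * h * a - t * k * b) + (t * h * a + t * k * b) by ring.
apply: le_trans (ler_normD _ _) _.
apply: le_trans (lerD hT (ler_normD _ _)) _.
rewrite !normrM (gtr0_norm tp).
have ha : t * `|h| * `|a| <= t * r * `|a|.
  by apply: ler_wpM2r => //; apply: ler_wpM2l => //; exact: ltW.
have hb : t * `|k| * `|b| <= t * r * `|b|.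
  by apply: ler_wpM2r => //; apply: ler_wpM2l => //; exact: ltW.
have M0 := pser_ge0 hA.
have hm : (2 * t) ^+ 2 * M <= 2 * t * M.
  by case/andP: te => t2 t3; apply: ler_wpM2r => //; rewrite expr2 -[leRHS]mulr1; exact: ler_wpM2l.
by apply: le_trans (lerD hm (lerD ha hb)) _; rewrite le_eqVlt; apply/orP; left; apply/eqP; ring.
Qed.

End analytic.

(** * Inverse function theorem *)

Section inverse.
Variable R : realType.
Implicit Types (r s h k t d a b c C M : R) (f g H : R * R -> R) (z p q w : R * R).

(** By [pser_small] the inner functions, less their values at p, have norm O(d) on the square of
    radius d * r. For small d they fit in the radius [rho] of the outer series, which is centred at
    those values. *)
Lemma an_comp f g1 g2 p : an f (g1 p, g2 p) -> an g1 p -> an g2 p ->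
  an (fun z => f (g1 z, g2 z)) p.
Proof.
move=> [rho [M [rho0 hf]]] h1 h2; have [r [M1 [M2 [r0 k1 k2]]]] := an_common h1 h2.
have [N1 [p1 l1]] := pser_small r0 k1; have [N2 [p2 l2]] := pser_small r0 k2.
pose d := Num.min 1 (rho / (N1 + N2 + 1)).
have D0 : 0 < N1 + N2 + 1 by rewrite ltr_wpDl // addr_ge0.
have d0 : 0 < d by rewrite lt_min ltr01 divr_gt0.
have d1 : d <= 1 by rewrite ge_min lexx.
have dr : d * (N1 + N2 + 1) <= rho by rewrite -ler_pdivlMr // ge_min lexx orbT.
have dN1 : d * N1 <= rho.
  by apply: le_trans dr; apply: ler_wpM2l; [exact: ltW|rewrite -addrA lerDl addr_ge0].
have dN2 : d * N2 <= rho.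
  by apply: le_trans dr; apply: ler_wpM2l; [exact: ltW|rewrite addrAC lerDr addr_ge0].
exists (d * r), M; split; first by rewrite mulr_gt0.
have dr0 : 0 <= d * r by rewrite mulr_ge0 // ltW.
have := pser_comp dr0 hf (pser_le dN1 (l1 _ (ltW d0) d1)) (pser_le dN2 (l2 _ (ltW d0) d1)).
by apply: pser_ext => h k _ _; rewrite /shf /= !addr0 -surjective_pairing !subrKC.
Qed.

Lemma half_sum N : \sum_(0 <= n < N) (1 / 2) ^+ n <= 2 :> R.
Proof.
suff -> : \sum_(0 <= n < N) (1 / 2) ^+ n = 2 - 2 * (1 / 2) ^+ N :> R.
  by rewrite lerBlDr lerDl mulr_ge0 // exprn_ge0 // divr_ge0.
elim: N => [|N IH]; first by rewrite big_geq // expr0; lra.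
by rewrite big_nat_recr //= IH exprS; field.
Qed.

Lemma abs_le_half (u : nat -> R) C : 0 <= C -> (forall n, `|u n| <= C * (1 / 2) ^+ n) ->
  abs_le u (C * 2).
Proof.
move=> C0 h N; apply: le_trans (ler_wpM2l C0 (half_sum N)).
by rewrite mulr_sumr; apply: ler_sum.
Qed.

(** The geometric series. The reciprocal is taken as a function of two variables, constant in the
    second, so that [an_comp] applies to it. *)
Lemma an_recip c d : c != 0 -> an (fun z => z.1^-1) (c, d).
Proof.
move=> c0; have nc : 0 < `|c| by rewrite normr_gt0.
have r0 : 0 < `|c| / 2 by rewrite divr_gt0.
exists (`|c| / 2), (`|c|^-1 * 2); split=> //.
have h1 n := pser_monomial (c^-1 * (- c^-1) ^+ n) n 0 (ltW r0).
have h2 : abs_le (fun n => `|c^-1 * (- c^-1) ^+ n| * (`|c| / 2) ^+ (n + 0)) (`|c|^-1 * 2).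
  apply: abs_le_half; first by rewrite invr_ge0.
  move=> n; rewrite addn0 ger0_norm ?mulr_ge0 ?exprn_ge0 ?(ltW r0) //.
  rewrite normrM normrX normrN normfV -mulrA -exprMn; apply: ler_wpM2l; first by rewrite invr_ge0.
  rewrite le_eqVlt; apply/orP; left; apply/eqP; congr (_ ^+ _).
  by field; rewrite gt_eqF.
apply: pser_ext (pser_sm h1 h2) => h k hh _; rewrite /shf /=; apply: sm_eq.
have hc : `|- (h / c)| < 1.
  by rewrite normrN normrM normfV ltr_pdivrMr // mul1r; apply: le_lt_trans hh _; lra.
have := @cvg_geometric_series R c^-1 _ hc.
have ch : c + h != 0.
  apply/eqP => e; have hce : h = - c by lra.
  by move: hh; rewrite hce normrN => hh; lra.
have -> : c^-1 / (1 - - (h / c)) = (c + h)^-1.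
  by field; rewrite c0 ch.
suff -> : (fun m : nat => c^-1 * (- c^-1) ^+ m * h ^+ m * k ^+ 0) = geometric c^-1 (- (h / c)) by [].
apply/funext => n.
by rewrite /= expr0 mulr1 -mulrA -exprMn; congr (_ * _ ^+ _); rewrite mulNr mulrC.
Qed.

Lemma an_inv f p : f p != 0 -> an f p -> an (fun z => (f z)^-1) p.
Proof.
move=> fp hf; apply: (@an_comp (fun z => z.1^-1) f (fun=> 0)) => //.
  exact: an_recip.
exact: an_cst.
Qed.

Lemma an_taylor f p : an f p -> exists r M C, [/\ 0 < r, pser r (shf p f) M &
  forall h k t, `|h| <= r -> `|k| <= r -> 0 < t -> t <= 1 / 2 ->
   `|f (p.1 + t * h, p.2 + t * k) - f p - t * h * pdx f p - t * k * pdy f p| <= C * t ^+ 2].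
Proof.
move=> /an_rep [d [P [M [d0 hP hf]]]]; exists (d + d), M, (4 * M).
have n0 : `|0 : R| <= d by rewrite normr0 ltW.
have n00 : `|0 : R| <= d + d by rewrite normr0 addr_ge0 // ltW.
split; first by rewrite addr_gt0.
  by exists P; split=> // h k hh hk; rewrite /shf hf.
move=> h k t hh hk tp tt.
have [_ kx] := @rep_diff R _ f p P M d0 hP hf 0 0 n0 n0.
rewrite /pdx /pdy; move: (kx (1, 0)) (kx (0, 1)); rewrite !addr0 -surjective_pairing /= => -> ->.
rewrite !mul0r !mul1r add0r addr0.
have tr x : `|x| <= d + d -> `|t * x| <= (2 * t) * d.
  move=> hx; rewrite normrM (gtr0_norm tp); apply: le_trans (ler_wpM2l (ltW tp) hx) _.
  by rewrite le_eqVlt; apply/orP; left; apply/eqP; ring.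
have te : 0 <= 2 * t <= 1 by apply/andP; split; lra.
have := lf_taylor d0 hP te n0 n0 (tr _ hh) (tr _ hk).
have trr x : `|x| <= d + d -> `|t * x| <= d + d.
  move=> hx; rewrite normrM (gtr0_norm tp); apply: le_trans hx.
  by rewrite -[leRHS]mul1r ler_wpM2r //; lra.
rewrite !add0r -!hf ?trr // !addr0 -surjective_pairing.
by congr (_ <= _); rewrite exprMn; ring.
Qed.

(** Telescoping, g^(i + 1) - g'^(i + 1) = (g^i - g'^i) g + g'^i (g - g'). The bound is given a shape
    that is stable under products: with a, c powers of 4 s and b, b' the same powers of 2 s, (a - b)
    b' + b (c - b') <= a c. *)
Lemma pow_lip s g g' d i : 0 < s -> pser s g (2 * s) -> pser s g' (2 * s) ->
  pser s (fun z => g z - g' z) d ->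
  pser s (fun z => g z ^+ i - g' z ^+ i) (d / (2 * s) * ((4 * s) ^+ i - (2 * s) ^+ i)).
Proof.
move=> s0 hg hg' hd; have d0 := pser_ge0 hd; have s0' := ltW s0.
have ds : 0 <= d / (2 * s) by rewrite divr_ge0 // mulr_ge0.
elim: i => [|i IH].
  rewrite !expr0 subrr mulr0 -[X in pser _ _ X](normr0 R).
  exact: pser_cst.
have h1 := pser_mul s0' IH hg.
have h2 := pser_mul s0' (pser_exp i s0' hg') hd.
apply: pser_le (pser_ext _ (pser_add h1 h2)); last by move=> x y _ _; rewrite /= !exprS; ring.
have e : (2 * s) ^+ i * d = d / (2 * s) * ((2 * s) * (2 * s) ^+ i) by field; rewrite gt_eqF.
rewrite {}e -mulrA -mulrDr; apply: ler_wpM2l => //.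
have : (2 * s) ^+ i <= (4 * s) ^+ i.
  by rewrite lerXn2r ?nnegrE ?mulr_ge0 // ler_wpM2r //; lra.
rewrite !exprS => /(ler_wpM2l s0'); lra.
Qed.

(** Substitution in H is Lipschitz with constant M / (2 s): monomial by monomial, [pow_lip] replaces
    the weight 2 s of the inner functions by 4 s. For M = s it contracts by 1 / 2. *)
Lemma pser_lip s H M g1 g2 g1' g2' d : 0 < s -> pser (4 * s) H M ->
  pser s g1 (2 * s) -> pser s g2 (2 * s) -> pser s g1' (2 * s) -> pser s g2' (2 * s) ->
  pser s (fun z => g1 z - g1' z) d -> pser s (fun z => g2 z - g2' z) d ->
  pser s (fun z => H (g1 z, g2 z) - H (g1' z, g2' z)) (d / (2 * s) * M).
Proof.
move=> s0 [P [hP hH]] h1 h2 h1' h2' hd1 hd2; have d0 := pser_ge0 hd1; have s0' := ltW s0.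
have ds : 0 <= d / (2 * s) by rewrite divr_ge0 // mulr_ge0.
have key n : pser s (fun z => cf P n * (g1 z ^+ ex P n * g2 z ^+ ey P n - g1' z ^+ ex P n * g2' z ^+ ey P n))
    (`|cf P n * pw (4 * s) (ex P n) (ey P n)| * (d / (2 * s))).
  move: (ex P n) (ey P n) => i j.
  have k1 := pser_mul s0' (pow_lip i s0 h1 h1' hd1) (pser_exp j s0' h2).
  have k2 := pser_mul s0' (pser_exp i s0' h1') (pow_lip j s0 h2 h2' hd2).
  have k3 := pser_scale (cf P n) s0' (pser_add k1 k2).
  apply: pser_le (pser_ext _ k3); last by move=> x y _ _ /=; ring.
  rewrite [in leRHS]normrM -[leRHS]mulrA; apply: ler_wpM2l => //.
  rewrite /pw normrX ger0_norm ?mulr_ge0 // exprD.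
  have hi m : (2 * s) ^+ m <= (4 * s) ^+ m.
    by rewrite lerXn2r ?nnegrE ?mulr_ge0 // ler_wpM2r //; lra.
  have p0 m : 0 <= (2 * s) ^+ m by rewrite exprn_ge0 // mulr_ge0.
  move: (hi i) (hi j) (p0 i) (p0 j).
  move: ((2 * s) ^+ i) ((4 * s) ^+ i) ((2 * s) ^+ j) ((4 * s) ^+ j) => b a d' c ab cd b0 d0'.
  have E : d / (2 * s) * (a - b) * d' + b * (d / (2 * s) * (c - d')) = (a * d' - b * d' + b * c - b * d') * (d / (2 * s)) by ring.
  rewrite E; apply: ler_wpM2r => //.
  have : 0 <= (a - b) * (c - d') by rewrite mulr_ge0 // subr_ge0.
  have : 0 <= b * d' by rewrite mulr_ge0.
  by clear; move=> x y; rewrite mulrBl !mulrBr in y; lra.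
have hb : abs_le (fun n => `|cf P n * pw (4 * s) (ex P n) (ey P n)| * (d / (2 * s))) (d / (2 * s) * M).
  rewrite -[X in X * M](ger0_norm ds).
  by apply: abs_le_dom (abs_leZ (d / (2 * s)) hP) => n; rewrite normrM normr_id mulrC [leRHS]normrM.
apply: pser_ext (pser_sm key hb) => x y hx hy.
have bb g : pser s g (2 * s) -> `|g (x, y)| <= 4 * s.
  move=> hg; apply: le_trans (pser_bound hg hx hy) _; lra.
have B1 := bb _ h1; have B2 := bb _ h2; have B1' := bb _ h1'; have B2' := bb _ h2'.
rewrite !hH // /lf -[in RHS]mulN1r.
rewrite -(smZ _ (dmd_abs_le hP (dmd_mon B1' B2'))).
rewrite -(smD (dmd_abs_le hP (dmd_mon B1 B2)) (abs_leZ (-1) (dmd_abs_le hP (dmd_mon B1' B2')))).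
by congr sm; apply/funext => n; rewrite /mon; ring.
Qed.

(* The fixed point of [G = id - H G], as the limit of the iterates. *)
Lemma pser_fix s H1 H2 : 0 < s -> pser (4 * s) H1 s -> pser (4 * s) H2 s ->
  exists G1 G2 M, [/\ pser s G1 M, pser s G2 M,
    (forall h k, `|h| <= s -> `|k| <= s ->
       [/\ `|G1 (h, k)| <= 2 * s, `|G2 (h, k)| <= 2 * s,
           G1 (h, k) = h - H1 (G1 (h, k), G2 (h, k)) &
           G2 (h, k) = k - H2 (G1 (h, k), G2 (h, k))]) &
    (H1 (0, 0) = 0 -> H2 (0, 0) = 0 -> G1 (0, 0) = 0 /\ G2 (0, 0) = 0)].
Proof.
move=> s0 hH1 hH2; have s0' := ltW s0.
pose step (G : (R * R -> R) * (R * R -> R)) : (R * R -> R) * (R * R -> R) :=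
  (fun z => z.1 - H1 (G.1 z, G.2 z), fun z => z.2 - H2 (G.1 z, G.2 z)).
pose G n := iter n step (fst, snd).
have s24 : 2 * s <= 4 * s by lra.
have s20 : 0 <= 2 * s by lra.
have k1 := pser_mono s20 s24 hH1; have k2 := pser_mono s20 s24 hH2.
have ss : s + s = 2 * s by ring.
have hG n : pser s (G n).1 (2 * s) /\ pser s (G n).2 (2 * s).
  elim: n => [|n [IH1 IH2]].
    by split; [apply: pser_le (pser_fst s0')|apply: pser_le (pser_snd s0')]; lra.
  rewrite /G iterS -/(G n); split; rewrite -ss; apply: pser_add; rewrite ?pser_fst ?pser_snd //.
  - exact: pser_fst.
  - by apply: pser_opp => //; exact: pser_comp k1 IH1 IH2.
  - exact: pser_snd.
  - by apply: pser_opp => //; exact: pser_comp k2 IH1 IH2.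
have hD n : pser s (fun z => (G n.+1).1 z - (G n).1 z) (s * (1 / 2) ^+ n) /\
            pser s (fun z => (G n.+1).2 z - (G n).2 z) (s * (1 / 2) ^+ n).
  elim: n => [|n [IH1 IH2]].
    rewrite expr0 mulr1; have s4 : s <= 4 * s by lra.
    split.
      by apply: pser_ext (pser_opp s0' (pser_mono s0' s4 hH1)) => x y _ _ /=; ring.
    by apply: pser_ext (pser_opp s0' (pser_mono s0' s4 hH2)) => x y _ _ /=; ring.
  have [a1 a2] := hG n; have [b1 b2] := hG n.+1.
  have e : s * (1 / 2) ^+ n.+1 = s * (1 / 2) ^+ n / (2 * s) * s by rewrite exprS; field; rewrite gt_eqF.
  rewrite e; split.
    by apply: pser_ext (pser_opp s0' (pser_lip s0 hH1 b1 b2 a1 a2 IH1 IH2)) => x y _ _; rewrite /G iterS /=; ring.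
  by apply: pser_ext (pser_opp s0' (pser_lip s0 hH2 b1 b2 a1 a2 IH1 IH2)) => x y _ _; rewrite /G iterS /=; ring.
pose S1 z := z.1 + sm (fun n => (G n.+1).1 z - (G n).1 z).
pose S2 z := z.2 + sm (fun n => (G n.+1).2 z - (G n).2 z).
have hb : abs_le (fun n => s * (1 / 2) ^+ n) (s * 2).
  apply: abs_le_half => // n; rewrite ger0_norm // mulr_ge0 // exprn_ge0 // divr_ge0 //.
have c1 h k : `|h| <= s -> `|k| <= s -> (fun n => (G n).1 (h, k)) @ \oo --> S1 (h, k).
  move=> hh hk; have ha : abs_le (fun n => (G n.+1).1 (h, k) - (G n).1 (h, k)) (s * 2).
    by apply: abs_le_half => // n; have [hx _] := hD n; exact: pser_bound hx hh hk.
  rewrite (_ : (fun n => _) = (fun n => h + series (fun n => (G n.+1).1 (h, k) - (G n).1 (h, k)) n)).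
    by apply: cvgD; [exact: cvg_cst|exact: smP ha].
  by apply/funext => n; rewrite /series /= telescope_sumr //= subrKC.
have c2 h k : `|h| <= s -> `|k| <= s -> (fun n => (G n).2 (h, k)) @ \oo --> S2 (h, k).
  move=> hh hk; have ha : abs_le (fun n => (G n.+1).2 (h, k) - (G n).2 (h, k)) (s * 2).
    by apply: abs_le_half => // n; have [_ hx] := hD n; exact: pser_bound hx hh hk.
  rewrite (_ : (fun n => _) = (fun n => k + series (fun n => (G n.+1).2 (h, k) - (G n).2 (h, k)) n)).
    by apply: cvgD; [exact: cvg_cst|exact: smP ha].
  by apply/funext => n; rewrite /series /= telescope_sumr //= subrKC.
have cont H h k : pser (4 * s) H s -> `|h| <= 2 * s -> `|k| <= 2 * s -> {for (h, k), continuous H}.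
  move=> [P [hP hH]] hh hk; have e4 : 4 * s = 2 * s + 2 * s by ring.
  rewrite e4 in hP hH; have s2 : 0 < 2 * s by lra.
  have hH' x y : `|x| <= 2 * s + 2 * s -> `|y| <= 2 * s + 2 * s ->
      H ((0 : R * R).1 + x, (0 : R * R).2 + y) = lf (mon x y) P.
    by move=> hx hy; rewrite !add0r hH.
  have [hd _] := rep_diff s2 hP hH' hh hk; rewrite !add0r in hd.
  exact: differentiable_continuous hd.
exists S1, S2, (s + s * 2); split.
- by apply: pser_add (pser_fst s0') _; apply: pser_sm hb => n; have [] := hD n.
- by apply: pser_add (pser_snd s0') _; apply: pser_sm hb => n; have [] := hD n.
- move=> h k hh hk.
  have B1 : `|S1 (h, k)| <= 2 * s.
    apply: cvgn_le (cvg_norm (c1 _ _ hh hk)) _; apply: nearW => n.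
    by have [hx _] := hG n; exact: pser_bound hx hh hk.
  have B2 : `|S2 (h, k)| <= 2 * s.
    apply: cvgn_le (cvg_norm (c2 _ _ hh hk)) _; apply: nearW => n.
    by have [_ hx] := hG n; exact: pser_bound hx hh hk.
  have cp : (fun n => ((G n).1 (h, k), (G n).2 (h, k))) @ \oo --> (S1 (h, k), S2 (h, k)).
    exact: (cvg_pair (c1 _ _ hh hk) (c2 _ _ hh hk)).
  split=> //.
    have L1 : (fun n => (G n.+1).1 (h, k)) @ \oo --> S1 (h, k).
      by rewrite (cvg_shiftS (fun n => (G n).1 (h, k))); exact: c1.
    have L2 : (fun n => (G n.+1).1 (h, k)) @ \oo --> h - H1 (S1 (h, k), S2 (h, k)).
      have L3 : (fun n => H1 ((G n).1 (h, k), (G n).2 (h, k))) @ \oo --> H1 (S1 (h, k), S2 (h, k)).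
        exact: (@cvg_comp _ _ _ (fun n => ((G n).1 (h, k), (G n).2 (h, k))) H1 _ _ _ cp (cont _ _ _ hH1 B1 B2)).
      exact: (cvgB (cvg_cst h) L3).
    by rewrite -[LHS](cvg_lim _ L1) // (cvg_lim _ L2).
  have L1 : (fun n => (G n.+1).2 (h, k)) @ \oo --> S2 (h, k).
    by rewrite (cvg_shiftS (fun n => (G n).2 (h, k))); exact: c2.
  have L2 : (fun n => (G n.+1).2 (h, k)) @ \oo --> k - H2 (S1 (h, k), S2 (h, k)).
    have L3 : (fun n => H2 ((G n).1 (h, k), (G n).2 (h, k))) @ \oo --> H2 (S1 (h, k), S2 (h, k)).
      exact: (@cvg_comp _ _ _ (fun n => ((G n).1 (h, k), (G n).2 (h, k))) H2 _ _ _ cp (cont _ _ _ hH2 B1 B2)).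
    exact: (cvgB (cvg_cst k) L3).
  by rewrite -[LHS](cvg_lim _ L1) // (cvg_lim _ L2).
- move=> e1 e2; have z n : (G n).1 (0, 0) = 0 /\ (G n).2 (0, 0) = 0.
    elim: n => [|n [IH1 IH2]] //; rewrite /G iterS -/(G n) /= IH1 IH2 e1 e2.
    by rewrite subr0.
  rewrite /S1 /S2 /= !add0r; split; rewrite -[RHS](sm0 R); congr sm; apply/funext => n.
    by rewrite (z n).1 (z n).2 e1 !subr0.
  by rewrite (z n).1 (z n).2 e2 !subr0.
Qed.

End inverse.

Section inverse_function.
Variable R : realType.
Implicit Types (r s h k t d a b c C M : R) (f g H : R * R -> R) (z p q w : R * R).

Lemma pser_shf0 r f M : pser r f M -> pser r (shf 0 f) M.
Proof. by apply: pser_ext => h k _ _; rewrite /shf /= !add0r. Qed.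

(** Composed with the inverse of its differential, F - F p becomes id + H, where H vanishes to
    second order. By [pser_order] with K = 2 the norm of H on radius d * r is O(d^2), hence at most
    s = d * r / 4 for small d, and [pser_fix] inverts id + H. *)
Lemma an_right_inverse F1 F2 p : an F1 p -> an F2 p ->
  pdx F1 p * pdy F2 p - pdy F1 p * pdx F2 p != 0 ->
  exists G1 G2, let q := (F1 p, F2 p) in
    [/\ an G1 q, an G2 q, (G1 q, G2 q) = p &
     \forall w \near q, F1 (G1 w, G2 w) = w.1 /\ F2 (G1 w, G2 w) = w.2].
Proof.
move=> hF1 hF2; set a := pdx F1 p; set b := pdy F1 p; set c := pdx F2 p; set e := pdy F2 p.
set D := a * e - b * c => D0.
have [r1 [M1 [C1 [r10 hA1 hT1]]]] := an_taylor hF1.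
have [r2 [M2 [C2 [r20 hA2 hT2]]]] := an_taylor hF2.
rewrite -/a -/b in hT1; rewrite -/c -/e in hT2.
pose r := Num.min r1 r2.
have r0 : 0 < r by rewrite lt_min r10.
have rr1 : r <= r1 by rewrite ge_min lexx.
have rr2 : r <= r2 by rewrite ge_min lexx orbT.
have r0' := ltW r0.
have B1 := pser_add (pser_mono r0' rr1 hA1) (pser_cst (- F1 p) r0').
have B2 := pser_add (pser_mono r0' rr2 hA2) (pser_cst (- F2 p) r0').
pose H al be f (z : R * R) : R := al * (F1 (p.1 + z.1, p.2 + z.2) - F1 p) + be * (F2 (p.1 + z.1, p.2 + z.2) - F2 p) - f z.
have key al be f Mf : pser r f Mf -> (forall h k t, f (t * h, t * k) = t * f (h, k)) ->
    (forall h k, f (h, k) = h * (al * a + be * c) + k * (al * b + be * e)) ->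
    exists M, forall d, 0 <= d -> d <= 1 -> pser (d * r) (H al be f) (d ^+ 2 * M).
  move=> hAf hom hf.
  have hA : pser r (H al be f) _ := pser_add (pser_add (pser_scale al r0' B1) (pser_scale be r0' B2)) (pser_opp r0' hAf).
  eexists => d d0 d1.
  apply: (@pser_order _ r _ _ 2 (`|al| * C1 + `|be| * C2) (1 / 2) r0 _ hA) => // h k t hh hk tp tt.
  have T1 := hT1 h k t (le_trans hh rr1) (le_trans hk rr1) tp tt.
  have T2 := hT2 h k t (le_trans hh rr2) (le_trans hk rr2) tp tt.
  rewrite /H /= hom hf.
  set X1 := F1 _ - _ - _ - _ in T1; set X2 := F2 _ - _ - _ - _ in T2.
  rewrite [X in `|X|](_ : _ = al * X1 + be * X2); last by rewrite /X1 /X2; ring.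
  apply: le_trans (ler_normD _ _) _; rewrite !normrM mulrDl -!mulrA.
  by apply: lerD; apply: ler_wpM2l.
(* (e / D, - b / D) and (- c / D, a / D) are the rows of the inverse of the Jacobian matrix. *)
have [N1 hN1] : exists M, forall d, 0 <= d -> d <= 1 -> pser (d * r) (H (e / D) (- b / D) fst) (d ^+ 2 * M).
  apply: key (pser_fst r0') _ _ => //= h k; rewrite /D; field; exact: D0.
have [N2 hN2] : exists M, forall d, 0 <= d -> d <= 1 -> pser (d * r) (H (- c / D) (a / D) snd) (d ^+ 2 * M).
  apply: key (pser_snd r0') _ _ => //= h k; rewrite /D; field; exact: D0.
pose N := `|N1| + `|N2| + 1.
have Np : 0 < N by rewrite /N ltr_wpDl // addr_ge0.
pose d := Num.min 1 (r / (4 * N)).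
have d0 : 0 < d by rewrite lt_min ltr01 divr_gt0 // mulr_gt0.
have d1 : d <= 1 by rewrite ge_min lexx.
have dN : d * (4 * N) <= r by rewrite -ler_pdivlMr ?mulr_gt0 // ge_min lexx orbT.
pose s := d * r / 4.
have s0 : 0 < s by rewrite divr_gt0 // mulr_gt0.
have s4 : d * r = 4 * s by rewrite /s; field.
have small M : M <= N -> d ^+ 2 * M <= s.
  move=> MN; rewrite /s expr2 -!mulrA; apply: ler_wpM2l; first exact: ltW.
  by rewrite ler_pdivlMr // -mulrA; apply: le_trans dN; apply: ler_wpM2l; [exact: ltW|lra].
have hH1 : pser (4 * s) (H (e / D) (- b / D) fst) s.
  rewrite -s4; apply: pser_le (hN1 _ (ltW d0) d1); apply: small.
  by rewrite /N -addrA; apply: le_trans (ler_norm _) _; rewrite lerDl addr_ge0.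
have hH2 : pser (4 * s) (H (- c / D) (a / D) snd) s.
  rewrite -s4; apply: pser_le (hN2 _ (ltW d0) d1); apply: small.
  by rewrite /N addrAC; apply: le_trans (ler_norm _) _; rewrite lerDr addr_ge0.
have [K1 [K2 [MK [hK1 hK2 hfix hzero]]]] := pser_fix s0 hH1 hH2.
have H0 al be f : f (0, 0) = 0 -> H al be f (0, 0) = 0.
  by move=> f0; rewrite /H /= f0 !addr0 -surjective_pairing !subrr !mulr0 addr0 subrr.
have [z1 z2] := hzero (H0 _ _ _ erefl) (H0 _ _ _ erefl).
set q := (F1 p, F2 p).
pose L1 w := e / D * (w.1 - q.1) + - b / D * (w.2 - q.2).
pose L2 w := - c / D * (w.1 - q.1) + a / D * (w.2 - q.2).
have aL al be : an (fun w : R * R => al * (w.1 - q.1) + be * (w.2 - q.2)) q.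
  by apply: an_add; apply: an_mul; rewrite ?an_cst //; try exact: an_cst;
    apply: an_sub; [exact: an_fst|exact: an_cst|exact: an_snd|exact: an_cst].
have L10 : L1 q = 0 by rewrite /L1 !subrr !mulr0 addr0.
have L20 : L2 q = 0 by rewrite /L2 !subrr !mulr0 addr0.
have aK K : pser s K MK -> an K (L1 q, L2 q).
  move=> hK; exists s, MK; split=> //.
  by rewrite L10 L20; exact: pser_shf0.
exists (fun w => p.1 + K1 (L1 w, L2 w)), (fun w => p.2 + K2 (L1 w, L2 w)) => /=.
split.
- by apply: an_add; [exact: an_cst|apply: an_comp; [exact: aK|exact: aL|exact: aL]].
- by apply: an_add; [exact: an_cst|apply: an_comp; [exact: aK|exact: aL|exact: aL]].
- by rewrite L10 L20 z1 z2 !addr0 -surjective_pairing.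
have c1 : \forall w \near q, `|L1 w| <= s.
  have : L1 @ q --> L1 q by exact: (an_continuous (aL _ _)).
  rewrite L10 => /cvgr0Pnorm_le /(_ s s0); exact.
have c2 : \forall w \near q, `|L2 w| <= s.
  have : L2 @ q --> L2 q by exact: (an_continuous (aL _ _)).
  rewrite L20 => /cvgr0Pnorm_le /(_ s s0); exact.
near=> w.
have w1 : `|L1 w| <= s by near: w.
have w2 : `|L2 w| <= s by near: w.
have [_ _ E1 E2] := hfix _ _ w1 w2.
move: E1 E2; set k1 := K1 _; set k2 := K2 _; rewrite /H /=.
set y1 := F1 (p.1 + k1, p.2 + k2); set y2 := F2 (p.1 + k1, p.2 + k2) => E1 E2.
have E1' : e / D * (y1 - F1 p) + - b / D * (y2 - F2 p) = L1 w by move: E1; lra.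
have E2' : - c / D * (y1 - F1 p) + a / D * (y2 - F2 p) = L2 w by move: E2; lra.
have X1 : y1 - F1 p = a * (e / D * (y1 - F1 p) + - b / D * (y2 - F2 p)) + b * (- c / D * (y1 - F1 p) + a / D * (y2 - F2 p)).
  by rewrite /D; field; exact: D0.
have X2 : y2 - F2 p = c * (e / D * (y1 - F1 p) + - b / D * (y2 - F2 p)) + e * (- c / D * (y1 - F1 p) + a / D * (y2 - F2 p)).
  by rewrite /D; field; exact: D0.
rewrite E1' E2' in X1 X2.
have X1' : w.1 - F1 p = a * L1 w + b * L2 w by rewrite /L1 /L2 /D /=; field; exact: D0.
have X2' : w.2 - F2 p = c * L1 w + e * L2 w by rewrite /L1 /L2 /D /=; field; exact: D0.
by split; [apply: (addIr (- F1 p)); rewrite X1 X1'|apply: (addIr (- F2 p)); rewrite X2 X2'].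
Unshelve. all: by end_near.
Qed.

Lemma derive_fst p (v : R * R) : 'D_v (fst : R * R -> R) p = v.1.
Proof.
suff /(@diff_quad R fst p 1 0 0 1 ltr01)[_ ->] : forall h k e : R, 0 <= e <= 1 ->
    `|h| <= e * 1 -> `|k| <= e * 1 -> `|(p.1 + h, p.2 + k).1 - p.1 - h * 1 - k * 0| <= e ^+ 2 * 0.
  by rewrite mulr1 mulr0 addr0.
by move=> h k e _ _ _; rewrite /= [p.1 + h]addrC addrK mulr1 subrr mulr0 subrr normr0 mulr0.
Qed.

Lemma derive_snd p (v : R * R) : 'D_v (snd : R * R -> R) p = v.2.
Proof.
suff /(@diff_quad R snd p 0 1 0 1 ltr01)[_ ->] : forall h k e : R, 0 <= e <= 1 ->
    `|h| <= e * 1 -> `|k| <= e * 1 -> `|(p.1 + h, p.2 + k).2 - p.2 - h * 0 - k * 1| <= e ^+ 2 * 0.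
  by rewrite mulr1 mulr0 add0r.
by move=> h k e _ _ _; rewrite /= [p.2 + k]addrC addrK mulr1 mulr0 subr0 subrr normr0 mulr0.
Qed.

(** The right inverse G has an invertible differential, hence a right inverse K of its own. Then F =
    F G K = K near p, so G F = G K = id. *)
Lemma an_inverse F1 F2 p : an F1 p -> an F2 p ->
  pdx F1 p * pdy F2 p - pdy F1 p * pdx F2 p != 0 ->
  exists G1 G2, let q := (F1 p, F2 p) in
    [/\ an G1 q, an G2 q, (G1 q, G2 q) = p,
     (\forall w \near q, F1 (G1 w, G2 w) = w.1 /\ F2 (G1 w, G2 w) = w.2) &
     (\forall z \near p, G1 (F1 z, F2 z) = z.1 /\ G2 (F1 z, F2 z) = z.2)].
Proof.
move=> hF1 hF2 D0; have [G1 [G2 [hG1 hG2 Gq hR]]] := an_right_inverse hF1 hF2 D0.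
exists G1, G2; set q := (F1 p, F2 p) in hG1 hG2 Gq hR *.
have Gq' : (G1 (F1 p, F2 p), G2 (F1 p, F2 p)) = p by [].
have e1 : p = (G1 q, G2 q) by rewrite Gq.
have dG1 := an_differentiable hG1; have dG2 := an_differentiable hG2.
have dF1 : differentiable F1 (G1 q, G2 q) by rewrite Gq; exact: an_differentiable.
have dF2 : differentiable F2 (G1 q, G2 q) by rewrite Gq; exact: an_differentiable.
have ch1 (v : R * R) : 'D_v G1 q * pdx F1 p + 'D_v G2 q * pdy F1 p = v.1.
  rewrite -(derive_fst q v) -[in LHS]Gq -pd_comp //; apply: near_eq_derive.
  by near=> w; have [] : F1 (G1 w, G2 w) = w.1 /\ F2 (G1 w, G2 w) = w.2 by near: w.
have ch2 (v : R * R) : 'D_v G1 q * pdx F2 p + 'D_v G2 q * pdy F2 p = v.2.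
  rewrite -(derive_snd q v) -[in LHS]Gq -pd_comp //; apply: near_eq_derive.
  by near=> w; have [] : F1 (G1 w, G2 w) = w.1 /\ F2 (G1 w, G2 w) = w.2 by near: w.
have DG : pdx G1 q * pdy G2 q - pdy G1 q * pdx G2 q != 0.
  have := ch1 (1, 0); have := ch1 (0, 1); have := ch2 (1, 0); have := ch2 (0, 1).
  rewrite -!/(pdx _ _) -!/(pdy _ _) /=.
  set a := pdx F1 p; set b := pdy F1 p; set c := pdx F2 p; set e := pdy F2 p.
  set x := pdx G1 q; set y := pdy G1 q; set z := pdx G2 q; set w := pdy G2 q.
  move=> h1 h2 h3 h4; apply/eqP => h5.
  have : (x * w - y * z) * (a * e - b * c) = (x * a + z * b) * (y * c + w * e) - (y * a + w * b) * (x * c + z * e) by ring.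
  rewrite h5 h1 h2 h3 h4 !mul0r !mul1r subr0 => /esym /eqP.
  by apply/negP; exact: oner_neq0.
have [K1 [K2 [hK1 hK2 Kp hRK]]] := an_right_inverse hG1 hG2 DG.
rewrite Gq in hK1 hK2 Kp hRK.
have cK : (fun z => (K1 z, K2 z)) @ p --> q.
  rewrite -Kp; exact: (cvg_pair (an_continuous hK1) (an_continuous hK2)).
split=> //.
have hRz := cK _ hR.
near=> z.
have [k1 k2] : G1 (K1 z, K2 z) = z.1 /\ G2 (K1 z, K2 z) = z.2 by near: z.
have [l1 l2] : F1 (G1 (K1 z, K2 z), G2 (K1 z, K2 z)) = (K1 z, K2 z).1 /\
   F2 (G1 (K1 z, K2 z), G2 (K1 z, K2 z)) = (K1 z, K2 z).2 by near: z.
move: l1 l2; rewrite k1 k2 -surjective_pairing /= => -> ->.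
by rewrite k1 k2.
Unshelve. all: by end_near.
Qed.

(** The re-expansion at p + z has radius r / 2, and its square contains the square of radius r / 4
    around p. *)
Lemma an_identity f p r M : 0 < r -> pser r (shf p f) M ->
  forall z, `|z.1| <= r / 4 -> `|z.2| <= r / 4 ->
  (\forall w \near (p.1 + z.1, p.2 + z.2), f w = 0) ->
  forall h k, `|h| <= r / 4 -> `|k| <= r / 4 -> f (p.1 + h, p.2 + k) = 0.
Proof.
move=> r0 hA z hz1 hz2 /near_box [d d0 hd] h k hh hk.
have d2 : 0 < r / 2 by rewrite divr_gt0.
have hB : pser (r / 2) (shf z (shf p f)) M.
  by apply: pser_shift hA; [exact: ltW|lra|lra].
have := @pser_zero R (r / 2) _ M d d2 d0 hB _ (h - z.1) (k - z.2).
rewrite /shf /= !subrKC; apply.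
- by move=> x y hx hy; rewrite !addrA; exact: hd.
- by apply: le_trans (ler_normB _ _) _; lra.
- by apply: le_trans (ler_normB _ _) _; lra.
Qed.

End inverse_function.

(** * Beltrami equation *)

Section cauchy_kovalevskaya.
Variable R : realType.
Implicit Types (h k x y d C M : R) (p : R * R) (a b u v : rep R).

Lemma sm_shift (u : nat -> R) M : abs_le u M -> sm u = u 0%N + sm (fun n => u n.+1).
Proof.
move=> h; have hs : abs_le (fun n => u n.+1) M.
  move=> N; apply: le_trans (h N.+1); rewrite [leRHS]big_nat_recl //.
  by rewrite lerDr.
apply: sm_eq; rewrite -cvg_shiftS.
have -> : (fun n => series u n.+1) = (fun n => u 0%N + series (fun n => u n.+1) n).
  by apply/funext => n; rewrite /series /= big_nat_recl.
by apply: cvgD; [exact: cvg_cst|exact: smP hs].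
Qed.

Definition ropp u := Rep (fun n => - cf u n) (ex u) (ey u).

Lemma nb_ropp w u M : nb w u M -> nb w (ropp u) M.
Proof. by apply: abs_le_dom => n; rewrite /= mulNr normrN. Qed.

Lemma lf_ropp w u M g C : nb w u M -> dmd g w C -> lf g (ropp u) = - lf g u.
Proof.
move=> hu hd; rewrite -mulN1r /lf -(smZ _ (dmd_abs_le hu hd)).
by congr sm; apply/funext => n; rewrite /= mulN1r mulNr.
Qed.

(* Termwise [int_0^y a * u_x dy]: the Beltrami equation is a fixed point equation
   for this operator. *)
Definition rint a u := rU (fun m =>
  Rep (fun n => cf a m * cf u n * (ex u n)%:R / (ey u n + ey a m).+1%:R)
      (fun n => ((ex u n).-1 + ex a m)%N) (fun n => (ey u n + ey a m).+1)).

(* In the weight the factor [i / (j + 1)] produced by [rint] is compensated by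
   the binomial, so that [rint a] is bounded with a constant proportional to
   [eps]. *)
Definition wt (rho eps : R) i j := rho ^+ (i + j) * eps ^+ j / 'C(i + j, j)%:R.

Lemma bin_mono i j i' j' : ('C(i + j, j) <= 'C(i + i' + (j + j'), j + j'))%N.
Proof.
apply: (@leq_trans 'C(i + i' + j, j)); first by apply: leq_bin2l; rewrite leq_add2r leq_addr.
rewrite -(bin_sub (leq_addl _ j)) -[X in (_ <= X)%N](bin_sub (leq_addl _ (j + j'))) !addnK.
by apply: leq_bin2l; rewrite leq_add2l leq_addr.
Qed.

Lemma bin_pos i j : (0 : R) < 'C(i + j, j)%:R.
Proof. by rewrite ltr0n bin_gt0 leq_addl. Qed.

Section weighted.
Variables (rho eps : R).
Hypotheses (rho0 : 0 < rho) (eps0 : 0 < eps) (eps1 : eps <= 1).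

Lemma wt_gt0 i j : 0 < wt rho eps i j.
Proof. by rewrite /wt divr_gt0 ?mulr_gt0 ?exprn_gt0 ?bin_pos. Qed.

Lemma wt_int i j i' j' :
  i%:R / (j + j').+1%:R * wt rho eps (i.-1 + i') (j + j').+1 <=
  eps * rho ^+ (i' + j') * wt rho eps i j.
Proof.
case: i => [|i]; first by rewrite !mul0r !mulr_ge0 ?exprn_ge0 ?(ltW rho0) ?(ltW eps0) //; exact/ltW/wt_gt0.
rewrite /wt /= [in leLHS]addnS.
(* The absorption identity (m + 1) C(n, m + 1) = (n - m) C(n, m) at m = j + j'. Its factor n - m = i
   + i' + 1 pays for the factor i + 1 coming from the x-derivative. *)
have E : ((j + j').+1 * 'C((i + i' + (j + j')).+1, (j + j').+1) =
          (i + i').+1 * 'C(i.+1 + i' + (j + j'), j + j'))%N.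
  have -> : (i.+1 + i' + (j + j') = (i + i' + (j + j')).+1)%N by rewrite addSn addSn.
  by rewrite mul_bin_left subSn ?leq_addl // addnK.
have hb : (i.+1 * 'C(i.+1 + j, j) <= (j + j').+1 * 'C((i + i' + (j + j')).+1, (j + j').+1))%N.
  by rewrite E; apply: leq_mul; [rewrite ltnS leq_addr|exact: bin_mono].
have hb' : i.+1%:R * 'C(i.+1 + j, j)%:R <= (j + j').+1%:R * 'C((i + i' + (j + j')).+1, (j + j').+1)%:R :> R.
  by rewrite -!natrM ler_nat.
have b1 := bin_pos i.+1 j.
have b2 : (0 : R) < 'C((i + i' + (j + j')).+1, (j + j').+1)%:R.
  by rewrite ltr0n bin_gt0 ltnS leq_addl.
have b3 : (0 : R) < (j + j').+1%:R by rewrite ltr0n.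
move: b1 b2 b3 hb'.
move: ('C(i.+1 + j, j)%:R : R) ('C((i + i' + (j + j')).+1, (j + j').+1)%:R : R) ((j + j').+1%:R : R) (i.+1%:R : R) => B B' J I Bp Bp' Jp hb'.
have -> : rho ^+ (i + i' + (j + j')).+1 = rho ^+ (i' + j') * rho ^+ (i.+1 + j).
  by rewrite -exprD; congr (_ ^+ _); lia.
have -> : eps ^+ (j + j').+1 = eps * eps ^+ j * eps ^+ j' by rewrite exprS exprD mulrA.
have p1 : 0 <= eps * rho ^+ (i' + j') * (rho ^+ (i.+1 + j) * eps ^+ j).
  by rewrite !mulr_ge0 ?exprn_ge0 ?ltW.
have p2 : I / J / B' <= B^-1.
  rewrite -mulrA -invfM ler_pdivrMr ?mulr_gt0 // mulrC ler_pdivlMr //.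
have p3 : eps ^+ j' <= 1 by rewrite exprn_ile1 // ltW.
have p4 : 0 <= eps ^+ j' by rewrite exprn_ge0 // ltW.
rewrite [leLHS](_ : _ = eps * rho ^+ (i' + j') * (rho ^+ (i.+1 + j) * eps ^+ j) * ((I / J / B') * eps ^+ j')); last by ring.
rewrite [leRHS](_ : _ = eps * rho ^+ (i' + j') * (rho ^+ (i.+1 + j) * eps ^+ j) * B^-1); last by ring.
apply: ler_wpM2l => //.
apply: (@le_trans _ _ (B^-1 * eps ^+ j')); first exact: ler_wpM2r.
by rewrite -[leRHS]mulr1; apply: ler_wpM2l => //; rewrite invr_ge0 ltW.
Qed.

(** Since C(i + j, j) <= 2^(i + j), the weight [wt] dominates [pw] at radius rho * eps / 2. A second
    halving leaves room for differentiating at radius [wrad]. *)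
Definition wrad : R := rho * eps / 4.

Lemma wrad_gt0 : 0 < wrad.
Proof. by rewrite divr_gt0 // mulr_gt0. Qed.

Lemma pw_le_wt i j : pw (wrad + wrad) i j <= wt rho eps i j.
Proof.
rewrite /pw /wt; have -> : wrad + wrad = rho * (eps / 2) by rewrite /wrad; field.
rewrite exprMn -mulrA; apply: ler_wpM2l; first by rewrite exprn_ge0 // ltW.
rewrite ler_pdivlMr ?bin_pos //.
have h2 : 'C(i + j, j)%:R <= 2 ^+ (i + j) :> R.
  rewrite -natrX ler_nat -[(2 : nat)]/(1 + 1)%N (Pascal 1 1).
  have hj : (j < (i + j).+1)%N by rewrite ltnS leq_addl.
  by rewrite (bigD1 (Ordinal hj)) //= !exp1n !muln1 leq_addr.
apply: (@le_trans _ _ ((eps / 2) ^+ (i + j) * 2 ^+ (i + j))).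
  by apply: ler_wpM2l => //; rewrite exprn_ge0 // divr_ge0 // ltW.
rewrite -exprMn divfK //; apply: ler_wiXn2l => //; first exact: ltW.
exact: leq_addl.
Qed.

Lemma dmd_wt g C : dmd g (pw (wrad + wrad)) C -> dmd g (wt rho eps) C.
Proof.
move=> [C0 h]; split=> // i j; apply: le_trans (h i j) _; apply: ler_wpM2l => //.
rewrite !ger0_norm; [exact: pw_le_wt|exact/ltW/wt_gt0|].
by rewrite exprn_ge0 // addr_ge0 // ltW // wrad_gt0.
Qed.

Lemma nb_pw_wt u M : nb (wt rho eps) u M -> nb (pw (wrad + wrad)) u M.
Proof.
apply: abs_le_dom => n; rewrite normrM [leRHS]normrM; apply: ler_wpM2l => //.
rewrite !ger0_norm; [exact: pw_le_wt|exact/ltW/wt_gt0|].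
by rewrite exprn_ge0 // addr_ge0 // ltW // wrad_gt0.
Qed.

Section rint_bounds.
Variables (a u : rep R) (Ma M : R).
Hypotheses (ha : nb (pw rho) a Ma) (hu : nb (wt rho eps) u M).

Let Mm m := `|cf a m * pw rho (ex a m) (ey a m)| * (eps * M).

Let Mm_le : abs_le Mm (Ma * (eps * M)).
Proof.
have M0 : 0 <= eps * M by rewrite mulr_ge0 ?(ltW eps0) // (abs_le_ge0 hu).
rewrite [Ma * _]mulrC -[X in X * Ma](ger0_norm M0).
by apply: abs_le_dom (abs_leZ (eps * M) ha) => m; rewrite /Mm normrM normr_id mulrC [leRHS]normrM.
Qed.

Let nb_term m : nb (wt rho eps)
  (Rep (fun n => cf a m * cf u n * (ex u n)%:R / (ey u n + ey a m).+1%:R)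
      (fun n => ((ex u n).-1 + ex a m)%N) (fun n => (ey u n + ey a m).+1)) (Mm m).
Proof.
have c0 : 0 <= `|cf a m * pw rho (ex a m) (ey a m)| * eps by rewrite mulr_ge0 // ltW.
rewrite /Mm mulrA -[X in X * M](ger0_norm c0).
apply: abs_le_dom (abs_leZ (`|cf a m * pw rho (ex a m) (ey a m)| * eps) hu) => n /=.
have := wt_int (ex u n) (ey u n) (ex a m) (ey a m).
set I := (ex u n)%:R; set J := _.+1%:R; set W := wt _ _ _ _; set W' := wt _ _ _ _ => hW.
have Wp : 0 < W by exact: wt_gt0.
have Wp' : 0 < W' by exact: wt_gt0.
have IJ : 0 <= I / J by rewrite divr_ge0 ?ler0n.
rewrite [X in `|X| <= _](_ : _ = cf a m * cf u n * (I / J * W)); last by ring.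
rewrite /pw; move: hW; set P := rho ^+ _ => hW.
have Pp : 0 <= P by rewrite exprn_ge0 // ltW.
have -> : `|cf a m * cf u n * (I / J * W)| = `|cf a m| * `|cf u n| * (I / J * W).
  by rewrite normrM [X in X * _]normrM [X in _ * X]ger0_norm // mulr_ge0 // ltW.
have -> : `| `|cf a m * P| * eps * (cf u n * W')| = `|cf a m| * P * eps * (`|cf u n| * W').
  by rewrite normrM [X in X * _]normrM normr_id [`|cf a m * P|]normrM [`|cf u n * W'|]normrM
    (ger0_norm Pp) (gtr0_norm eps0) (gtr0_norm Wp').
rewrite [leRHS](_ : _ = `|cf a m| * `|cf u n| * (eps * P * W')); last by ring.
by apply: ler_wpM2l => //; rewrite mulr_ge0.
Qed.

Lemma nb_rint : nb (wt rho eps) (rint a u) (Ma * (eps * M)).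
Proof. exact: nb_rU Mm_le nb_term. Qed.

(** The y-derivative cancels the denominators introduced by the integration, which leaves the
    product of a and u_x written as a double sum. *)
Lemma lf_rint_dmy x y : `|x| <= wrad -> `|y| <= wrad ->
  lf (dmy x y) (rint a u) = lf (mon x y) a * lf (dmx x y) u.
Proof.
move=> hx hy; have hdy := dmd_wt (dmd_dmy wrad_gt0 hx hy).
have hdx := dmd_wt (dmd_dmx wrad_gt0 hx hy).
have wr : wrad <= rho.
  by rewrite /wrad ler_pdivrMr // ler_pM2l // (le_trans eps1) // ler1n.
have hm := dmd_mon (le_trans hx wr) (le_trans hy wr).
rewrite (lf_rU Mm_le nb_term hdy) mulrC [lf (mon x y) a]/lf -(smZ _ (dmd_abs_le ha hm)).
congr sm; apply/funext => m.
rewrite [RHS](_ : _ = cf a m * mon x y (ex a m) (ey a m) * lf (dmx x y) u); last by ring.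
rewrite /lf -(smZ _ (dmd_abs_le hu hdx)); congr sm; apply/funext => n /=.
rewrite /dmy /dmx /mon /= !exprD.
have : (ey u n + ey a m).+1%:R != 0 :> R by rewrite pnatr_eq0.
by move: (_.+1%:R : R) => J J0; field.
Qed.

(** Every monomial of the integral has positive degree in y, so the iteration leaves the Cauchy data
    on the x-axis, and with it the x-derivative at 0, unchanged. *)
Lemma lf_rint_dmx0 : lf (dmx 0 0) (rint a u) = 0.
Proof.
rewrite /lf -[RHS](sm0 R); congr sm; apply/funext => k; rewrite /rint /=.
by case: pickle_inv => [[m n]|] /=; rewrite ?mul0r // /dmx exprS mul0r !mulr0.
Qed.

End rint_bounds.

Section iteration.
Variables (a b : rep R) (Ma Mb : R).
Hypotheses (ha : nb (pw rho) a Ma) (hb : nb (pw rho) b Mb) (hab : eps * (Ma + Mb) <= 1 / 2).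

(** Real and imaginary parts of w -> int_0^y (a + i b) w_x dy. The iterates start from x + 0 i and
    halve in norm, so the solution is their sum, a Neumann series. *)
Let step (w : rep R * rep R) : rep R * rep R :=
  (radd (rint a w.1) (ropp (rint b w.2)), radd (rint b w.1) (rint a w.2)).

Let w0 : rep R * rep R :=
  (Rep (fun n => (n == 0%N)%:R) (fun=> 1%N) (fun=> 0%N), Rep (fun=> 0) (fun=> 0%N) (fun=> 0%N)).

Let w n := iter n step w0.

Let nb_w n : nb (wt rho eps) (w n).1 (rho * (1 / 2) ^+ n) /\
             nb (wt rho eps) (w n).2 (rho * (1 / 2) ^+ n).
Proof.
elim: n => [|n [IH1 IH2]].
  rewrite expr0 mulr1; split; last by apply: abs_le_trans (nb0 _); exact: ltW.
  move=> [|N]; first by rewrite big_geq // ltW.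
  rewrite big_nat_recl //= big1 => [|i _]; last by rewrite mul0r normr0.
  by rewrite addr0 mul1r /wt expr0 mulr1 bin0 divr1 expr1 ger0_norm // ltW.
have hM : 0 <= rho * (1 / 2) ^+ n by rewrite mulr_ge0 ?(ltW rho0) // exprn_ge0 // divr_ge0.
have h1 : Ma * (eps * (rho * (1 / 2) ^+ n)) + Mb * (eps * (rho * (1 / 2) ^+ n)) <= rho * (1 / 2) ^+ n.+1.
  rewrite exprS [leRHS]mulrCA [leLHS](_ : _ = eps * (Ma + Mb) * (rho * (1 / 2) ^+ n)); last by ring.
  exact: ler_wpM2r.
rewrite /w iterS -/(w n); split.
  apply: abs_le_trans h1 _; apply: nb_radd; first exact: nb_rint.
  by apply: nb_ropp; exact: nb_rint.
rewrite addrC in h1; apply: abs_le_trans h1 _; apply: nb_radd; exact: nb_rint.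
Qed.

Let hM : abs_le (fun n => rho * (1 / 2) ^+ n) (rho * 2).
Proof.
apply: abs_le_half; first exact: ltW.
by move=> n; rewrite ger0_norm // mulr_ge0 ?(ltW rho0) // exprn_ge0 // divr_ge0.
Qed.

(** The y-derivative kills the initial term x and turns the term of index n + 1 into a + i b times
    the x-derivative of the term of index n; summation over n gives the equation. *)
Lemma ck_reps : exists u v, [/\ nb (pw (wrad + wrad)) u (rho * 2),
  nb (pw (wrad + wrad)) v (rho * 2),
  (forall x y, `|x| <= wrad -> `|y| <= wrad ->
    lf (dmy x y) u = lf (mon x y) a * lf (dmx x y) u - lf (mon x y) b * lf (dmx x y) v /\
    lf (dmy x y) v = lf (mon x y) b * lf (dmx x y) u + lf (mon x y) a * lf (dmx x y) v),
  lf (dmx 0 0) u = 1 & lf (dmx 0 0) v = 0].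
Proof.
have h1 n := (nb_w n).1; have h2 n := (nb_w n).2.
exists (rU (fun n => (w n).1)), (rU (fun n => (w n).2)).
have lfu g C : dmd g (wt rho eps) C -> lf g (rU (fun n => (w n).1)) = lf g w0.1 + sm (fun n => lf g (w n.+1).1).
  move=> hd; rewrite (lf_rU hM h1 hd); apply: (@sm_shift _ (C * (rho * 2))).
  have := abs_leZ C hM; rewrite (ger0_norm hd.1); apply: abs_le_dom => n.
  by apply: le_trans (ler_norm _); exact: lf_bound (h1 n) hd.
have lfv g C : dmd g (wt rho eps) C -> lf g (rU (fun n => (w n).2)) = lf g w0.2 + sm (fun n => lf g (w n.+1).2).
  move=> hd; rewrite (lf_rU hM h2 hd); apply: (@sm_shift _ (C * (rho * 2))).
  have := abs_leZ C hM; rewrite (ger0_norm hd.1); apply: abs_le_dom => n.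
  by apply: le_trans (ler_norm _); exact: lf_bound (h2 n) hd.
have lf0 g : lf g w0.2 = 0.
  by rewrite /lf -[RHS](sm0 R); congr sm; apply/funext => n; rewrite /= mul0r.
have lfx g : lf g w0.1 = g 1%N 0%N.
  rewrite /lf (@sm_fin _ _ 1) => [|[|n]] //; last by rewrite /= mul0r.
  by rewrite big_nat1 /= mul1r.
have n0 : `|0 : R| <= wrad by rewrite normr0 ltW // wrad_gt0.
have hd0 := dmd_wt (dmd_dmx wrad_gt0 n0 n0).
split.
- by apply: nb_pw_wt; exact: nb_rU hM h1.
- by apply: nb_pw_wt; exact: nb_rU hM h2.
- move=> x y hx hy.
  have hdy := dmd_wt (dmd_dmy wrad_gt0 hx hy).
  have hdx := dmd_wt (dmd_dmx wrad_gt0 hx hy).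
  have ab1 : abs_le (fun n => lf (dmx x y) (w n).1) (wrad^-1 * (rho * 2)).
    have := abs_leZ wrad^-1 hM; rewrite (ger0_norm hdx.1); apply: abs_le_dom => n.
    by apply: le_trans (ler_norm _); exact: lf_bound (h1 n) hdx.
  have ab2 : abs_le (fun n => lf (dmx x y) (w n).2) (wrad^-1 * (rho * 2)).
    have := abs_leZ wrad^-1 hM; rewrite (ger0_norm hdx.1); apply: abs_le_dom => n.
    by apply: le_trans (ler_norm _); exact: lf_bound (h2 n) hdx.
  rewrite !(lf_rU hM h1 hdx) !(lf_rU hM h2 hdx) (lfu _ _ hdy) (lfv _ _ hdy) lf0 lfx.
  rewrite /dmy mul0r mulr0 -/(dmy x y) !add0r; split.
    rewrite -mulNr -!(smZ _ ab1) -!(smZ _ ab2) -(smD (abs_leZ _ ab1) (abs_leZ _ ab2)).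
    congr sm; apply/funext => n; rewrite /w iterS -/(w n) /=.
    rewrite (lf_radd (nb_rint ha (h1 n)) (nb_ropp (nb_rint hb (h2 n))) hdy).
    rewrite (lf_ropp (nb_rint hb (h2 n)) hdy) (lf_rint_dmy ha (h1 n) hx hy).
    by rewrite (lf_rint_dmy hb (h2 n) hx hy) mulNr.
  rewrite -!(smZ _ ab1) -!(smZ _ ab2) -(smD (abs_leZ _ ab1) (abs_leZ _ ab2)).
  congr sm; apply/funext => n; rewrite /w iterS -/(w n) /=.
  rewrite (lf_radd (nb_rint hb (h1 n)) (nb_rint ha (h2 n)) hdy).
  by rewrite (lf_rint_dmy hb (h1 n) hx hy) (lf_rint_dmy ha (h2 n) hx hy).
- rewrite (lfu _ _ hd0) lfx (_ : dmx 0 0 1 0 = 1); last by rewrite /dmx /= !mulr1.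
  rewrite -[RHS]addr0; congr (_ + _).
  rewrite -[RHS](sm0 R); congr sm; apply/funext => n; rewrite /w iterS -/(w n) /=.
  rewrite (lf_radd (nb_rint ha (h1 n)) (nb_ropp (nb_rint hb (h2 n))) hd0).
  by rewrite (lf_ropp (nb_rint hb (h2 n)) hd0) !lf_rint_dmx0 oppr0 addr0.
- rewrite (lfv _ _ hd0) lf0 add0r.
  rewrite -[RHS](sm0 R); congr sm; apply/funext => n; rewrite /w iterS -/(w n) /=.
  rewrite (lf_radd (nb_rint hb (h1 n)) (nb_rint ha (h2 n)) hd0).
  by rewrite !lf_rint_dmx0 addr0.
Qed.

End iteration.
End weighted.

(** The two equations say (S + i T)_y = (al + i be) (S + i T)_x. With the prescribed derivatives at
    p, the Jacobian determinant of (S, T) there is be p. *)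
Lemma beltrami (al be : R * R -> R) p : an al p -> an be p ->
  exists S T, [/\ an S p, an T p,
    (\forall z \near p, pdy S z = al z * pdx S z - be z * pdx T z /\
                        pdy T z = be z * pdx S z + al z * pdx T z),
    pdx S p = 1 & pdx T p = 0].
Proof.
move=> hal hbe; have [r [Ma [Mb [r0 [a [ha hfa]] [b [hb hfb]]]]]] := an_common hal hbe.
have Ma0 := abs_le_ge0 ha; have Mb0 := abs_le_ge0 hb.
(* Makes the iteration contract by 1 / 2; the summand 1 keeps [eps] at most 1 and the denominator
   positive. *)
pose eps : R := (2 * (Ma + Mb + 1))^-1.
have Dp : 0 < 2 * (Ma + Mb + 1) by rewrite mulr_gt0 // ltr_wpDl // addr_ge0.
have eps0 : 0 < eps by rewrite invr_gt0.
have eps1 : eps <= 1 by rewrite invf_le1 //; lra.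
have hab : eps * (Ma + Mb) <= 1 / 2.
  by rewrite /eps mulrC ler_pdivrMr //; lra.
have [u [v [hu hv hpde hux hvx]]] := ck_reps r0 eps0 eps1 ha hb hab.
set d := wrad r eps in hu hv hpde.
have d0 : 0 < d by exact: wrad_gt0.
have dr : d <= r by rewrite /d /wrad ler_pdivrMr // ler_pM2l //; lra.
pose S z := lf (mon (z.1 - p.1) (z.2 - p.2)) u.
pose T z := lf (mon (z.1 - p.1) (z.2 - p.2)) v.
have hS h k : `|h| <= d + d -> `|k| <= d + d -> S (p.1 + h, p.2 + k) = lf (mon h k) u.
  by move=> _ _; rewrite /S /= ![_ + _ - _]addrAC !subrr !add0r.
have hT h k : `|h| <= d + d -> `|k| <= d + d -> T (p.1 + h, p.2 + k) = lf (mon h k) v.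
  by move=> _ _; rewrite /T /= ![_ + _ - _]addrAC !subrr !add0r.
have dS := rep_diff d0 hu hS; have dT := rep_diff d0 hv hT.
have px F q w : (forall v : R * R, 'D_v F q = v.1 * w.1 + v.2 * w.2) -> pdx F q = w.1 /\ pdy F q = w.2.
  by move=> h; rewrite /pdx /pdy !h /= !mul1r !mul0r addr0 add0r.
have n0 : `|0 : R| <= d by rewrite normr0 ltW.
exists S, T; split.
- by exists (d + d), (r * 2); split; [rewrite addr_gt0|exists u].
- by exists (d + d), (r * 2); split; [rewrite addr_gt0|exists v].
- apply/near_box; exists d => // h k hh hk.
  have [_ kS] := dS _ _ hh hk; have [_ kT] := dT _ _ hh hk.
  have [-> ->] := px _ _ (_, _) kS; have [-> ->] := px _ _ (_, _) kT => /=.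
  have [e1 e2] := hpde _ _ hh hk.
  have -> : al (p.1 + h, p.2 + k) = lf (mon h k) a by apply: hfa; exact: le_trans dr.
  have -> : be (p.1 + h, p.2 + k) = lf (mon h k) b by apply: hfb; exact: le_trans dr.
  by split.
- have [_ kS] := dS _ _ n0 n0; have [] := px _ _ (_, _) kS.
  by rewrite !addr0 -surjective_pairing /= hux.
- have [_ kT] := dT _ _ n0 n0; have [] := px _ _ (_, _) kT.
  by rewrite !addr0 -surjective_pairing /= hvx.
Qed.

End cauchy_kovalevskaya.

(** * Triple cross product *)

Section polynomial.
Variable K : comNzRingType.
Implicit Types x y z w : nat -> K.

Definition d3 x y z i j k : K :=
  x i * (y j * z k - y k * z j) - x j * (y i * z k - y k * z i)
  + x k * (y i * z j - y j * z i).

(** The contraction of Phi with x, y, z, indexed from 0: every index occurs in seven of the fourteen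
    terms of Phi and each occurrence gives a signed 3 by 3 minor. Vectors are functions on nat, so
    that identities reduce to [ring]. *)
Definition tcp x y z (j : nat) : K :=
  match j with
  | 0%N => - d3 x y z 1 2 3 - d3 x y z 1 4 5 - d3 x y z 1 6 7 - d3 x y z 2 4 6 + d3 x y z 2 5 7 + d3 x y z 3 4 7 + d3 x y z 3 5 6
  | 1%N => d3 x y z 0 2 3 + d3 x y z 0 4 5 + d3 x y z 0 6 7 - d3 x y z 3 5 7 + d3 x y z 3 4 6 + d3 x y z 2 5 6 + d3 x y z 2 4 7
  | 2%N => - d3 x y z 0 1 3 + d3 x y z 0 4 6 - d3 x y z 0 5 7 - d3 x y z 3 6 7 - d3 x y z 3 4 5 - d3 x y z 1 5 6 - d3 x y z 1 4 7
  | 3%N => d3 x y z 0 1 2 - d3 x y z 0 4 7 - d3 x y z 0 5 6 + d3 x y z 2 6 7 + d3 x y z 2 4 5 + d3 x y z 1 5 7 - d3 x y z 1 4 6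
  | 4%N => - d3 x y z 0 1 5 - d3 x y z 0 2 6 + d3 x y z 0 3 7 - d3 x y z 5 6 7 - d3 x y z 2 3 5 + d3 x y z 1 3 6 + d3 x y z 1 2 7
  | 5%N => d3 x y z 0 1 4 + d3 x y z 0 2 7 + d3 x y z 0 3 6 + d3 x y z 4 6 7 + d3 x y z 2 3 4 - d3 x y z 1 3 7 + d3 x y z 1 2 6
  | 6%N => - d3 x y z 0 1 7 + d3 x y z 0 2 4 - d3 x y z 0 3 5 - d3 x y z 4 5 7 - d3 x y z 2 3 7 - d3 x y z 1 3 4 - d3 x y z 1 2 5
  | 7%N => d3 x y z 0 1 6 - d3 x y z 0 2 5 - d3 x y z 0 3 4 + d3 x y z 4 5 6 + d3 x y z 2 3 6 + d3 x y z 1 3 5 - d3 x y z 1 2 4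
  | _ => 0
  end.

Definition g8 x y : K := x 0%N * y 0%N + x 1%N * y 1%N + x 2%N * y 2%N + x 3%N * y 3%N
  + x 4%N * y 4%N + x 5%N * y 5%N + x 6%N * y 6%N + x 7%N * y 7%N.

(** The identity behind the complex structure: for orthonormal x, y and z orthogonal to both, it
    says that x cross y cross - squares to -1. It depends on the signs in Phi and is checked by
    expansion. *)
Lemma tcp_tcp x y z j : (j < 8)%N -> tcp x y (tcp x y z) j =
  - (g8 x x * g8 y y - g8 x y ^+ 2) * z j
  + (g8 x z * g8 y y - g8 y z * g8 x y) * x j
  + (g8 y z * g8 x x - g8 x z * g8 x y) * y j.
Proof.
rewrite /g8; case: j => [|[|[|[|[|[|[|[|//]]]]]]]] _; rewrite /tcp /d3; ring.
Qed.

Lemma tcp_ext x y z w j : (forall k, (k < 8)%N -> z k = w k) -> tcp x y z j = tcp x y w j.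
Proof.
move=> h; case: j => [|[|[|[|[|[|[|[|//]]]]]]]]; by rewrite /tcp /d3 !h.
Qed.

Lemma g8_tcp x y z w : g8 (tcp x y z) w = - g8 (tcp x y w) z.
Proof. rewrite /g8 /tcp /d3; ring. Qed.

Lemma tcp_swap12 x y z j : tcp y x z j = - tcp x y z j.
Proof.
case: j => [|[|[|[|[|[|[|[|j]]]]]]]]; rewrite /tcp /d3; ring.
Qed.

Lemma tcp_swap23 x y z j : tcp x z y j = - tcp x y z j.
Proof.
case: j => [|[|[|[|[|[|[|[|j]]]]]]]]; rewrite /tcp /d3; ring.
Qed.

Lemma tcp_lin x y z w a j :
  tcp x y (fun k => a * z k + w k) j = a * tcp x y z j + tcp x y w j.
Proof.
case: j => [|[|[|[|[|[|[|[|j]]]]]]]]; rewrite /tcp /d3; ring.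
Qed.

Definition d4 x y z w i j k l : K :=
  - w i * d3 x y z j k l + w j * d3 x y z i k l
  - w k * d3 x y z i j l + w l * d3 x y z i j k.

End polynomial.

Lemma det_nat (K : comNzRingType) n (f : nat -> nat -> K) :
  \det (\matrix_(i < n.+1, j < n.+1) f i j) =
  \sum_(j < n.+1) (-1) ^+ j * f 0%N j * \det (\matrix_(i < n, k < n) f i.+1 (bump j k)).
Proof.
rewrite (expand_det_row _ ord0); apply: eq_bigr => j _.
rewrite mxE /cofactor add0n mulrCA mulrA; congr (_ * \det _).
by apply/matrixP => i k; rewrite !mxE.
Qed.

Lemma det2_nat (K : comNzRingType) (f : nat -> nat -> K) :
  \det (\matrix_(i < 2, j < 2) f i j) = f 0%N 0%N * f 1%N 1%N - f 0%N 1%N * f 1%N 0%N.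
Proof.
rewrite (det_nat 1 f) !big_ord_recl big_ord0 !det_mx11 !mxE /= /bump /=; ring.
Qed.

Lemma det3_nat (K : comNzRingType) (f : nat -> nat -> K) :
  \det (\matrix_(i < 3, j < 3) f i j) = d3 (f 0%N) (f 1%N) (f 2%N) 0 1 2.
Proof.
rewrite (det_nat 2 f) !big_ord_recl big_ord0.
rewrite !(det2_nat (fun i k => f i.+1 (bump _ k))) /d3 /= /bump /=; ring.
Qed.

Lemma det4_nat (K : comNzRingType) (f : nat -> nat -> K) :
  \det (\matrix_(i < 4, j < 4) f i j) = d4 (f 0%N) (f 1%N) (f 2%N) (f 3%N) 0 1 2 3.
Proof.
rewrite (det_nat 3 f) !big_ord_recl big_ord0.
rewrite !(det3_nat (fun i k => f i.+1 (bump _ k))) /d4 /d3 /= /bump /=; ring.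
Qed.

Section vectors.
Variable R : realType.
Implicit Types x y z w u v : 'rV[R]_8.

Definition co x (k : nat) : R := x 0 (inord k).

Lemma co_inj x y : (forall k, (k < 8)%N -> co x k = co y k) -> x = y.
Proof.
move=> h; apply/rowP => j; have := h j (ltn_ord j).
by rewrite /co inord_val.
Qed.

Lemma euclid_co x y : euclid x y = g8 (co x) (co y).
Proof.
transitivity (\sum_(0 <= k < 8) co x k * co y k).
  by rewrite big_mkord; apply: eq_bigr => i _; rewrite /co inord_val.
by rewrite /g8 !big_nat_recr //= big_geq // add0r.
Qed.

Lemma dx_frame i j k l x y z w :
  dx i.+1 j.+1 k.+1 l.+1 (frame x y z w) = d4 (co x) (co y) (co z) (co w) i j k l.
Proof.
have -> : dx i.+1 j.+1 k.+1 l.+1 (frame x y z w) = \det (\matrix_(a < 4, b < 4)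
    co (nth 0 [:: x; y; z; w] a) (nth 0%N [:: i; j; k; l] b)).
  rewrite /dx; congr (\det _); apply/matrixP => a b; rewrite !mxE /co; congr (_ _ (inord _)).
  by case: b => [[|[|[|[|b]]]] hb].
by rewrite (det4_nat (fun a b => co (nth 0 [:: x; y; z; w] a) (nth 0%N [:: i; j; k; l] b))).
Qed.

Lemma Phi_co x y z w : Phi x y z w = g8 (tcp (co x) (co y) (co z)) (co w).
Proof.
rewrite /Phi /PhiM !dx_frame /g8 /tcp /d4; ring.
Qed.

Lemma euclid_tcross x y z w : euclid (tcross x y z) w = Phi x y z w.
Proof. exact: (iffRL (tcrossP x y z _) erefl). Qed.

Lemma tcross_co x y z j : (j < 8)%N -> co (tcross x y z) j = tcp (co x) (co y) (co z) j.
Proof.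
move=> hj; rewrite /co mxE Phi_co.
have e k : (k < 8)%N -> co (delta_mx 0 (inord j) : 'rV[R]_8) k = (k == j)%:R.
  move=> hk; rewrite /co mxE eqxx /=; congr (nat_of_bool _)%:R.
  by rewrite -val_eqE /= !inordK.
rewrite /g8 !e //; move: hj.
by case: j {e} => [|[|[|[|[|[|[|[|//]]]]]]]] _; rewrite /= !mulr0 mulr1 ?addr0 ?add0r.
Qed.

Lemma euclidC x y : euclid x y = euclid y x.
Proof. by apply: eq_bigr => i _; rewrite mulrC. Qed.

Lemma euclidDl x y z : euclid (x + y) z = euclid x z + euclid y z.
Proof. by rewrite /euclid -big_split; apply: eq_bigr => i _; rewrite !mxE mulrDl. Qed.

Lemma euclidZl a x z : euclid (a *: x) z = a * euclid x z.
Proof. by rewrite /euclid mulr_sumr; apply: eq_bigr => i _; rewrite !mxE mulrA. Qed.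

Lemma euclidDr x y z : euclid z (x + y) = euclid z x + euclid z y.
Proof. by rewrite !(euclidC z) euclidDl. Qed.

Lemma euclidZr a x z : euclid z (a *: x) = a * euclid z x.
Proof. by rewrite !(euclidC z) euclidZl. Qed.

Lemma euclidNl x z : euclid (- x) z = - euclid x z.
Proof. by rewrite -scaleN1r euclidZl mulN1r. Qed.

Lemma euclidNr x z : euclid z (- x) = - euclid z x.
Proof. by rewrite !(euclidC z) euclidNl. Qed.

Lemma euclid0l z : euclid 0 z = 0.
Proof. by rewrite -(scale0r z) euclidZl mul0r. Qed.

Lemma euclid0r z : euclid z 0 = 0.
Proof. by rewrite euclidC euclid0l. Qed.

Lemma euclid_ge0 x : 0 <= euclid x x.
Proof. by apply: sumr_ge0 => i _; rewrite -expr2 sqr_ge0. Qed.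

Lemma euclid_eq0 x : euclid x x = 0 -> x = 0.
Proof.
move/eqP; rewrite psumr_eq0 => [/allP h|i _]; last by rewrite -expr2 sqr_ge0.
apply/rowP => j; have := h j (mem_index_enum _).
by rewrite mulf_eq0 orbb mxE => /eqP.
Qed.

Lemma euclid_gt0 x : x != 0 -> 0 < euclid x x.
Proof.
by move=> x0; rewrite lt_def euclid_ge0 andbT; apply: contraNneq x0 => /euclid_eq0 ->.
Qed.

Lemma tcross_skew x y z w : euclid (tcross x y z) w = - euclid z (tcross x y w).
Proof. by rewrite [in RHS]euclidC !euclid_tcross !Phi_co g8_tcp. Qed.

Lemma co_opp x k : co (- x) k = - co x k.
Proof. by rewrite /co mxE. Qed.

Lemma tcross12 x y z : tcross y x z = - tcross x y z.
Proof. by apply: co_inj => k hk; rewrite co_opp !tcross_co // tcp_swap12. Qed.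

Lemma tcross23 x y z : tcross x z y = - tcross x y z.
Proof. by apply: co_inj => k hk; rewrite co_opp !tcross_co // tcp_swap23. Qed.

Lemma tcross_linear3 x y a z w :
  tcross x y (a *: z + w) = a *: tcross x y z + tcross x y w.
Proof.
apply: co_inj => k hk.
have -> : co (a *: tcross x y z + tcross x y w) k = a * co (tcross x y z) k + co (tcross x y w) k.
  by rewrite /co !mxE.
rewrite !tcross_co // -tcp_lin; congr tcp; apply/funext => m.
by rewrite /co !mxE.
Qed.

Lemma tcross_linear2 x y a z w :
  tcross x (a *: z + w) y = a *: tcross x z y + tcross x w y.
Proof. by rewrite !(tcross23 x y) tcross_linear3 opprD scalerN. Qed.

Lemma tcross_linear1 x y a z w :
  tcross (a *: z + w) x y = a *: tcross z x y + tcross w x y.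
Proof. by rewrite !(tcross12 x) tcross_linear2 opprD scalerN. Qed.

Lemma opp_eq_self (V : lmodType R) (v : V) : v = - v -> v = 0.
Proof.
move=> /eqP; rewrite -subr_eq0 opprK -mulr2n -scaler_nat scaler_eq0.
by rewrite pnatr_eq0 /= => /eqP.
Qed.

Lemma tcross_x12 x z : tcross x x z = 0.
Proof. by apply: opp_eq_self; rewrite -tcross12. Qed.

Lemma tcross_x23 x z : tcross x z z = 0.
Proof. by apply: opp_eq_self; rewrite -tcross23. Qed.

Lemma tcross_x13 x z : tcross x z x = 0.
Proof. by rewrite tcross23 tcross_x12 oppr0. Qed.

Lemma tcross_cycle x y z : tcross y z x = tcross x y z.
Proof. by rewrite tcross23 tcross12 opprK. Qed.

Lemma tcross_tcross x y z : tcross x y (tcross x y z) =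
  - (euclid x x * euclid y y - euclid x y ^+ 2) *: z
  + (euclid x z * euclid y y - euclid y z * euclid x y) *: x
  + (euclid y z * euclid x x - euclid x z * euclid x y) *: y.
Proof.
apply: co_inj => k hk.
set a := - _; set b := _ - _; set c := _ - _.
have -> : co (a *: z + b *: x + c *: y) k = a * co z k + b * co x k + c * co y k.
  by rewrite /co !mxE.
rewrite /a /b /c !euclid_co tcross_co // -tcp_tcp //.
by apply: tcp_ext => m hm; exact: tcross_co.
Qed.

Lemma dx_mul i j k l (A : 'M[R]_4) (E : 'M[R]_(4, 8)) : dx i j k l (A *m E) = \det A * dx i j k l E.
Proof.
rewrite /dx -det_mulmx; congr (\det _); apply/matrixP => a b.
by rewrite !mxE; apply: eq_bigr => m _; rewrite mxE.
Qed.

Lemma PhiM_mul (A : 'M[R]_4) (E : 'M[R]_(4, 8)) : PhiM (A *m E) = \det A * PhiM E.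
Proof. by rewrite /PhiM !dx_mul; ring. Qed.

Lemma row_frame x y z w i : row i (frame x y z w) = nth 0 [:: x; y; z; w] i.
Proof. by rewrite /frame rowK. Qed.

Lemma frame_sub m (F : 'M[R]_(m, 8)) x y z w :
  (x <= F)%MS -> (y <= F)%MS -> (z <= F)%MS -> (w <= F)%MS -> (frame x y z w <= F)%MS.
Proof.
move=> h1 h2 h3 h4; apply/row_subP => i; rewrite row_frame.
by case: i => [[|[|[|[|i]]]] hi].
Qed.

Lemma sub_frame x y z w : [/\ (x <= frame x y z w)%MS, (y <= frame x y z w)%MS,
  (z <= frame x y z w)%MS & (w <= frame x y z w)%MS].
Proof.
have h (i : 'I_4) : (nth 0 [:: x; y; z; w] i <= frame x y z w)%MS.
  by rewrite -row_frame row_sub.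
have := (h (inord 0), h (inord 1), h (inord 2), h (inord 3)).
by rewrite !inordK // => -[[[]]].
Qed.

Lemma frame_orthonormal x y z w :
  euclid x x = 1 -> euclid y y = 1 -> euclid z z = 1 -> euclid w w = 1 ->
  euclid x y = 0 -> euclid x z = 0 -> euclid x w = 0 -> euclid y z = 0 ->
  euclid y w = 0 -> euclid z w = 0 ->
  frame x y z w *m (frame x y z w)^T = 1%:M.
Proof.
move=> h1 h2 h3 h4 h12 h13 h14 h23 h24 h34.
have e (i j : 'I_4) : (frame x y z w *m (frame x y z w)^T) i j =
    euclid (nth 0 [:: x; y; z; w] i) (nth 0 [:: x; y; z; w] j).
  by rewrite mxE; apply: eq_bigr => k _; rewrite !mxE.
apply/matrixP => i j; rewrite e mxE -val_eqE /=.
by case: i => [[|[|[|[|i]]]] hi] //; case: j => [[|[|[|[|j]]]] hj] //=; rewrite euclidC.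
Qed.

Lemma row_free_orthonormal (E : 'M[R]_(4, 8)) : E *m E^T = 1%:M -> row_free E.
Proof. by move=> h; apply/row_freeP; exists E^T. Qed.

(** The matrix expressing one orthonormal frame in the other is orthogonal, of determinant 1 or
    -1. *)
Lemma PhiM_orthonormal (E F : 'M[R]_(4, 8)) : E *m E^T = 1%:M -> F *m F^T = 1%:M ->
  (E <= F)%MS -> PhiM E = PhiM F \/ PhiM E = - PhiM F.
Proof.
move=> hE hF /submxP [A EA].
have hA : A *m A^T = 1%:M.
  by rewrite -hE EA trmx_mul mulmxA -(mulmxA A) hF mulmx1.
have : \det A ^+ 2 = 1 by rewrite expr2 -{2}det_tr -det_mulmx hA det1.
move/eqP; rewrite sqrf_eq1 EA PhiM_mul => /orP[]/eqP ->; [left|right].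
  by rewrite mul1r.
by rewrite mulN1r.
Qed.

End vectors.

Ltac vec := apply/rowP => ?; rewrite !mxE; ring.

(** * The complex structure on the orthogonal complement of two orthonormal vectors *)

Definition prj (R : realType) (e1 e2 v : 'rV[R]_8) : 'rV[R]_8 :=
  v - euclid v e1 *: e1 - euclid v e2 *: e2.

Section complex_structure.
Variable R : realType.
Variables e1 e2 : 'rV[R]_8.
Hypotheses (e11 : euclid e1 e1 = 1) (e22 : euclid e2 e2 = 1) (e12 : euclid e1 e2 = 0).
Implicit Types (u v w p q x y P Q : 'rV[R]_8) (a b c : R).

Local Notation J := (tcross e1 e2).
Local Notation pr := (prj e1 e2).

Let e21 : euclid e2 e1 = 0. Proof. by rewrite euclidC. Qed.

Lemma JD u v : J (u + v) = J u + J v.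
Proof. by have := tcross_linear3 e1 e2 1 u v; rewrite !scale1r. Qed.

Lemma JZ a u : J (a *: u) = a *: J u.
Proof.
have J0 : J 0 = 0.
  have := tcross_linear3 e1 e2 (-1) 0 0; rewrite scaler0 addr0 scaleN1r addrC subrr; exact.
by rewrite -[a *: u]addr0 tcross_linear3 J0 addr0.
Qed.

Lemma JN u : J (- u) = - J u.
Proof. by rewrite -scaleN1r JZ scaleN1r. Qed.

Lemma J0 : J 0 = 0.
Proof. by have := JZ 0 0; rewrite !scale0r. Qed.

Lemma Je1 : J e1 = 0.
Proof. exact: tcross_x13. Qed.

Lemma Je2 : J e2 = 0.
Proof. exact: tcross_x23. Qed.

Lemma J_pr v : J (pr v) = J v.
Proof. by rewrite /prj !JD !JN !JZ Je1 Je2 !scaler0 oppr0 !addr0. Qed.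

Lemma euclid_J u v : euclid (J u) v = - euclid u (J v).
Proof. exact: tcross_skew. Qed.

Lemma euclid_Je1 v : euclid (J v) e1 = 0.
Proof. by rewrite euclid_J Je1 euclid0r oppr0. Qed.

Lemma euclid_Je2 v : euclid (J v) e2 = 0.
Proof. by rewrite euclid_J Je2 euclid0r oppr0. Qed.

Lemma JJ v : J (J v) = - pr v.
Proof.
rewrite tcross_tcross e11 e22 e12 /prj !(euclidC v) !mulr1 !mulr0 !subr0 expr0n subr0 scaleN1r.
vec.
Qed.

Lemma pr_J v : pr (J v) = J v.
Proof. by rewrite /prj euclid_Je1 euclid_Je2 !scale0r !subr0. Qed.

Lemma euclid_pre1 v : euclid (pr v) e1 = 0.
Proof. by rewrite /prj !euclidDl !euclidNl !euclidZl e11 e21 mulr0 mulr1 oppr0 addr0 subrr. Qed.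

Lemma euclid_pre2 v : euclid (pr v) e2 = 0.
Proof. by rewrite /prj !euclidDl !euclidNl !euclidZl e22 e12 mulr0 mulr1 oppr0 addr0 subrr. Qed.

Lemma pr_pr v : pr (pr v) = pr v.
Proof. by rewrite {1}/prj euclid_pre1 euclid_pre2 !scale0r !subr0. Qed.

Lemma prD u v : pr (u + v) = pr u + pr v.
Proof. rewrite /prj !euclidDl; vec. Qed.

Lemma prZ a u : pr (a *: u) = a *: pr u.
Proof. by rewrite /prj !euclidZl !scalerBr !scalerA. Qed.

Lemma prN u : pr (- u) = - pr u.
Proof. by rewrite -scaleN1r prZ scaleN1r. Qed.

Lemma pr_e1 : pr e1 = 0.
Proof. by rewrite /prj e11 e12 scale1r scale0r subrr subr0. Qed.

Lemma pr_e2 : pr e2 = 0.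
Proof. by rewrite /prj e22 e21 scale1r scale0r subr0 subrr. Qed.

Lemma euclid_JJ u v : euclid (J u) (J v) = euclid (pr u) v.
Proof.
rewrite euclid_J JJ euclidNr opprK /prj !euclidDl !euclidDr !euclidNl !euclidNr !euclidZl !euclidZr.
by rewrite (euclidC e1 v) (euclidC e2 v); ring.
Qed.

Lemma euclid_prpr u v : euclid (pr u) (pr v) = euclid (pr u) v.
Proof. by rewrite {2}/prj !euclidDr !euclidNr !euclidZr euclid_pre1 euclid_pre2 !mulr0 oppr0 !addr0. Qed.

Lemma euclid_pJp p : euclid p (J p) = 0.
Proof. by have := euclid_J p p; rewrite euclidC => h; lra. Qed.

Definition inC p v := exists a b, v = a *: p + b *: J p.

(** Complex linear dependence in an asymmetric form: u will be an x-derivative, and where it is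
    nonzero v is the multiple of u by a complex slope. *)
Definition dep u v := u = 0 \/ inC u v.

Lemma inC0 p : inC p 0.
Proof. by exists 0, 0; rewrite !scale0r addr0. Qed.

Lemma inC_D p u v : inC p u -> inC p v -> inC p (u + v).
Proof.
move=> [a [b ->]] [c [d ->]]; exists (a + c), (b + d).
by rewrite !scalerDl addrACA.
Qed.

Lemma inC_Z p c u : inC p u -> inC p (c *: u).
Proof.
move=> [a [b ->]]; exists (c * a), (c * b).
by rewrite scalerDr !scalerA.
Qed.

Lemma inC_N p u : inC p u -> inC p (- u).
Proof. by rewrite -scaleN1r; exact: inC_Z. Qed.

Lemma inC_B p u v : inC p u -> inC p v -> inC p (u - v).
Proof. by move=> hu hv; apply: inC_D => //; exact: inC_N. Qed.

Lemma inC_J p u : pr p = p -> inC p u -> inC p (J u).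
Proof.
move=> hp [a [b ->]]; exists (- b), a.
by rewrite JD !JZ JJ hp scalerN scaleNr addrC.
Qed.

Lemma inC_trans p u v : pr p = p -> inC p u -> inC u v -> inC p v.
Proof.
move=> hp hu [a [b ->]]; apply: inC_D; first exact: inC_Z.
by apply: inC_Z; exact: inC_J.
Qed.

Lemma inC_sym p v : pr p = p -> inC p v -> v <> 0 -> inC v p.
Proof.
move=> hp [a [b e]] v0.
have ab : a ^+ 2 + b ^+ 2 != 0.
  apply/eqP => h; apply: v0.
  have a0 : 0 <= a ^+ 2 by exact: sqr_ge0.
  have b0 : 0 <= b ^+ 2 by exact: sqr_ge0.
  have a20 : a ^+ 2 = 0 by lra.
  have b20 : b ^+ 2 = 0 by lra.
  move/eqP: a20; move/eqP: b20; rewrite !sqrf_eq0 => /eqP b0' /eqP a0'.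
  by rewrite e a0' b0' !scale0r addr0.
exists (a / (a ^+ 2 + b ^+ 2)), (- b / (a ^+ 2 + b ^+ 2)).
apply: (scalerI ab); rewrite scalerDr !scalerA.
have -> : (a ^+ 2 + b ^+ 2) * (a / (a ^+ 2 + b ^+ 2)) = a by field.
have -> : (a ^+ 2 + b ^+ 2) * (- b / (a ^+ 2 + b ^+ 2)) = - b by field.
rewrite e JD !JZ JJ hp; move: (J p) => Jp; vec.
Qed.

(** Subtracting (a + b J) (p + t x) shows that t d is a complex multiple of p + t x when p + t x is
    nonzero. If d is nonzero, then p + t x lies in the complex line of d for all t other than 0; t =
    1 and t = -1 put p and x there. *)
Lemma dep_line p q x y a b : pr p = p -> pr x = x -> pr y = y -> p <> 0 -> q = a *: p + b *: J p ->
  (forall t : R, dep (p + t *: x) (q + t *: y)) ->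
  y - a *: x - b *: J x = 0 \/ (inC p x /\ inC p y).
Proof.
move=> hp hx hy p0 hq hd; set d := y - _ - _.
have [d0|d0] := pselect (d = 0); [by left|right].
have key t : t != 0 -> inC d (p + t *: x).
  move=> t0; have [->|[c [c' e]]] := hd t; first exact: inC0.
  have [->|n0] := pselect (p + t *: x = 0); first exact: inC0.
  apply: (inC_sym _ _ d0); first by rewrite prD prZ hp hx.
  have -> : d = t^-1 *: (t *: d) by rewrite scalerA mulVf // scale1r.
  apply: inC_Z; exists (c - a), (c' - b).
  have -> : t *: d = (q + t *: y) - (a *: (p + t *: x) + b *: J (p + t *: x)).
    by rewrite /d hq JD JZ; vec.
  by rewrite e; vec.
have pd : inC d p.
  have -> : p = 2^-1 *: ((p + 1 *: x) + (p + (-1) *: x)).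
    by apply/rowP => i; rewrite !mxE; field.
  by apply: inC_Z; apply: inC_D; apply: key; rewrite ?oppr_eq0 oner_neq0.
have xd : inC d x.
  have -> : x = (p + 1 *: x) - p by rewrite scale1r addrAC subrr add0r.
  by apply: inC_B => //; apply: key; rewrite oner_neq0.
have dd : pr d = d.
  by rewrite /d !prD !prN !prZ pr_J hx hy.
have dp := inC_sym dd pd p0.
have xp := inC_trans hp dp xd; split=> //.
have -> : y = d + a *: x + b *: J x by rewrite /d; vec.
by apply: inC_D; [apply: inC_D => //; exact: inC_Z|apply: inC_Z; exact: inC_J].
Qed.

Lemma dep_plane p q x1 y1 x2 y2 a b : pr p = p -> pr x1 = x1 -> pr y1 = y1 ->
  pr x2 = x2 -> pr y2 = y2 -> p <> 0 -> q = a *: p + b *: J p ->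
  (forall s t : R, dep (p + s *: x1 + t *: x2) (q + s *: y1 + t *: y2)) ->
  (y1 - a *: x1 - b *: J x1 = 0 /\ y2 - a *: x2 - b *: J x2 = 0) \/
  [/\ inC p x1, inC p y1, inC p x2 & inC p y2].
Proof.
move=> hp hx1 hy1 hx2 hy2 p0 hq hd.
have dir c c' : (c *: y1 + c' *: y2) - a *: (c *: x1 + c' *: x2) - b *: J (c *: x1 + c' *: x2) = 0
    \/ (inC p (c *: x1 + c' *: x2) /\ inC p (c *: y1 + c' *: y2)).
  apply: (dep_line (q := q)) => //; rewrite ?prD ?prZ ?hx1 ?hx2 ?hy1 ?hy2 // => t.
  have := hd (t * c) (t * c').
  by rewrite -!addrA -!scalerA -!scalerDr.
set d1 := y1 - _ - _; set d2 := y2 - _ - _.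
have E c c' : (c *: y1 + c' *: y2) - a *: (c *: x1 + c' *: x2) - b *: J (c *: x1 + c' *: x2) = c *: d1 + c' *: d2.
  by rewrite JD !JZ /d1 /d2; vec.
have [[h1 h2]|nd] := pselect (d1 = 0 /\ d2 = 0); [by left|right].
(* The directions (c, c') killing c d1 + c' d2 form a proper subspace of the plane, so two
   independent directions avoid it. *)
have pick : exists c c' e e', [/\ c * e' - c' * e != 0, c *: d1 + c' *: d2 <> 0 & e *: d1 + e' *: d2 <> 0].
  have [z1|z1] := pselect (d1 = 0).
    have z2 : d2 <> 0 by move=> z2; apply: nd.
    exists 0, 1, 1, 1; rewrite z1 !scaler0 !scale1r !add0r.
    by split=> //; rewrite !mul0r mul1r sub0r oppr_eq0 oner_neq0.
  have [z2|z2] := pselect (d1 + d2 = 0).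
    exists 1, 0, 1, (-1); rewrite !scale1r scale0r addr0 scaleN1r mul0r mul1r subr0.
    split=> // z3; apply: z1.
    have -> : d1 = 2^-1 *: ((d1 + d2) + (d1 - d2)) by apply/rowP => i; rewrite !mxE; field.
    by rewrite z2 z3 addr0 scaler0.
  exists 1, 0, 1, 1; rewrite !scale1r scale0r addr0 mul0r mul1r subr0.
  by split=> //; exact: oner_neq0.
have [c [c' [e [e' [D n1 n2]]]]] := pick.
have [h|[k1 l1]] := dir c c'; first by case: n1; rewrite -E.
have [h|[k2 l2]] := dir e e'; first by case: n2; rewrite -E.
set D' := c * e' - c' * e in D.
have s1 (u v : 'rV[R]_8) : u = D'^-1 *: (e' *: (c *: u + c' *: v) - c' *: (e *: u + e' *: v)).
  apply: (scalerI D); rewrite scalerA mulfV // scale1r /D'; vec.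
have s2 (u v : 'rV[R]_8) : v = D'^-1 *: (c *: (e *: u + e' *: v) - e *: (c *: u + c' *: v)).
  apply: (scalerI D); rewrite scalerA mulfV // scale1r /D'; vec.
split.
- by rewrite (s1 x1 x2); apply: inC_Z; apply: inC_B; exact: inC_Z.
- by rewrite (s1 y1 y2); apply: inC_Z; apply: inC_B; exact: inC_Z.
- by rewrite (s2 x1 x2); apply: inC_Z; apply: inC_B; exact: inC_Z.
- by rewrite (s2 y1 y2); apply: inC_Z; apply: inC_B; exact: inC_Z.
Qed.

Lemma prK v : v = pr v + euclid v e1 *: e1 + euclid v e2 *: e2.
Proof. rewrite /prj; vec. Qed.

Lemma sub_span3 m (F : 'M[R]_(m, 8)) v : (e1 <= F)%MS -> (e2 <= F)%MS ->
  (pr v <= F)%MS = (v <= F)%MS.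
Proof.
move=> h1 h2; apply/idP/idP => h.
  by rewrite (prK v); apply: addmx_sub; [apply: addmx_sub => //|]; exact: scalemx_sub.
by rewrite /prj; apply: addmx_sub; [apply: addmx_sub => //|]; rewrite eqmx_opp; exact: scalemx_sub.
Qed.

Lemma row_free_frame P Q : row_free (frame e1 e2 P Q) ->
  pr P <> 0 /\ forall a, pr Q <> a *: pr P.
Proof.
rewrite /row_free => /eqP rk.
have h1 (v : 'rV[R]_8) : (e1 <= col_mx e1 (col_mx e2 v))%MS by rewrite -addsmxE addsmxSl.
have h2 (v : 'rV[R]_8) : (e2 <= col_mx e1 (col_mx e2 v))%MS.
  by rewrite -addsmxE (submx_trans _ (addsmxSr _ _)) // -addsmxE addsmxSl.
have h3 (v : 'rV[R]_8) : (v <= col_mx e1 (col_mx e2 v))%MS.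
  by rewrite -addsmxE (submx_trans _ (addsmxSr _ _)) // -addsmxE addsmxSr.
have bad (v : 'rV[R]_8) : (P <= col_mx e1 (col_mx e2 v))%MS -> (Q <= col_mx e1 (col_mx e2 v))%MS -> False.
  move=> hP hQ; have /mxrankS : (frame e1 e2 P Q <= col_mx e1 (col_mx e2 v))%MS.
    exact: frame_sub.
  by rewrite rk => h; have := leq_trans h (rank_leq_row _).
split=> [p0|a qa].
  by apply: (bad Q); [rewrite -sub_span3 // p0 sub0mx|exact: h3].
apply: (bad P); first exact: h3.
by rewrite -sub_span3 // qa; apply: scalemx_sub; rewrite sub_span3.
Qed.

(** The equality case of the Cauchy-Schwarz inequality. *)
Lemma unit_eq u v : euclid u u = 1 -> euclid v v = 1 -> euclid v u ^+ 2 = 1 ->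
  u = euclid v u *: v.
Proof.
move=> hu hv h; apply/eqP; rewrite -subr_eq0; apply/eqP; apply: euclid_eq0.
rewrite euclidDl !euclidDr !euclidNl !euclidNr !euclidZl !euclidZr hu hv (euclidC u v).
by rewrite mulr1 -expr2 h; ring.
Qed.

(** Gram-Schmidt completes e1, e2 to an orthonormal frame e1, e2, e3, e4 of the plane. Phi on it is
    the inner product of the unit vectors J e3 and e4; if it is 1 or -1, they are parallel.
    Degenerate frames satisfy [dep] trivially. *)
Lemma cayley_dep P Q :
  (forall E : 'M[R]_(4, 8), E *m E^T = 1%:M -> row_free (frame e1 e2 P Q) ->
     (E == frame e1 e2 P Q)%MS -> PhiM E = 1 \/ PhiM E = - 1) ->
  dep (pr P) (pr Q).
Proof.
move=> hE; have [p0|p0] := eqVneq (pr P) 0; [by left|right].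
set p := pr P in p0 *; set q := pr Q.
have pp := euclid_gt0 p0.
pose c := euclid q p / euclid p p.
pose q' := q - c *: p.
have [q0|q0] := eqVneq q' 0.
  by exists c, 0; rewrite scale0r addr0; apply/eqP; rewrite -subr_eq0 -/q' q0.
have qq := euclid_gt0 q0.
have q'p : euclid q' p = 0.
  by rewrite /q' euclidDl euclidNl euclidZl /c divfK ?subrr // gt_eqF.
pose s := Num.sqrt (euclid p p); pose t := Num.sqrt (euclid q' q').
have s0 : s != 0 by rewrite gt_eqF // sqrtr_gt0.
have t0 : t != 0 by rewrite gt_eqF // sqrtr_gt0.
have ss : s ^+ 2 = euclid p p by rewrite sqr_sqrtr // ltW.
have tt : t ^+ 2 = euclid q' q' by rewrite sqr_sqrtr // ltW.
pose e3 := s^-1 *: p; pose e4 := t^-1 *: q'.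
have o13 : euclid e1 e3 = 0 by rewrite euclidZr euclidC euclid_pre1 mulr0.
have o23 : euclid e2 e3 = 0 by rewrite euclidZr euclidC euclid_pre2 mulr0.
have o14 : euclid e1 e4 = 0.
  by rewrite euclidZr euclidC /q' euclidDl euclidNl euclidZl !euclid_pre1 mulr0 subrr mulr0.
have o24 : euclid e2 e4 = 0.
  by rewrite euclidZr euclidC /q' euclidDl euclidNl euclidZl !euclid_pre2 mulr0 subrr mulr0.
have o34 : euclid e3 e4 = 0 by rewrite euclidZr euclidZl euclidC q'p !mulr0.
have o33 : euclid e3 e3 = 1 by rewrite euclidZl euclidZr -ss; field.
have o44 : euclid e4 e4 = 1 by rewrite euclidZl euclidZr -tt; field.
have hO := frame_orthonormal e11 e22 o33 o44 e12 o13 o14 o23 o24 o34.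
have rE := row_free_orthonormal hO.
have [f1 f2 f3 f4] := sub_frame e1 e2 P Q.
have sub : (frame e1 e2 e3 e4 <= frame e1 e2 P Q)%MS.
  apply: frame_sub => //; first by rewrite scalemx_sub // sub_span3.
  rewrite scalemx_sub // addmx_sub //; first by rewrite sub_span3.
  by rewrite eqmx_opp scalemx_sub // sub_span3.
have rF : row_free (frame e1 e2 P Q).
  rewrite /row_free eqn_leq rank_leq_row /= -{1}(eqP rE); exact: mxrankS.
have eqs : (frame e1 e2 e3 e4 == frame e1 e2 P Q)%MS.
  by rewrite -(geq_leqif (mxrank_leqif_eq sub)) (eqP rE) (eqP rF).
have JJ3 : euclid (J e3) (J e3) = 1.
  by rewrite euclid_JJ /e3 prZ pr_pr -/e3.
have := hE _ hO rF eqs; rewrite -[PhiM _]/(Phi e1 e2 e3 e4) -euclid_tcross => h.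
have [sg [sg1 hJ]] : exists sg : R, sg ^+ 2 = 1 /\ e4 = sg *: J e3.
  have h2 : euclid (J e3) e4 ^+ 2 = 1 by case: h => ->; rewrite ?sqrrN expr1n.
  by exists (euclid (J e3) e4); split=> //; exact: unit_eq.
have : q' = (t * sg / s) *: J P.
  have -> : q' = t *: e4 by rewrite /e4 scalerA mulfV // scale1r.
  by rewrite hJ JZ /p J_pr !scalerA mulrA.
rewrite /q' => /eqP; rewrite subr_eq => /eqP ->.
by exists c, (t * sg / s); rewrite J_pr addrC.
Qed.

(** Modulo e1 and e2 the plane is spanned by pr P and J P, so normalising pr P gives the frame e1,
    e2, e3, J e3 on which Phi is 1; on the given frame Phi is the squared length of pr P. *)
Lemma cayley_frame P Q c1 c2 : Q = J P + c1 *: e1 + c2 *: e2 ->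
  row_free (frame e1 e2 P Q) ->
  0 < Phi e1 e2 P Q /\
  forall E : 'M[R]_(4, 8), E *m E^T = 1%:M -> (E <= frame e1 e2 P Q)%MS ->
    PhiM E = 1 \/ PhiM E = - 1.
Proof.
move=> hQ rF; have [/eqP p0 _] := row_free_frame rF.
have pp := euclid_gt0 p0.
have hPhi : Phi e1 e2 P Q = euclid (pr P) (pr P).
  by rewrite -euclid_tcross euclid_prpr -euclid_JJ hQ !euclidDr !euclidZr euclid_Je1 euclid_Je2 !mulr0 !addr0.
split; first by rewrite hPhi.
pose s := Num.sqrt (euclid (pr P) (pr P)).
have s0 : s != 0 by rewrite gt_eqF // sqrtr_gt0.
have ss : s ^+ 2 = euclid (pr P) (pr P) by rewrite sqr_sqrtr // ltW.
pose e3 := s^-1 *: pr P; pose e4 := J e3.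
have o13 : euclid e1 e3 = 0 by rewrite euclidZr euclidC euclid_pre1 mulr0.
have o23 : euclid e2 e3 = 0 by rewrite euclidZr euclidC euclid_pre2 mulr0.
have o33 : euclid e3 e3 = 1 by rewrite euclidZl euclidZr -ss; field.
have o14 : euclid e1 e4 = 0 by rewrite euclidC euclid_Je1.
have o24 : euclid e2 e4 = 0 by rewrite euclidC euclid_Je2.
have o34 : euclid e3 e4 = 0 by exact: euclid_pJp.
have o44 : euclid e4 e4 = 1 by rewrite euclid_JJ /e3 prZ pr_pr -/e3.
have hO := frame_orthonormal e11 e22 o33 o44 e12 o13 o14 o23 o24 o34.
have [f1 f2 f3 f4] := sub_frame e1 e2 e3 e4.
have hP : (pr P <= frame e1 e2 e3 e4)%MS.
  have -> : pr P = s *: e3 by rewrite /e3 scalerA mulfV // scale1r.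
  exact: scalemx_sub.
have sub : (frame e1 e2 P Q <= frame e1 e2 e3 e4)%MS.
  apply: frame_sub => //; first by rewrite -sub_span3.
  rewrite -sub_span3 // hQ !prD !prZ pr_e1 pr_e2 !scaler0 !addr0 pr_J.
  have -> : J P = s *: e4 by rewrite /e4 /e3 JZ J_pr scalerA mulfV // scale1r.
  exact: scalemx_sub.
have h1 : PhiM (frame e1 e2 e3 e4) = 1.
  by rewrite -[PhiM _]/(Phi e1 e2 e3 e4) -euclid_tcross.
move=> E hE sE; rewrite -h1; apply: PhiM_orthonormal => //.
exact: submx_trans sub.
Qed.

End complex_structure.

(** * Calculus of analytic vector functions *)

Section vector_calculus.
Variable R : realType.
Implicit Types (F G H K : R * R -> 'rV[R]_8) (f g : R * R -> R) (p q u : R * R).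

Definition van F p := forall i, an (fun q => F q 0 i) p.

Definition vd u F p : 'rV[R]_8 := \row_i 'D_u (fun q => F q 0 i) p.

Lemma vdE u F p i : vd u F p 0 i = 'D_u (fun q => F q 0 i) p.
Proof. by rewrite mxE. Qed.

Definition vdx F p := vd (1, 0) F p.
Definition vdy F p := vd (0, 1) F p.

Lemma derive_van u F p : van F p -> 'D_u F p = vd u F p.
Proof.
move=> h; rewrite derive_mx; last first.
  apply/derivable_mxP => i j; apply: diff_derivable; rewrite (ord1 i).
  by apply: an_differentiable; exact: h.
by apply/rowP => j; rewrite !mxE.
Qed.

Lemma van_near F p : van F p -> \forall q \near p, van F q.
Proof.
move=> h; have hi i : \forall q \near p, an (fun q => F q 0 i) q by exact: an_near.
exact: (@filter_forall _ _ _ _ _ hi).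
Qed.

Lemma van_vd u F p : van F p -> van (vd u F) p.
Proof.
move=> h i; have := an_derive u (h i); congr an; apply/funext => q; by rewrite mxE.
Qed.

Lemma vd_ext u F G p : (\forall q \near p, F q = G q) -> vd u F p = vd u G p.
Proof.
move=> e; apply/rowP => i; rewrite !mxE; apply: near_eq_derive.
by apply: filterS e => q ->.
Qed.

Lemma van_cst w p : van (fun=> w) p.
Proof. by move=> i; exact: an_cst. Qed.

Lemma vanD F G p : van F p -> van G p -> van (fun q => F q + G q) p.
Proof.
move=> hF hG i; have := an_add (hF i) (hG i); congr an; apply/funext => q.
by rewrite mxE.
Qed.

Lemma vanZ f F p : an f p -> van F p -> van (fun q => f q *: F q) p.
Proof.
move=> hf hF i; have := an_mul hf (hF i); congr an; apply/funext => q.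
by rewrite mxE.
Qed.

Lemma vanN F p : van F p -> van (fun q => - F q) p.
Proof.
move=> hF i; have := an_opp (hF i); congr an; apply/funext => q.
by rewrite mxE.
Qed.

Lemma vanB F G p : van F p -> van G p -> van (fun q => F q - G q) p.
Proof. by move=> hF hG; apply: vanD => //; exact: vanN. Qed.

Lemma an_euclid F G p : van F p -> van G p -> an (fun q => euclid (F q) (G q)) p.
Proof. by move=> hF hG; apply: an_sum => i _; apply: an_mul. Qed.

(** The coordinates of the triple cross product are polynomials with constant coefficients, which
    reduces its analyticity and its product rule to scalar functions. *)
Lemma tcross_expand (x y z : 'rV[R]_8) j : tcross x y z 0 j =
  \sum_(a < 8) \sum_(b < 8) \sum_(c < 8) x 0 a * (y 0 b * (z 0 c *
    tcross (delta_mx 0 a) (delta_mx 0 b) (delta_mx 0 c) 0 j)).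
Proof.
have lin (L : 'rV[R]_8 -> 'rV[R]_8) (v : 'rV[R]_8) :
    (forall a (u w : 'rV[R]_8), L (a *: u + w) = a *: L u + L w) ->
    L v 0 j = \sum_(a < 8) v 0 a * L (delta_mx 0 a) 0 j.
  move=> hL; have L0 : L 0 = 0.
    by have := hL (-1) 0 0; rewrite scaler0 addr0 scaleN1r addNr.
  rewrite {1}(row_sum_delta v).
  have : forall s : seq 'I_8, L (\sum_(i <- s) v 0 i *: delta_mx 0 i) 0 j = \sum_(i <- s) v 0 i * L (delta_mx 0 i) 0 j.
    elim=> [|i s IH]; first by rewrite !big_nil L0 mxE.
    by rewrite !big_cons hL mxE IH mxE.
  by apply.
rewrite (lin (fun v => tcross v y z)); last by move=> *; exact: tcross_linear1.
apply: eq_bigr => a _; rewrite (lin (fun v => tcross _ v z)); last by move=> *; exact: tcross_linear2.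
rewrite mulr_sumr; apply: eq_bigr => b _.
rewrite (lin (fun v => tcross _ _ v)); last by move=> *; exact: tcross_linear3.
by rewrite !mulr_sumr.
Qed.

Lemma van_tcross F G H p : van F p -> van G p -> van H p ->
  van (fun q => tcross (F q) (G q) (H q)) p.
Proof.
move=> hF hG hH j.
have := @an_sum R _ (index_enum 'I_8) xpredT (fun a q => \sum_(b < 8) \sum_(c < 8) F q 0 a * (G q 0 b * (H q 0 c *
    tcross (delta_mx 0 a) (delta_mx 0 b) (delta_mx 0 c) 0 j))) p.
move=> h; have {}h := h (fun a _ => an_sum _ _).
have := h _; rewrite (_ : (fun q => \sum_(a < 8) _) = (fun q => tcross (F q) (G q) (H q) 0 j)); last first.
  by apply/funext => q; rewrite tcross_expand.
apply => a b _; apply: an_sum => c _.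
by apply: an_mul => //; apply: an_mul => //; apply: an_mul => //; exact: an_cst.
Qed.

Lemma dM u f g p : an f p -> an g p ->
  'D_u (fun q => f q * g q) p = 'D_u f p * g p + f p * 'D_u g p.
Proof.
move=> /an_differentiable hf /an_differentiable hg.
rewrite (_ : (fun q => f q * g q) = f * g) // deriveM; try exact: diff_derivable.
by rewrite /GRing.scale /= addrC mulrC [X in _ + X]mulrC [X in _ + X]mulrC.
Qed.

Lemma dD u f g p : an f p -> an g p ->
  'D_u (fun q => f q + g q) p = 'D_u f p + 'D_u g p.
Proof.
move=> /an_differentiable hf /an_differentiable hg.
by rewrite (_ : (fun q => f q + g q) = f + g) // deriveD //; exact: diff_derivable.
Qed.

Lemma dsum u (I : Type) (s : seq I) (f : I -> R * R -> R) p : (forall i, an (f i) p) ->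
  'D_u (fun q => \sum_(i <- s) f i q) p = \sum_(i <- s) 'D_u (f i) p.
Proof.
move=> h; elim: s => [|i s IH].
  under eq_fun do rewrite big_nil; rewrite big_nil; exact: derive_cst.
under eq_fun do rewrite big_cons; rewrite big_cons dD // ?IH //.
exact: an_sum.
Qed.

Lemma dcst u (c : R) p : 'D_u (fun=> c) p = 0.
Proof. exact: derive_cst. Qed.

Lemma vdD u F G p : van F p -> van G p -> vd u (fun q => F q + G q) p = vd u F p + vd u G p.
Proof.
move=> hF hG; apply/rowP => i; rewrite !mxE -dD //.
by congr ('D_u _ p); apply/funext => q; rewrite mxE.
Qed.

Lemma vdZ u f F p : an f p -> van F p ->
  vd u (fun q => f q *: F q) p = 'D_u f p *: F p + f p *: vd u F p.
Proof.
move=> hf hF; apply/rowP => i; rewrite !mxE -dM //.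
by congr ('D_u _ p); apply/funext => q; rewrite mxE.
Qed.

Lemma vdZl u c F p : van F p -> vd u (fun q => c *: F q) p = c *: vd u F p.
Proof. by move=> hF; rewrite (@vdZ _ (fun=> c)) //; [rewrite dcst scale0r add0r|exact: an_cst]. Qed.

Lemma d_euclid u F G p : van F p -> van G p ->
  'D_u (fun q => euclid (F q) (G q)) p = euclid (vd u F p) (G p) + euclid (F p) (vd u G p).
Proof.
move=> hF hG; rewrite dsum => [|i]; last exact: an_mul.
by rewrite /euclid -big_split; apply: eq_bigr => i _; rewrite dM // !mxE.
Qed.

Lemma d_euclid_cst u (w : 'rV[R]_8) F p : van F p ->
  'D_u (fun q => euclid w (F q)) p = euclid w (vd u F p).
Proof.
move=> hF; rewrite (@d_euclid _ (fun=> w)) //; last exact: van_cst.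
rewrite (_ : vd u _ p = 0) ?euclid0l ?add0r //.
by apply/rowP => i; rewrite !mxE dcst.
Qed.

Lemma vd_tcross u F G H p : van F p -> van G p -> van H p ->
  vd u (fun q => tcross (F q) (G q) (H q)) p =
  tcross (vd u F p) (G p) (H p) + tcross (F p) (vd u G p) (H p) + tcross (F p) (G p) (vd u H p).
Proof.
move=> hF hG hH; apply/rowP => j.
have addE (x y : 'rV[R]_8) : (x + y) 0 j = x 0 j + y 0 j by rewrite mxE.
rewrite !addE vdE !tcross_expand.
under eq_fun do rewrite tcross_expand.
pose T a b c : R := tcross (delta_mx 0 a) (delta_mx 0 b) (delta_mx 0 c) 0 j.
have a1 c (t : R) : an (fun q => H q 0 c * t) p by apply: an_mul => //; exact: an_cst.
have a2 b c (t : R) : an (fun q => G q 0 b * (H q 0 c * t)) p by exact: an_mul.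
have a3 a b c (t : R) : an (fun q => F q 0 a * (G q 0 b * (H q 0 c * t))) p by exact: an_mul.
rewrite dsum => [|a]; last by apply: an_sum => b _; apply: an_sum.
rewrite -!big_split; apply: eq_bigr => a _ /=.
rewrite dsum => [|b]; last exact: an_sum.
rewrite -!big_split; apply: eq_bigr => b _ /=.
rewrite dsum // -!big_split; apply: eq_bigr => c _ /=.
rewrite dM // dM // (@dM _ _ (fun=> _)) // ?dcst; last exact: an_cst.
by rewrite !vdE mulr0 addr0 mulrDr !addrA.
Qed.

Lemma vd_swap F p : van F p -> vdy (vdx F) p = vdx (vdy F) p.
Proof.
move=> hF; apply/rowP => i.
have E u : (fun q => vd u F q 0 i) = 'D_u (fun q => F q 0 i).
  by apply/funext => q; exact: vdE.
transitivity ('D_((0, 1) : R * R) (fun q => vdx F q 0 i) p); first exact: vdE.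
transitivity ('D_((1, 0) : R * R) (fun q => vdy F q 0 i) p); last by symmetry; exact: vdE.
by rewrite /vdx /vdy !E; exact: an_derive_swap (hF i).
Qed.

Lemma an_nz f p : an f p -> f p != 0 -> \forall q \near p, f q != 0.
Proof.
by move=> hf h0; have := an_continuous hf; move/cvgrPdist_lt => /(_ `|f p|); rewrite normr_gt0 => /(_ h0);
  apply: filterS => q; apply: contraTneq => ->; rewrite subr0 ltxx.
Qed.

Lemma an_bounded f p : an f p -> \forall q \near p, `|f q| <= `|f p| + 1.
Proof.
move=> hf; have := an_continuous hf; move/cvgrPdist_lt => /(_ 1 ltr01); apply: filterS => q h.
have -> : f q = f p - (f p - f q) by ring.
by apply: le_trans (ler_normB _ _) _; rewrite lerD2l ltW.
Qed.

Lemma van_neq0 F p : van F p -> F p <> 0 -> \forall q \near p, F q <> 0.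
Proof.
move=> hF F0; have d1 : euclid (F p) (F p) != 0 by rewrite gt_eqF // euclid_gt0 //; exact/eqP.
have := an_nz (an_euclid hF hF) d1.
by apply: filterS => w /eqP h h'; apply: h; rewrite h' euclid0l.
Qed.

End vector_calculus.

(** * Uniqueness for linear differential systems *)

Section gronwall.
Variable R : realType.

(** exp(- K t) z(t) is nonincreasing and starts at 0. *)
Lemma gronwall_line (z : R -> R) (K : R) : (forall t : R, 0 <= t <= 1 -> derivable z t 1) ->
  (forall t : R, 0 <= t <= 1 -> 'D_1 z t <= K * z t) -> z 0 = 0 -> z 1 <= 0.
Proof.
move=> dz hz z0.
pose w (t : R) : R := expR (- K * t) * z t.
have de (t : R) : is_derive t (1 : R) (fun t : R => expR (- K * t)) (- K * expR (- K * t)).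
  have h0 : is_derive t (1 : R) (fun t : R => - K * t) (- K *: 1) := is_deriveZ (- K) (is_derive_id t (1 : R)).
  have h1 : is_derive t (1 : R) (fun t : R => - K * t) (- K).
    by apply: (is_derive_eq h0); rewrite /GRing.scale /= mulr1.
  have h2 : is_derive t (1 : R) (fun t : R => expR (- K * t)) _ :=
    @is_derive1_comp R expR (fun t => - K * t) t _ _ (is_derive_expR _) h1.
  by apply: (is_derive_eq h2); rewrite /GRing.scale /= ?(mulrC (- K)).
have dw (t : R) : 0 <= t <= 1 -> is_derive t 1 w (expR (- K * t) * ('D_1 z t - K * z t)).
  move=> ht; have hzt := derivableP (dz t ht).
  have h0 : is_derive t (1 : R) w _ := @is_deriveM _ _ (fun t : R => expR (- K * t)) z t 1 _ _ (de t) hzt.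
  by apply: (is_derive_eq h0); rewrite /GRing.scale /=; ring.
have cw : {within `[0, 1], continuous w}.
  apply: derivable_within_continuous => t; rewrite in_itv /= => ht.
  by have [] := dw t ht.
have : w 1 <= w 0.
  apply: (@ler0_derive1_le_cc _ w 0 1) => //.
  - move=> t; rewrite in_itv /= => /andP[t0 t1].
    by have [] := dw t _; rewrite ?(ltW t0) ?(ltW t1).
  - move=> t; rewrite in_itv /= => /andP[t0 t1].
    have ht : 0 <= t <= 1 by rewrite !ltW.
    have [_ e] := dw t ht; rewrite derive1E e.
    by rewrite pmulr_rle0 ?expR_gt0 // subr_le0; exact: hz.
  - by rewrite in_itv /= ler01 lexx.
  - by rewrite in_itv /= ler01 lexx.
rewrite /w z0 mulr0 mulr1 pmulr_rle0 //; exact: expR_gt0.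
Qed.

Lemma line_derive (f : R * R -> R) (p : R * R) (h k t : R) :
  differentiable f (p.1 + t * h, p.2 + t * k) ->
  is_derive t (1 : R) (fun t : R => f (p.1 + t * h, p.2 + t * k))
    (h * pdx f (p.1 + t * h, p.2 + t * k) + k * pdy f (p.1 + t * h, p.2 + t * k)).
Proof.
move=> df.
have d1 (a b : R) : is_derive t (1 : R) (fun t : R => a + t * b) b.
  have h0 : is_derive t (1 : R) (fun t : R => t * b) _ :=
    @is_deriveM _ _ id (fun=> b) t 1 _ _ (is_derive_id _ _) (is_derive_cst _ _ _).
  have h1 : is_derive t (1 : R) (fun t : R => a + t * b) _ := is_deriveD (is_derive_cst a t (1 : R)) h0.
  by apply: (is_derive_eq h1); rewrite /GRing.scale /= mulr0 !add0r mulr1.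
have [g1 e1] := d1 p.1 h; have [g2 e2] := d1 p.2 k.
have g1' : differentiable (fun t : R => p.1 + t * h) t by apply/derivable1_diffP.
have g2' : differentiable (fun t : R => p.2 + t * k) t by apply/derivable1_diffP.
have gp : differentiable (fun t : R => (p.1 + t * h, p.2 + t * k)) t by exact: differentiable_pair.
have dfg : differentiable (f \o (fun t : R => (p.1 + t * h, p.2 + t * k))) t by exact: differentiable_comp.
apply: DeriveDef; first exact: diff_derivable.
have := @derive_comp _ _ _ _ f (fun t : R => (p.1 + t * h, p.2 + t * k)) t 1 gp df.
by rewrite derive_pair // e1 e2 derive_pd.
Qed.

Lemma sum_pairs n (K : R) (a : 'I_n -> R) :
  \sum_(i < n) \sum_(l < n) K * (a i + a l) = 2 * K * n%:R * \sum_(i < n) a i.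
Proof.
under eq_bigr => j _ do rewrite -mulr_sumr big_split /= sumr_const card_ord.
rewrite -mulr_sumr big_split /= sumr_const card_ord sumrMnl.
by move: (\sum_(i < n) a i) => s; rewrite -(mulr_natr s); ring.
Qed.

(** Along each segment from p, the sum of squares z satisfies z' <= 4 C n z: the products |y i| |y
    l| are bounded by half the sum of the two squares. *)
Lemma gronwall n (y : 'I_n -> R * R -> R) (p : R * R) (C : R) : 0 <= C ->
  (forall i, an (y i) p) -> (forall i, y i p = 0) ->
  (\forall q \near p, forall i, `|pdx (y i) q| <= C * \sum_(l < n) `|y l q| /\
                                `|pdy (y i) q| <= C * \sum_(l < n) `|y l q|) ->
  \forall q \near p, forall i, y i q = 0.
Proof.
move=> C0 hy y0 hb.
have han : \forall q \near p, forall i, an (y i) q.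
  have hi i : \forall q \near p, an (y i) q by exact: an_near.
  exact: (@filter_forall _ _ _ _ _ hi).
have [d d0 hd] := (@near_box R _ p).1 (filterI han hb).
(* The bound 1 on h and k keeps the velocity of the segment out of the constant. *)
apply/near_box; exists (Num.min d 1); first by rewrite lt_min d0 ltr01.
move=> h k; rewrite !le_min => /andP[hh h1] /andP[hk k1] i.
pose z (t : R) := \sum_(i < n) y i (p.1 + t * h, p.2 + t * k) ^+ 2.
have inb (t : R) : 0 <= t <= 1 -> `|t * h| <= d /\ `|t * k| <= d.
  move=> /andP[t0 t1]; rewrite !normrM (ger0_norm t0).
  by split; rewrite -[leRHS]mul1r; apply: ler_pM.
have dz (t : R) : 0 <= t <= 1 -> is_derive t (1 : R) z (\sum_(i < n) 2 * y i (p.1 + t * h, p.2 + t * k) *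
    (h * pdx (y i) (p.1 + t * h, p.2 + t * k) + k * pdy (y i) (p.1 + t * h, p.2 + t * k))).
  move=> ht; have [b1 b2] := inb t ht; have [ha _] := hd _ _ b1 b2.
  have hs j : is_derive t (1 : R) (fun t : R => y j (p.1 + t * h, p.2 + t * k) ^+ 2)
     (2 * y j (p.1 + t * h, p.2 + t * k) *
    (h * pdx (y j) (p.1 + t * h, p.2 + t * k) + k * pdy (y j) (p.1 + t * h, p.2 + t * k))).
    have hl := line_derive (an_differentiable (ha j)).
    have h0 : is_derive t (1 : R) (fun t : R => y j (p.1 + t * h, p.2 + t * k) ^+ 2) _ :=
      is_deriveM hl hl.
    by apply: (is_derive_eq h0); rewrite /GRing.scale /=; ring.
  have := @is_derive_sum _ _ _ n (fun j (t : R) => y j (p.1 + t * h, p.2 + t * k) ^+ 2) t 1 _ hs.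
  rewrite (_ : \sum_(i < n) _ = z) //; apply/funext => t'; rewrite /z.
  by rewrite fct_sumE.
have hle (t : R) : 0 <= t <= 1 -> 'D_1 z t <= (4 * C * n%:R) * z t.
  move=> ht; have [_ ->] := dz t ht; have [b1 b2] := inb t ht; have [_ hbd] := hd _ _ b1 b2.
  rewrite /z; set q := (p.1 + t * h, p.2 + t * k) in hbd *.
  pose s := \sum_(l < n) `|y l q|.
  have s0 : 0 <= s by apply: sumr_ge0.
  have step1 : \sum_(i < n) 2 * y i q * (h * pdx (y i) q + k * pdy (y i) q) <= \sum_(i < n) \sum_(l < n) 2 * C * (y i q ^+ 2 + y l q ^+ 2).
    apply: ler_sum => j _; apply: (@le_trans _ _ (2 * `|y j q| * (2 * (C * s)))).
      apply: le_trans (ler_norm _) _; rewrite normrM normrM (@ger0_norm _ 2) //.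
      apply: ler_wpM2l; first by rewrite mulr_ge0.
      apply: le_trans (ler_normD _ _) _; rewrite !normrM.
      have [x1 x2] := hbd j.
      have -> : 2 * (C * s) = 1 * (C * s) + 1 * (C * s) by ring.
      by apply: lerD; apply: ler_pM.
    rewrite (_ : 2 * `|y j q| * (2 * (C * s)) = \sum_(l < n) 2 * C * (2 * `|y j q| * `|y l q|)); last first.
      by rewrite -mulr_sumr -mulr_sumr -/s; ring.
    apply: ler_sum => l _; apply: ler_wpM2l; first by rewrite mulr_ge0.
    rewrite -(real_normK (num_real (y j q))) -(real_normK (num_real (y l q))).
    by have := sqr_ge0 (`|y j q| - `|y l q|); rewrite sqrrB; lra.
  apply: le_trans step1 _; rewrite le_eqVlt; apply/orP; left; apply/eqP.
  by rewrite (sum_pairs (2 * C) (fun i => y i q ^+ 2)); congr (_ * _); ring.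
have z1 : z 1 <= 0.
  apply: gronwall_line hle _; first by move=> t ht; have [] := dz t ht.
  by rewrite /z big1 // => j _; rewrite !mul0r !addr0 -surjective_pairing y0 expr0n.
have : z 1 == 0 by rewrite eq_le z1 sumr_ge0 // => j _; exact: sqr_ge0.
rewrite /z psumr_eq0 => [/allP /(_ i (mem_index_enum _))|j _]; last exact: sqr_ge0.
by rewrite !mul1r sqrf_eq0 => /eqP.
Qed.

End gronwall.

Local Notation coord := Defs.coord.
Local Notation jacobian := Defs.jacobian.

(** * Charts *)

Section charts.
Variables (R : realType) (S : analytic_surface R).
Implicit Types (c d : chart R S) (x y : S) (F : S -> 'rV[R]_8).

Lemma param_coord c x : dom c x -> param c (coord c x) = x.
Proof. by move=> hx; apply: coordK; exact: mem_set. Qed.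

Lemma near_dom c x : dom c x -> \forall y \near x, dom c y.
Proof. by move=> hx; apply: open_nbhs_nbhs; split=> //; exact: dom_open. Qed.

Lemma cvg_param c x : dom c x -> param c @ (coord c x) --> x.
Proof.
move=> hx; rewrite -{2}(param_coord hx); apply: param_continuous.
by apply: mem_set; exists x.
Qed.

Lemma cvg_coord c x : dom c x -> coord c @ x --> coord c x.
Proof. by move=> hx; apply: Defs.coord_continuous; exact: mem_set. Qed.

Lemma near_cod c x : dom c x ->
  \forall q \near coord c x, coord c (param c q) = q /\ dom c (param c q).
Proof.
move=> hx; have : nbhs (coord c x) (coord c @` dom c).
  by apply: open_nbhs_nbhs; split; [exact: cod_open|exists x].
by apply: filterS => _ [y hy <-]; rewrite param_coord.
Qed.

Lemma near_param c x (P : S -> Prop) : dom c x -> (\forall y \near x, P y) ->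
  \forall q \near coord c x, P (param c q).
Proof. by move=> hx hP; exact: (cvg_param hx). Qed.

Lemma near_coord c x (P : R * R -> Prop) : dom c x -> (\forall q \near coord c x, P q) ->
  \forall y \near x, P (coord c y).
Proof. by move=> hx hP; exact: (cvg_coord hx). Qed.

Lemma atlas_local c : atlas c -> local_coordinates c.
Proof. by move=> hc d hd; split; exact: atlas_compatible. Qed.

Lemma an_transition c d x : transition_analytic c d -> dom c x -> dom d x ->
  an (fun q => (coord d (param c q)).1) (coord c x) /\
  an (fun q => (coord d (param c q)).2) (coord c x).
Proof. by move=> h hc hd; have [h1 h2] := h x hc hd; split; apply/anP. Qed.

Lemma an_change c d x (f : S -> R) : transition_analytic c d -> dom c x -> dom d x ->
  an (f \o param d) (coord d x) -> an (f \o param c) (coord c x).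
Proof.
move=> h hc hd hf; have [h1 h2] := an_transition h hc hd.
have E : (fun q => f (param d (coord d (param c q)))) =
    (fun q => (f \o param d) ((coord d (param c q)).1, (coord d (param c q)).2)).
  by apply/funext => q; rewrite -surjective_pairing.
apply: (@an_ext _ (fun q => f (param d (coord d (param c q))))).
  have := near_param hc (near_dom hd); apply: filterS => q hq.
  by rewrite /= param_coord.
rewrite E; apply: an_comp => //.
by rewrite -surjective_pairing param_coord.
Qed.

Lemma van_chart c x F : local_coordinates c -> dom c x -> analytic_map F ->
  van (F \o param c) (coord c x).
Proof.
move=> hc hx hF i; have [d hd dx] := atlas_cover x.
apply: (@an_change c d x (fun y => F y 0 i)) => //; first by have [] := hc d hd.
by apply/anP; exact: hF.
Qed.

Lemma vd_change c d x F u : transition_analytic d c -> dom c x -> dom d x ->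
  van (F \o param c) (coord c x) ->
  vd u (F \o param d) (coord d x) =
    'D_u (fun q => (coord c (param d q)).1) (coord d x) *: vdx (F \o param c) (coord c x) +
    'D_u (fun q => (coord c (param d q)).2) (coord d x) *: vdy (F \o param c) (coord c x).
Proof.
move=> h hc hd hF; have [h1 h2] := an_transition h hd hc.
have E : (coord c (param d (coord d x))) = coord c x by rewrite param_coord.
have Ep : ((coord c (param d (coord d x))).1, (coord c (param d (coord d x))).2) = coord c x.
  by rewrite -surjective_pairing.
apply/rowP => i.
have -> : vd u (F \o param d) (coord d x) 0 i = 'D_u (fun q => F (param c (coord c (param d q))) 0 i) (coord d x).
  rewrite vdE; apply: near_eq_derive; have := near_param hd (near_dom hc); apply: filterS => q hq.
  by rewrite /= param_coord.
have dF := an_differentiable (hF i).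
have := @pd_comp R (fun q => F (param c q) 0 i) _ _ (coord d x) u _ (an_differentiable h1) (an_differentiable h2).
rewrite Ep => /(_ dF).
rewrite (_ : (fun z => _) = (fun z => F (param c (coord c (param d z))) 0 i)); last first.
  by apply/funext => z; rewrite -surjective_pairing.
move=> ->; have addE (a b : R) (v w : 'rV[R]_8) : (a *: v + b *: w) 0 i = a * v 0 i + b * w 0 i.
  by rewrite !mxE.
by rewrite addE /vdx /vdy !vdE.
Qed.

(** A directional derivative depends only on the restriction to one line. This identifies the s and
    t derivatives of [iota_M], taken on a product, with those of the ruling at fixed r. *)
Lemma derive_shape (V V' W : normedModType R) (f : V -> W) (g : V' -> W) (a v : V) (a' v' : V') :
  (forall t : R, f (t *: v + a) = g (t *: v' + a')) -> 'D_v f a = 'D_v' g a'.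
Proof.
move=> h; rewrite /derive (_ : (fun t : R => t^-1 *: ((f \o shift a) (t *: v) - f a)) =
  (fun t : R => t^-1 *: ((g \o shift a') (t *: v') - g a'))) //; apply/funext => t /=.
by rewrite h; congr (_ *: (_ - _)); have := h 0; rewrite !scale0r !add0r.
Qed.

Lemma derive_affine (V W : normedModType R) (f : V -> W) (a v : V) (w : W) :
  (forall t : R, f (t *: v + a) = f a + t *: w) -> 'D_v f a = w.
Proof.
move=> h; apply: cvg_lim => //; apply: cvg_near_cst; near=> t.
rewrite /= h addrAC subrr add0r scalerA mulVf ?scale1r //; near: t; exact: nbhs_dnbhs_neq.
Unshelve. all: by end_near.
Qed.

Section ruled.
Variables phi1 phi2 psi : S -> 'rV[R]_8.
Hypotheses (a1 : analytic_map phi1) (a2 : analytic_map phi2) (a3 : analytic_map psi).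

Definition ruling c (r q : R * R) : 'rV[R]_8 :=
  r.1 *: phi1 (param c q) + r.2 *: phi2 (param c q) + psi (param c q).

Lemma van_ruling c x r : local_coordinates c -> dom c x -> van (ruling c r) (coord c x).
Proof.
move=> hc hx; apply: vanD; first apply: vanD.
- by apply: vanZ; [exact: an_cst|exact: van_chart a1].
- by apply: vanZ; [exact: an_cst|exact: van_chart a2].
- exact: van_chart a3.
Qed.

Lemma vd_ruling c x r u : local_coordinates c -> dom c x ->
  vd u (ruling c r) (coord c x) = r.1 *: vd u (phi1 \o param c) (coord c x)
    + r.2 *: vd u (phi2 \o param c) (coord c x) + vd u (psi \o param c) (coord c x).
Proof.
move=> hc hx; have h1 := van_chart hc hx a1; have h2 := van_chart hc hx a2.
have h3 := van_chart hc hx a3.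
have k1 : van (fun q => r.1 *: (phi1 \o param c) q) (coord c x) by apply: vanZ => //; exact: an_cst.
have k2 : van (fun q => r.2 *: (phi2 \o param c) q) (coord c x) by apply: vanZ => //; exact: an_cst.
rewrite -(vdZl _ _ h1) -(vdZl _ _ h2) -vdD // -vdD //; exact: vanD.
Qed.

Lemma dsE c x F : local_coordinates c -> dom c x -> analytic_map F ->
  ds c F x = vdx (F \o param c) (coord c x) /\ dt c F x = vdy (F \o param c) (coord c x).
Proof. by move=> hc hx hF; split; rewrite /ds /dt derive_van //; exact: van_chart. Qed.

Lemma ds_iota c x r : local_coordinates c -> dom c x ->
  ds c (fun y => iota_M phi1 phi2 psi (r, y)) x = vdx (ruling c r) (coord c x) /\
  dt c (fun y => iota_M phi1 phi2 psi (r, y)) x = vdy (ruling c r) (coord c x).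
Proof. by move=> hc hx; split; exact: (derive_van _ (van_ruling r hc hx)). Qed.

Lemma jacobianE c x r : local_coordinates c -> dom c x ->
  jacobian (iota_M phi1 phi2 psi) c (r, x) =
  frame (phi1 x) (phi2 x) (vdx (ruling c r) (coord c x)) (vdy (ruling c r) (coord c x)).
Proof.
move=> hc hx; have hv := van_ruling r hc hx; rewrite /jacobian /=.
have z0 (t : R) (q : R * R) : t *: ((0, 0) : R * R) + q = q.
  by rewrite (_ : (0, 0) = 0) // scaler0 add0r.
congr frame.
- transitivity (phi1 (param c (coord c x))); last by rewrite param_coord.
  apply: derive_affine => t; rewrite /iota_M; move: (coord c x) => q.
  have -> : (t *: ((1, 0), (0, 0)) + (r, q)).1.1 = t + r.1 by rewrite /= /GRing.scale /= mulr1.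
  have -> : (t *: ((1, 0), (0, 0)) + (r, q)).1.2 = r.2 by rewrite /= /GRing.scale /= mulr0 add0r.
  have -> : (t *: ((1, 0), (0, 0)) + (r, q)).2 = q.
    exact: z0.
  by rewrite /= scalerDl addrC !addrA; vec.
- transitivity (phi2 (param c (coord c x))); last by rewrite param_coord.
  apply: derive_affine => t; rewrite /iota_M; move: (coord c x) => q.
  have -> : (t *: ((0, 1), (0, 0)) + (r, q)).1.1 = r.1 by rewrite /= /GRing.scale /= mulr0 add0r.
  have -> : (t *: ((0, 1), (0, 0)) + (r, q)).1.2 = t + r.2 by rewrite /= /GRing.scale /= mulr1.
  have -> : (t *: ((0, 1), (0, 0)) + (r, q)).2 = q.
    exact: z0.
  by rewrite /= scalerDl; vec.
- transitivity ('D_((1, 0) : R * R) (ruling c r) (coord c x)); last exact: derive_van.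
  apply: derive_shape => t; rewrite /iota_M /ruling.
  have -> : (t *: ((0, 0), (1, 0)) + (r, coord c x)).1 = r by exact: z0.
  by [].
- transitivity ('D_((0, 1) : R * R) (ruling c r) (coord c x)); last exact: derive_van.
  apply: derive_shape => t; rewrite /iota_M /ruling.
  have -> : (t *: ((0, 0), (0, 1)) + (r, coord c x)).1 = r by exact: z0.
  by [].
Qed.

Lemma jacobian_sub c d x r : local_coordinates c -> local_coordinates d ->
  transition_analytic d c -> dom c x -> dom d x ->
  (jacobian (iota_M phi1 phi2 psi) d (r, x) <= jacobian (iota_M phi1 phi2 psi) c (r, x))%MS.
Proof.
move=> hc hd ht cx dx; rewrite !jacobianE //.
have [f1 f2 f3 f4] := sub_frame (phi1 x) (phi2 x) (vdx (ruling c r) (coord c x)) (vdy (ruling c r) (coord c x)).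
have hv : van ((fun y => r.1 *: phi1 y + r.2 *: phi2 y + psi y) \o param c) (coord c x) by exact: van_ruling.
apply: frame_sub => //.
  have E : vdx (ruling d r) (coord d x) = _ := vd_change (1, 0) ht cx dx hv.
  by rewrite E; apply: addmx_sub; exact: scalemx_sub.
have E : vdy (ruling d r) (coord d x) = _ := vd_change (0, 1) ht cx dx hv.
by rewrite E; apply: addmx_sub; exact: scalemx_sub.
Qed.

(** [immersion_at] provides one chart of the atlas; the chain rule, as an inclusion of row spaces,
    carries full rank to all local coordinates. *)
Lemma immersion_jacobian c x r : local_coordinates c -> dom c x ->
  immersion_at (iota_M phi1 phi2 psi) (r, x) -> row_free (jacobian (iota_M phi1 phi2 psi) c (r, x)).
Proof.
move=> hc hx [d [hd dx rf]]; have [_ ht] := hc d hd.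
have /mxrankS := jacobian_sub r hc (atlas_local hd) ht hx dx.
by rewrite /row_free (eqP rf) => h; rewrite eqn_leq rank_leq_row.
Qed.

End ruled.

(** The set of points near which f vanishes is open by definition. It is closed because a series of
    radius r at a limit point x is already zero if f vanishes near some point within r / 4 of x. *)
Lemma analytic_identity (f : S -> R) (x1 : S) : connected [set: S] ->
  (forall c, atlas c -> analytic_in c f) -> (\forall y \near x1, f y = 0) -> forall x, f x = 0.
Proof.
move=> hconn hf h1.
pose U := [set x : S | \forall y \near x, f y = 0].
have oU : open U by exact: (@open_interior S [set y | f y = 0]).
have cU : closed U.
  move=> x hx.
  have [c hc dx] := atlas_cover x.
  have /anP [r [M [r0 hA]]] := hf c hc x dx.
  have r4 : 0 < r / 4 by rewrite divr_gt0.
  have nb : \forall y \near x, dom c y /\ `|(coord c y).1 - (coord c x).1| <= r / 4 /\ `|(coord c y).2 - (coord c x).2| <= r / 4.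
    apply: filterI; first exact: near_dom.
    apply: (@near_coord c x (fun q => `|q.1 - (coord c x).1| <= r / 4 /\ `|q.2 - (coord c x).2| <= r / 4)) => //.
    apply/near_box; exists (r / 4) => // h k hh hk /=.
    by rewrite ![_ + _ - _]addrAC !subrr !add0r.
  have [y [yU [dy [y1 y2]]]] := hx _ nb.
  have hz := @near_param c y (fun y => f y = 0) dy yU.
  have := @an_identity R (f \o param c) (coord c x) r M r0 hA
    ((coord c y).1 - (coord c x).1, (coord c y).2 - (coord c x).2) y1 y2.
  rewrite /= !subrKC -surjective_pairing => /(_ hz) hzero.
  rewrite /U /=.
  have : \forall q \near coord c x, f (param c q) = 0.
    by apply/near_box; exists (r / 4) => // h k hh hk; exact: hzero.
  move=> /(near_coord dx) h2.
  near=> w; rewrite -(@param_coord c w); last by near: w; exact: near_dom.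
  by near: w; exact: h2.
have UT : U = setT.
  apply: hconn; first by exists x1.
    by exists U => //; rewrite setTI.
  by exists U => //; rewrite setTI.
move=> x; have : U x by rewrite UT.
by rewrite /U /= => /nbhs_singleton.
Unshelve. all: by end_near.
Qed.

End charts.

(** * Constancy of the tangent planes *)

Section complex_plane.
Variable R : realType.
Variables e1 e2 p : 'rV[R]_8.
Hypotheses (e11 : euclid e1 e1 = 1) (e22 : euclid e2 e2 = 1) (e12 : euclid e1 e2 = 0).
Hypotheses (p1 : euclid p e1 = 0) (p2 : euclid p e2 = 0).
Implicit Types (u v w n : 'rV[R]_8) (a b c : R).

Local Notation J := (tcross e1 e2).
Local Notation rho := (euclid p p).
Local Notation k := (Num.sqrt rho)^-1.

(** Normal vectors of W, the span of e1, e2, p and J p. Membership in W is tested by pairing with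
    them, which turns differentiation modulo W into scalar equations. *)
Definition perp n := [/\ euclid n e1 = 0, euclid n e2 = 0, euclid n p = 0 & euclid n (J p) = 0].

Lemma prj_id : prj e1 e2 p = p.
Proof. by rewrite /prj p1 p2 !scale0r !subr0. Qed.

Lemma perp_J n : perp n -> perp (J n).
Proof.
move=> [n1 n2 n3 n4]; split.
- exact: euclid_Je1.
- exact: euclid_Je2.
- by rewrite euclid_J n4 oppr0.
- by rewrite euclid_J JJ // prj_id euclidNr n3 !oppr0.
Qed.

Lemma euclid_perp n v a b c d : perp n -> v = a *: p + b *: J p + c *: e1 + d *: e2 -> euclid n v = 0.
Proof.
move=> [n1 n2 n3 n4] ->.
by rewrite !euclidDr !euclidZr n1 n2 n3 n4 !mulr0 !addr0.
Qed.

(** W is closed under the triple cross product. The case v = e1 gives J p; v = J p gives a double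
    cross product, which [tcross_tcross] expands in e1, e2 and p. *)
Lemma perp_tcross1 n v a b c d : perp n -> v = a *: p + b *: J p + c *: e1 + d *: e2 ->
  euclid n (tcross v e2 p) = 0.
Proof.
move=> pn ->.
have -> : a *: p + b *: J p + c *: e1 + d *: e2 = a *: p + (b *: J p + (c *: e1 + (d *: e2 + 0))).
  by rewrite addr0 !addrA.
rewrite !tcross_linear1 tcross_x13 tcross_x12.
have -> : tcross 0 e2 p = 0 by have := tcross_linear1 e2 p (-1) 0 0; rewrite scaler0 addr0 scaleN1r addNr.
have -> : tcross (J p) e2 p = tcross e2 p (tcross e2 p e1) by rewrite (tcross_cycle e1 e2 p) (tcross_cycle (J p) e2 p).
rewrite tcross_tcross; case: pn => n1 n2 n3 n4.
by rewrite !(euclidDr, euclidZr) n1 n2 n3 n4 euclid0r; ring.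
Qed.

Lemma perp_tcross2 n v a b c d : perp n -> v = a *: p + b *: J p + c *: e1 + d *: e2 ->
  euclid n (tcross e1 v p) = 0.
Proof.
move=> pn ->.
have -> : a *: p + b *: J p + c *: e1 + d *: e2 = a *: p + (b *: J p + (c *: e1 + (d *: e2 + 0))).
  by rewrite addr0 !addrA.
rewrite !tcross_linear2 tcross_x23 tcross_x12.
have -> : tcross e1 0 p = 0 by have := tcross_linear2 e1 p (-1) 0 0; rewrite scaler0 addr0 scaleN1r addNr.
have -> : tcross e1 (J p) p = tcross p e1 (tcross p e1 e2).
  by rewrite -(tcross_cycle p e1 e2) -(tcross_cycle p e1 (J p)).
rewrite tcross_tcross; case: pn => n1 n2 n3 n4.
by rewrite !(euclidDr, euclidZr) n1 n2 n3 n4 euclid0r; ring.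
Qed.

(** The difference n of the two sides is normal to W. It is orthogonal to the right side for that
    reason and to v by assumption, hence to itself. *)
Lemma perp_span v : p != 0 -> (forall n, perp n -> euclid n v = 0) ->
  v = (rho^-1 * euclid v p) *: p + (rho^-1 * euclid v (J p)) *: J p + euclid v e1 *: e1 + euclid v e2 *: e2.
Proof.
move=> p0 h; set w := RHS; pose n := v - w.
have r0 : rho != 0 by rewrite gt_eqF // euclid_gt0.
have e21 : euclid e2 e1 = 0 by rewrite euclidC.
have Jp1 : euclid (J p) e1 = 0 by exact: euclid_Je1.
have Jp2 : euclid (J p) e2 = 0 by exact: euclid_Je2.
have pJ : euclid p (J p) = 0 by exact: euclid_pJp.
have Jpp : euclid (J p) p = 0 by rewrite euclidC.
have JJp : euclid (J p) (J p) = rho by rewrite euclid_JJ // prj_id.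
have p1' : euclid e1 p = 0 by rewrite euclidC.
have p2' : euclid e2 p = 0 by rewrite euclidC.
have Jp1' : euclid e1 (J p) = 0 by rewrite euclidC.
have Jp2' : euclid e2 (J p) = 0 by rewrite euclidC.
have pn : perp n.
  split; rewrite /n /w !(euclidDl, euclidNl, euclidZl).
  - by rewrite p1 Jp1 e11 e21; ring.
  - by rewrite p2 Jp2 e22 e12; ring.
  - by rewrite Jpp p1' p2'; field.
  - by rewrite pJ JJp Jp1' Jp2'; field.
apply/eqP; rewrite -subr_eq0 -/n; apply/eqP; apply: euclid_eq0.
rewrite {2}/n euclidDr euclidNr (h n pn) (euclid_perp pn (erefl w)); ring.
Qed.

Lemma perp_submx v : p != 0 -> (forall n, perp n -> euclid n v = 0) ->
  (v <= frame e1 e2 (k *: p) (k *: J p))%MS.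
Proof.
move=> p0 h; rewrite (perp_span p0 h).
have k0 : k != 0 by rewrite invr_eq0 gt_eqF // sqrtr_gt0 euclid_gt0.
have [s1 s2 s3 s4] := sub_frame e1 e2 (k *: p) (k *: J p).
have s5 : (p <= frame e1 e2 (k *: p) (k *: J p))%MS.
  by rewrite -[X in (X <= _)%MS](@scalerK _ _ k) ?unitfE //; exact: scalemx_sub.
have s6 : (J p <= frame e1 e2 (k *: p) (k *: J p))%MS.
  by rewrite -[X in (X <= _)%MS](@scalerK _ _ k) ?unitfE //; exact: scalemx_sub.
by rewrite !addmx_sub // scalemx_sub.
Qed.

Lemma complex_frame_free : p != 0 ->
  row_free (frame e1 e2 (k *: p) (k *: J p)).
Proof.
move=> p0; have r0 : 0 < rho by rewrite euclid_gt0.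
have k1 : k * (k * rho) = 1.
  rewrite mulrA -invfM -expr2 sqr_sqrtr ?euclid_ge0 // mulVf // gt_eqF //.
apply: row_free_orthonormal; apply: frame_orthonormal => //; rewrite ?euclidZl ?euclidZr //.
- by rewrite euclid_JJ // prj_id.
- by rewrite euclidC p1 mulr0.
- by rewrite euclidC euclid_Je1 mulr0.
- by rewrite euclidC p2 mulr0.
- by rewrite euclidC euclid_Je2 mulr0.
- by rewrite euclid_pJp !mulr0.
Qed.

Lemma inC_span v : p != 0 -> inC e1 e2 p (prj e1 e2 v) ->
  v = (rho^-1 * euclid v p) *: p + (rho^-1 * euclid v (J p)) *: J p + euclid v e1 *: e1 + euclid v e2 *: e2.
Proof.
move=> p0 [a [b E]]; apply: perp_span => // n pn.
by apply: (@euclid_perp n v a b (euclid v e1) (euclid v e2) pn); rewrite -E -prK.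
Qed.

End complex_plane.

Section local_planarity.
Variable R : realType.
Implicit Types (F G H P : R * R -> 'rV[R]_8) (f g : R * R -> R) (q : R * R).

(** Analytic coefficients are bounded near q, so [gronwall] applies with the sum of all their bounds
    as constant. *)
Lemma linear_system n (y : 'I_n -> R * R -> R) (c d : 'I_n -> 'I_n -> R * R -> R) q :
  (forall i, an (y i) q) -> (forall i j, an (c i j) q) -> (forall i j, an (d i j) q) ->
  (forall i, y i q = 0) ->
  (\forall z \near q, forall i, pdx (y i) z = \sum_(j < n) c i j z * y j z /\
     pdy (y i) z = \sum_(j < n) d i j z * y j z) ->
  \forall z \near q, forall i, y i z = 0.
Proof.
move=> hy hc hd y0 hz.
pose K i j := `|c i j q| + 1 + (`|d i j q| + 1).
have K0 i j : 0 <= K i j by rewrite !addr_ge0.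
pose C := \sum_i \sum_j K i j.
have KC i j : K i j <= C.
  rewrite /C (bigD1 i) //= (bigD1 j) //= -addrA lerDl addr_ge0 ?sumr_ge0 // => k _.
  exact: sumr_ge0.
apply: (@gronwall R n y q C) => //.
  by apply: sumr_ge0 => i _; apply: sumr_ge0.
have hb (f : 'I_n -> 'I_n -> R * R -> R) : (forall i j, an (f i j) q) ->
    \forall z \near q, forall i j, `|f i j z| <= `|f i j q| + 1.
  move=> hf.
  have hi i : \forall z \near q, forall j, `|f i j z| <= `|f i j q| + 1.
    have hij j : \forall z \near q, `|f i j z| <= `|f i j q| + 1 by exact: an_bounded.
    exact: (@filter_forall _ _ _ _ _ hij).
  exact: (@filter_forall _ _ _ _ _ hi).
have bnd (f : 'I_n -> R) (g : 'I_n -> R) : (forall j, `|f j| <= C) ->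
    `|\sum_(j < n) f j * g j| <= C * \sum_(j < n) `|g j|.
  move=> hf; apply: le_trans (ler_norm_sum _ _ _) _; rewrite mulr_sumr.
  by apply: ler_sum => j _; rewrite normrM ler_wpM2r.
move: (hb c hc) (hb d hd) => {}hc {}hd.
apply: filterS3 hz hc hd => z hz hc hd i; have [-> ->] := hz i.
split; apply: bnd => j; apply: le_trans (KC i j).
  by apply: le_trans (hc i j) _; rewrite /K lerDl addr_ge0.
by apply: le_trans (hd i j) _; rewrite /K lerDr addr_ge0.
Qed.

Lemma vd_cst u (v : 'rV[R]_8) q : vd u (fun=> v) q = 0.
Proof. by apply/rowP => i; rewrite vdE mxE; exact: derive_cst. Qed.

Lemma euclid_comb4 (n x y z t : 'rV[R]_8) a b c d :
  euclid n (a *: x + b *: y + c *: z + d *: t) =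
  a * euclid n x + b * euclid n y + c * euclid n z + d * euclid n t.
Proof. by rewrite !euclidDr !euclidZr. Qed.

Definition inW F1 F2 P q v := exists a b c d,
  v = a *: P q + b *: tcross (F1 q) (F2 q) (P q) + c *: F1 q + d *: F2 q.

(* Modulo [W], the span of [P], [J P], [F1], [F2], a section of [W] is
   differentiated by differentiating [P] alone. *)
Lemma derive_section F1 F2 P q u n a b c d H :
  van F1 q -> van F2 q -> van P q -> an a q -> an b q -> an c q -> an d q ->
  inW F1 F2 P q (vd u F1 q) -> inW F1 F2 P q (vd u F2 q) ->
  (\forall z \near q, H z = a z *: P z + b z *: tcross (F1 z) (F2 z) (P z) + c z *: F1 z + d z *: F2 z) ->
  perp (F1 q) (F2 q) (P q) n ->
  euclid n (vd u H q) = a q * euclid n (vd u P q) - b q * euclid (tcross (F1 q) (F2 q) n) (vd u P q).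
Proof.
move=> h1 h2 hP ha hb hc hd w1 w2 hH pn.
have hJ := van_tcross h1 h2 hP.
have k1 := vanZ ha hP; have k2 := vanZ hb hJ; have k3 := vanZ hc h1; have k4 := vanZ hd h2.
have k12 := vanD k1 k2; have k123 := vanD k12 k3.
rewrite (vd_ext u hH) (vdD u k123 k4) (vdD u k12 k3) (vdD u k1 k2) !vdZ // vd_tcross //.
have [n1 n2 n3 n4] := pn.
have [? [? [? [? E1]]]] := w1; have [? [? [? [? E2]]]] := w2.
have x1 := euclid_perp pn E1; have x2 := euclid_perp pn E2.
have x3 := perp_tcross1 pn E1; have x4 := perp_tcross2 pn E2.
rewrite !(euclidDr, euclidZr) n1 n2 n3 n4 x1 x2 x3 x4.
rewrite euclid_J.
by move: (euclid n (vd u P q)) (euclid n (tcross _ _ _)) => X Y; ring.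
Qed.

Section flat_frame.
Variables (F1 F2 G : R * R -> 'rV[R]_8) (al be : R * R -> R) (q1 : R * R).
Local Notation J z := (tcross (F1 z) (F2 z)).
Local Notation pr z := (prj (F1 z) (F2 z)).

Definition mainpart z := pr z (vdx G z).
Local Notation P := mainpart.

(** The operator F_y - (al + be J) F_x modulo F1 and F2. It vanishes exactly when F satisfies the
    equation that defines [al] and [be] through G. *)
Definition defect F z := pr z (vdy F z) - al z *: pr z (vdx F z) - be z *: J z (pr z (vdx F z)).

Definition tangent_in F z := inC (F1 z) (F2 z) (P z) (pr z (vdx F z)) /\
  inC (F1 z) (F2 z) (P z) (pr z (vdy F z)).

Definition orthonormal z := [/\ euclid (F1 z) (F1 z) = 1, euclid (F2 z) (F2 z) = 1 & euclid (F1 z) (F2 z) = 0].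

Lemma van_prj F H K z : van F z -> van H z -> van K z -> van (fun z => prj (F z) (H z) (K z)) z.
Proof.
move=> hF hH hK; apply: vanB; first apply: vanB => //.
  by apply: vanZ => //; exact: an_euclid.
by apply: vanZ => //; exact: an_euclid.
Qed.

Lemma van_mainpart z : van F1 z -> van F2 z -> van G z -> van P z.
Proof. by move=> h1 h2 hG; apply: van_prj => //; exact: van_vd. Qed.

Lemma tangent_inW u F z : orthonormal z -> P z <> 0 -> inC (F1 z) (F2 z) (P z) (pr z (vd u F z)) ->
  inW F1 F2 P z (vd u F z).
Proof.
move=> [u1 u2 u12] /eqP p0 h.
have p1 : euclid (P z) (F1 z) = 0 by exact: euclid_pre1.
have p2 : euclid (P z) (F2 z) = 0 by exact: euclid_pre2.
by do 4 eexists; exact: (inC_span u1 u2 u12 p1 p2 p0 h).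
Qed.

Lemma section_coef u F z : van F1 z -> van F2 z -> van G z -> van F z -> P z <> 0 ->
  (\forall w \near z, [/\ orthonormal w, P w <> 0 & inC (F1 w) (F2 w) (P w) (pr w (vd u F w))]) ->
  exists a b c d, [/\ an a z, an b z, an c z, an d z & \forall w \near z,
    vd u F w = a w *: P w + b w *: J w (P w) + c w *: F1 w + d w *: F2 w].
Proof.
move=> h1 h2 hG hF p0 hn.
have hP := van_mainpart h1 h2 hG.
have hJ := van_tcross h1 h2 hP.
have r0 : euclid (P z) (P z) != 0 by rewrite gt_eqF // euclid_gt0 //; exact/eqP.
have hr : an (fun w => (euclid (P w) (P w))^-1) z by apply: an_inv => //; exact: an_euclid.
have hv := van_vd u hF.
exists (fun w => (euclid (P w) (P w))^-1 * euclid (vd u F w) (P w)),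
  (fun w => (euclid (P w) (P w))^-1 * euclid (vd u F w) (J w (P w))),
  (fun w => euclid (vd u F w) (F1 w)), (fun w => euclid (vd u F w) (F2 w)).
split; [apply: an_mul => //; exact: an_euclid|apply: an_mul => //; exact: an_euclid|exact: an_euclid|exact: an_euclid|].
apply: filterS hn => w [[u1 u2 u12] /eqP pw t].
have p1 : euclid (P w) (F1 w) = 0 by exact: euclid_pre1.
have p2 : euclid (P w) (F2 w) = 0 by exact: euclid_pre2.
exact: (inC_span u1 u2 u12 p1 p2 pw t).
Qed.

(** A complex system in real form: with alpha = a + i b, eta = h + i h', lambda = A + i B, xi = x +
    i x' and upsilon = y + i y', it reads alpha upsilon = eta xi and upsilon = lambda xi. Hence (eta
    - lambda alpha) xi = 0, where the factor is nonzero. *)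
Lemma complex_elim (h a h' b x y x' y' A B : R) :
  (h - A * a + B * b != 0) || (h' - A * b - B * a != 0) ->
  a * y - b * y' = h * x - h' * x' -> a * y' + b * y = h * x' + h' * x ->
  y = A * x - B * x' -> y' = A * x' + B * x -> x = 0 /\ y = 0.
Proof.
move=> hm E1 E2 Ey Ey'; rewrite Ey; move: E1 E2; rewrite {}Ey {}Ey' => E1 E2.
move: hm; set m := h - _ + _; set m' := h' - _ - _ => hm.
have m0 : m ^+ 2 + m' ^+ 2 != 0.
  by rewrite paddr_eq0 ?sqr_ge0 // !sqrf_eq0 negb_and.
have M1 : m * x - m' * x' = 0.
  transitivity ((h * x - h' * x') - (a * (A * x - B * x') - b * (A * x' + B * x))); last by rewrite E1 subrr.
  by rewrite /m /m'; ring.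
have M2 : m * x' + m' * x = 0.
  transitivity ((h * x' + h' * x) - (a * (A * x' + B * x) + b * (A * x - B * x'))); last by rewrite E2 subrr.
  by rewrite /m /m'; ring.
have x0 : x = 0.
  apply: (mulfI m0); rewrite mulr0.
  transitivity (m * (m * x - m' * x') + m' * (m * x' + m' * x)); first by ring.
  by rewrite M1 M2 !mulr0 addr0.
have x'0 : x' = 0.
  apply: (mulfI m0); rewrite mulr0.
  transitivity (m * (m * x' + m' * x) - m' * (m * x - m' * x')); first by ring.
  by rewrite M1 M2 !mulr0 subr0.
by rewrite x0 x'0 !mulr0 subr0.
Qed.

(* With [p = P z], write [X = <n, p_x>], [X' = <J n, p_x>] and [Y], [Y'] likewise
   with [p_y]. The equality of the mixed derivatives of [G] and of [F], tested
   against [n] and [J n], is a linear system whose determinant is the squared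
   norm of the defect of [F] in the basis [p, J p]. *)
Lemma mainpart_flat F z n : van F1 z -> van F2 z -> van G z -> van F z -> an al z -> an be z ->
  P z <> 0 -> defect F z <> 0 ->
  (\forall w \near z, [/\ orthonormal w, P w <> 0, tangent_in F1 w, tangent_in F2 w & tangent_in F w]) ->
  (\forall w \near z, pr w (vdy G w) = al w *: P w + be w *: J w (P w)) ->
  perp (F1 z) (F2 z) (P z) n ->
  euclid n (vdx P z) = 0 /\ euclid n (vdy P z) = 0.
Proof.
move=> h1 h2 hG hF hal hbe p0 d0 hn hGy pn.
have [oz _ t1 t2 tF] := nbhs_singleton hn; have [u1 u2 u12] := oz.
have hP := van_mainpart h1 h2 hG.
have p1 : euclid (P z) (F1 z) = 0 by exact: euclid_pre1.
have p2 : euclid (P z) (F2 z) = 0 by exact: euclid_pre2.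
have w1 := tangent_inW oz p0 t1.1; have w2 := tangent_inW oz p0 t1.2.
have w3 := tangent_inW oz p0 t2.1; have w4 := tangent_inW oz p0 t2.2.
have ac K u : van K z -> an (fun w => euclid (vd u G w) (K w)) z.
  by move=> hK; apply: an_euclid => //; exact: van_vd.
have hx : \forall w \near z, [/\ orthonormal w, P w <> 0 & inC (F1 w) (F2 w) (P w) (pr w (vd (1, 0) F w))].
  by apply: filterS hn => w [k1 k2 _ _ [k3 k4]]; split; [exact: k1|exact: k2|exact: k3].
have hy : \forall w \near z, [/\ orthonormal w, P w <> 0 & inC (F1 w) (F2 w) (P w) (pr w (vd (0, 1) F w))].
  by apply: filterS hn => w [k1 k2 _ _ [k3 k4]]; split; [exact: k1|exact: k2|exact: k4].
have [a [b [c [d [ha hb hc hd eFx]]]]] := section_coef h1 h2 hG hF p0 hx.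
have [a' [b' [c' [d' [ha' hb' hc' hd' eFy]]]]] := section_coef h1 h2 hG hF p0 hy.
have eGx : \forall w \near z, vdx G w = 1 *: P w + 0 *: J w (P w)
    + euclid (vdx G w) (F1 w) *: F1 w + euclid (vdx G w) (F2 w) *: F2 w.
  apply: filterE => w; rewrite scale1r scale0r addr0; exact: prK.
have eGy : \forall w \near z, vdy G w = al w *: P w + be w *: J w (P w)
    + euclid (vdy G w) (F1 w) *: F1 w + euclid (vdy G w) (F2 w) *: F2 w.
  apply: filterS hGy => w <-; exact: prK.
pose X m := euclid m (vdx P z); pose Y m := euclid m (vdy P z).
have relF m : perp (F1 z) (F2 z) (P z) m ->
    a z * Y m - b z * Y (J z m) = a' z * X m - b' z * X (J z m).
  move=> pm.
  have D1 : euclid m (vdy (vdx F) z) = _ := derive_section h1 h2 hP ha hb hc hd w2 w4 eFx pm.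
  have D2 : euclid m (vdx (vdy F) z) = _ := derive_section h1 h2 hP ha' hb' hc' hd' w1 w3 eFy pm.
  by rewrite /X /Y -[LHS]D1 -[RHS]D2 (vd_swap hF).
have relG m : perp (F1 z) (F2 z) (P z) m ->
    1 * Y m - 0 * Y (J z m) = al z * X m - be z * X (J z m).
  move=> pm.
  have D1 : euclid m (vdy (vdx G) z) = _ := derive_section h1 h2 hP (an_cst 1 z) (an_cst 0 z) (ac F1 (1, 0) h1) (ac F2 (1, 0) h2) w2 w4 eGx pm.
  have D2 : euclid m (vdx (vdy G) z) = _ := derive_section h1 h2 hP hal hbe (ac F1 (0, 1) h1) (ac F2 (0, 1) h2) w1 w3 eGy pm.
  by rewrite /X /Y -[LHS]D1 -[RHS]D2 (vd_swap hG).
have pJ := perp_J u1 u2 u12 p1 p2 pn.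
have JJn : J z (J z n) = - n.
  by rewrite JJ //; case: (pn) => n1 n2 _ _; rewrite /prj n1 n2 !scale0r !subr0.
have XN : X (- n) = - X n by exact: euclidNl.
have YN : Y (- n) = - Y n by exact: euclidNl.
change (X n = 0 /\ Y n = 0); move: relF relG XN YN.
move: X Y => X Y relF relG XN YN.
move: (relF n pn) (relF _ pJ) (relG n pn) (relG _ pJ); rewrite JJn XN YN !mulrN !opprK !mul1r !mul0r !subr0 addr0.
move=> E1 E2 E3 E4; apply: (complex_elim _ E1 E2 E3 E4).
rewrite -negb_and; apply/negP => /andP[/eqP m0 /eqP m'0]; apply: d0.
have prP : pr z (P z) = P z by exact: pr_pr.
have Ex : vdx F z = _ := nbhs_singleton eFx; have Ey : vdy F z = _ := nbhs_singleton eFy.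
rewrite /defect Ex Ey.
rewrite !prD !prZ pr_e1 // pr_e2 // !scaler0 !addr0 prP pr_J // JD !JZ JJ // prP.
transitivity ((a' z - al z * a z + be z * b z) *: P z + (b' z - al z * b z - be z * a z) *: J z (P z)); last by rewrite m0 m'0 !scale0r addr0.
move: (a z) (a' z) (b z) (b' z) (J z (P z)) (P z) (al z) (be z) => *; vec.
Qed.

(** For a fixed n, normal at q1, the pairings of n with P, J P, F1, F2 and G - G q1 all vanish at
    q1. By [mainpart_flat] the derivatives of these five fields stay in the moving plane, so the
    pairings satisfy a closed linear system and remain zero. *)
Lemma frame_flat F n : van F1 q1 -> van F2 q1 -> van G q1 -> van F q1 -> an al q1 -> an be q1 ->
  P q1 <> 0 -> defect F q1 <> 0 ->
  (\forall w \near q1, [/\ orthonormal w, P w <> 0, tangent_in F1 w, tangent_in F2 w & tangent_in F w]) ->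
  (\forall w \near q1, pr w (vdy G w) = al w *: P w + be w *: J w (P w)) ->
  perp (F1 q1) (F2 q1) (P q1) n ->
  \forall w \near q1, [/\ euclid n (F1 w) = 0, euclid n (F2 w) = 0 & euclid n (G w - G q1) = 0].
Proof.
move=> h1 h2 hG hF hal hbe p0 d0 hn hGy pn.
have hP := van_mainpart h1 h2 hG.
have hJ := van_tcross h1 h2 hP.
have r0 : euclid (P q1) (P q1) != 0 by rewrite gt_eqF // euclid_gt0 //; exact/eqP.
have hr : an (fun w => (euclid (P w) (P w))^-1) q1 by apply: an_inv => //; exact: an_euclid.
have hG' : van (fun w => G w - G q1) q1 by apply: vanB => //; exact: van_cst.
have nd : \forall w \near q1, defect F w <> 0.
  have ad : van (defect F) q1.
    have x1 := van_prj h1 h2 (van_vd (1, 0) hF); have x2 := van_prj h1 h2 (van_vd (0, 1) hF).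
    exact: (vanB (vanB x2 (vanZ hal x1)) (vanZ hbe (van_tcross h1 h2 x1))).
  exact: (van_neq0 ad d0).
pose E (i : 'I_5) : R * R -> 'rV[R]_8 := nth (fun=> 0) [:: P; (fun w => J w (P w)); F1; F2; (fun w => G w - G q1)] i.
(* Inverse squared lengths of the orthogonal basis P, J P, F1, F2 of the plane. The fifth field is
   not a basis vector and gets weight 0. *)
pose wt (i : 'I_5) : R * R -> R := nth (fun=> 0) [:: (fun w => (euclid (P w) (P w))^-1); (fun w => (euclid (P w) (P w))^-1); (fun=> 1); (fun=> 1); (fun=> 0)] i.
have vE i : van (E i) q1 by case: i => [[|[|[|[|[|i]]]]] hi].
have awt i : an (wt i) q1.
  by case: i => [[|[|[|[|[|i]]]]] hi] //; exact: an_cst.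
have key : \forall w \near q1, forall i, euclid n (vdx (E i) w) = \sum_(j < 5) (wt j w * euclid (vdx (E i) w) (E j w)) * euclid n (E j w) /\
     euclid n (vdy (E i) w) = \sum_(j < 5) (wt j w * euclid (vdy (E i) w) (E j w)) * euclid n (E j w).
  near=> w.
  have [oz pw t1 t2 tF] : [/\ orthonormal w, P w <> 0, tangent_in F1 w, tangent_in F2 w & tangent_in F w].
    by near: w.
  have [u1 u2 u12] := oz.
  have p1 : euclid (P w) (F1 w) = 0 by exact: euclid_pre1.
  have p2 : euclid (P w) (F2 w) = 0 by exact: euclid_pre2.
  have v1 : van F1 w by near: w; exact: van_near.
  have v2 : van F2 w by near: w; exact: van_near.
  have vG : van G w by near: w; exact: van_near.
  have vF : van F w by near: w; exact: van_near.
  have vP := van_mainpart v1 v2 vG.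
  have flat m : perp (F1 w) (F2 w) (P w) m -> euclid m (vdx P w) = 0 /\ euclid m (vdy P w) = 0.
    apply: (@mainpart_flat F w m v1 v2 vG vF).
    - by near: w; exact: an_near.
    - by near: w; exact: an_near.
    - exact: pw.
    - by near: w.
    - by near: w; exact: nbhs_interior.
    - by near: w; exact: nbhs_interior.
  have inw i m : perp (F1 w) (F2 w) (P w) m -> euclid m (vdx (E i) w) = 0 /\ euclid m (vdy (E i) w) = 0.
    move=> pm.
    have W u H : inC (F1 w) (F2 w) (P w) (pr w (vd u H w)) -> euclid m (vd u H w) = 0.
      by move=> t; have [? [? [? [? e]]]] := tangent_inW oz pw t; exact: euclid_perp pm e.
    have pJ := perp_J u1 u2 u12 p1 p2 pm.
    case: i => [[|[|[|[|[|i]]]]] hi] //; rewrite /E /=.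
    - exact: flat.
    - have [f1 f2] := flat _ pJ.
      have jj u : inC (F1 w) (F2 w) (P w) (pr w (vd u F1 w)) -> inC (F1 w) (F2 w) (P w) (pr w (vd u F2 w)) ->
          euclid (J w m) (vd u P w) = 0 -> euclid m (vd u (fun w => J w (P w)) w) = 0.
        move=> k1 k2 k3; rewrite vd_tcross // !euclidDr.
        have [? [? [? [? e1]]]] := tangent_inW oz pw k1.
        have [? [? [? [? e2]]]] := tangent_inW oz pw k2.
        rewrite (perp_tcross1 pm e1) (perp_tcross2 pm e2) !add0r.
        by move: k3; rewrite euclid_J => /eqP; rewrite oppr_eq0 => /eqP.
      by split; [exact: (jj _ t1.1 t2.1 f1)|exact: (jj _ t1.2 t2.2 f2)].
    - by split; apply: W; [exact: t1.1|exact: t1.2].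
    - by split; apply: W; [exact: t2.1|exact: t2.2].
    - have GE u : vd u (fun w => G w - G q1) w = vd u G w.
        transitivity (vd u G w + vd u (fun=> - G q1) w).
          by apply: vdD => //; exact: van_cst.
        by rewrite vd_cst addr0.
      rewrite /vdx /vdy !GE; split; apply: W.
        by exists 1, 0; rewrite scale1r scale0r addr0.
      exists (al w), (be w); near: w; exact: hGy.
  move=> i; have /eqP pw' := pw.
  have expand v : (forall m, perp (F1 w) (F2 w) (P w) m -> euclid m v = 0) ->
      euclid n v = \sum_(j < 5) (wt j w * euclid v (E j w)) * euclid n (E j w).
    move=> hm; rewrite {1}(perp_span u1 u2 u12 p1 p2 pw' hm).
    by rewrite euclid_comb4 !big_ord_recl big_ord0 /wt /E /= !mul1r !mul0r !addr0 !addrA.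
  by split; apply: expand => m /(inw i) [].
have := @linear_system 5 (fun i w => euclid n (E i w)) (fun i j w => wt j w * euclid (vdx (E i) w) (E j w))
  (fun i j w => wt j w * euclid (vdy (E i) w) (E j w)) q1.
have aE i : an (fun w => euclid n (E i w)) q1 by apply: an_euclid => //; exact: van_cst.
have ac u i j : an (fun w => wt j w * euclid (vd u (E i) w) (E j w)) q1.
  by apply: an_mul => //; apply: an_euclid => //; exact: van_vd.
move=> /(_ aE (ac (1, 0)) (ac (0, 1))) ls.
have {ls} : \forall w \near q1, forall i, euclid n (E i w) = 0.
  apply: ls.
    case: pn => n1 n2 n3 n4; case=> [[|[|[|[|[|i]]]]] hi] //.
    by rewrite /E /= subrr euclid0r.
  have vEn : \forall w \near q1, forall i, van (E i) w.
    have hi i : \forall w \near q1, van (E i) w by exact: van_near.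
    exact: (@filter_forall _ _ _ _ _ hi).
  apply: filterS2 key vEn => w hk hvw i; rewrite /pdx /pdy !d_euclid_cst //; exact: hk.
apply: filterS => w hz.
by split; [exact: (hz (Ordinal (isT : 2 < 5)%N))|exact: (hz (Ordinal (isT : 3 < 5)%N))|exact: (hz (Ordinal (isT : 4 < 5)%N))].
Unshelve. all: by end_near.
Qed.

End flat_frame.

End local_planarity.

Local Opaque tcross euclid vd.

(** * Cayley 2-ruled 4-folds *)

Section ruled_cayley.
Variables (R : realType) (S : analytic_surface R) (phi1 phi2 psi : S -> 'rV[R]_8).
Hypotheses (a1 : analytic_map phi1) (a2 : analytic_map phi2) (a3 : analytic_map psi).
Hypotheses (n1 : forall x, euclid (phi1 x) (phi1 x) = 1) (n2 : forall x, euclid (phi2 x) (phi2 x) = 1).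
Hypothesis n12 : forall x, euclid (phi1 x) (phi2 x) = 0.
Local Notation iota := (iota_M phi1 phi2 psi).
Local Notation ruling := (ruling phi1 phi2 psi).
Local Notation F1 c := (phi1 \o param c).
Local Notation F2 c := (phi2 \o param c).
Local Notation F3 c := (psi \o param c).
Implicit Types (c d : chart R S) (x y : S) (r : R * R).

Lemma orthonormal_param c z : orthonormal (F1 c) (F2 c) z.
Proof. by split; [exact: n1|exact: n2|exact: n12]. Qed.

(** At a point where the frame is degenerate, [dep] holds by itself; the relation is therefore
    available for every r, as [tangent_dichotomy] requires. *)
Lemma cayley_tangent c x r : cayley iota -> atlas c -> dom c x ->
  dep (phi1 x) (phi2 x) (prj (phi1 x) (phi2 x) (vdx (ruling c r) (coord c x)))
    (prj (phi1 x) (phi2 x) (vdy (ruling c r) (coord c x))).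
Proof.
move=> [ori [ho1 _] ho] hc hx; apply: cayley_dep => // E EE rf Ef.
have jE := jacobianE a1 a2 a3 r (atlas_local hc) hx.
have im : immersion_at iota (r, x) by exists c; split=> //; rewrite jE.
have tf : tangent_frame iota (r, x) E.
  by split; [exact: row_free_orthonormal|exists c; split=> //; rewrite jE].
have [oE|noE] := pselect (ori (r, x) E); first by left; exact: ho im tf EE oE.
(* Exchanging two vectors makes a negative frame positive and changes the sign of Phi. *)
right; pose A : 'M[R]_4 := tperm_mx 0 1.
have dA : \det A = -1 by rewrite /A det_perm odd_tperm.
have uA : A \in unitmx by rewrite unitmxE dA unitrN unitr1.
have oA : ori (r, x) (A *m E).
  by apply: (iffRL (ho1 _ _ A im tf uA)); rewrite dA ltr0N1.
have AA : A *m A^T = 1%:M.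
  by rewrite /A tr_perm_mx tpermV -perm_mxM tperm2 perm_mx1.
have AE : (A *m E :=: E)%MS by apply: eqmxMfull; rewrite row_full_unit.
have := ho (r, x) (A *m E) im; rewrite PhiM_mul dA mulN1r => h.
rewrite -[PhiM E]opprK h //.
- split; first by rewrite /row_free AE; case: tf.
  by exists c; split=> //; rewrite jE !AE.
- by rewrite trmx_mul mulmxA -(mulmxA A) EE mulmx1.
Qed.

Lemma immersion_exists x : singular_set_nowhere_dense iota -> exists r, immersion_at iota (r, x).
Proof.
move=> hs; apply: contrapT => hn; have := hs x; rewrite /nowhere_dense.
rewrite (_ : [set r | _] = setT); last by apply/seteqP; split=> r //= _ hr; apply: hn; exists r.
rewrite (_ : closure setT = setT); last by apply/seteqP; split=> // r _; exact: subset_closure.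
rewrite interiorT => /seteqP[/(_ (0, 0)) h _]; exact: h.
Qed.

Lemma dep_comb (e1 e2 A B C A' B' C' V V' : 'rV[R]_8) s t :
  V = A + s *: B + t *: C -> V' = A' + s *: B' + t *: C' ->
  dep e1 e2 (prj e1 e2 V) (prj e1 e2 V') ->
  dep e1 e2 (prj e1 e2 A + s *: prj e1 e2 B + t *: prj e1 e2 C)
    (prj e1 e2 A' + s *: prj e1 e2 B' + t *: prj e1 e2 C').
Proof. by move=> -> ->; rewrite !prD !prZ. Qed.

Lemma euclid_comb (n x y z : 'rV[R]_8) a b :
  euclid n (a *: x + b *: y + z) = a * euclid n x + b * euclid n y + euclid n z.
Proof. by rewrite !euclidDr !euclidZr. Qed.

Lemma defect_comb (e1 e2 Gx Gy X1 Y1 X2 Y2 X3 Y3 : 'rV[R]_8) s t a b :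
  Gx = s *: X1 + t *: X2 + X3 -> Gy = s *: Y1 + t *: Y2 + Y3 ->
  prj e1 e2 Gy = a *: prj e1 e2 Gx + b *: tcross e1 e2 (prj e1 e2 Gx) ->
  prj e1 e2 Y1 - a *: prj e1 e2 X1 - b *: tcross e1 e2 (prj e1 e2 X1) = 0 ->
  prj e1 e2 Y2 - a *: prj e1 e2 X2 - b *: tcross e1 e2 (prj e1 e2 X2) = 0 ->
  prj e1 e2 Y3 - a *: prj e1 e2 X3 - b *: tcross e1 e2 (prj e1 e2 X3) = 0.
Proof.
move=> -> ->; rewrite !prD !prZ.
move: (prj e1 e2 X1) (prj e1 e2 X2) (prj e1 e2 X3) (prj e1 e2 Y1) (prj e1 e2 Y2) (prj e1 e2 Y3) => x1 x2 x3 y1 y2 y3.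
rewrite !JD !JZ; move: (tcross _ _ x1) (tcross _ _ x2) (tcross _ _ x3) => j1 j2 j3 E E1 E2.
have -> : y3 - a *: x3 - b *: j3 = (s *: y1 + t *: y2 + y3) - (a *: (s *: x1 + t *: x2 + x3) + b *: (s *: j1 + t *: j2 + j3))
    - s *: (y1 - a *: x1 - b *: j1) - t *: (y2 - a *: x2 - b *: j2) by vec.
by rewrite E E1 E2 subrr !scaler0 !subr0.
Qed.

Section at_point.
Variables (c : chart R S) (r : R * R).
Hypothesis hc : atlas c.
Hypothesis hcay : cayley iota.

Local Notation G := (ruling c r).
Local Notation P := (mainpart (F1 c) (F2 c) G).
Local Notation J z := (tcross (F1 c z) (F2 c z)).
Local Notation pr z := (prj (F1 c z) (F2 c z)).

(** Real part of the complex slope of G_y over P modulo phi1 and phi2. P and J P have the same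
    length, so both parts have the same denominator. *)
Definition slope_re z := (euclid (P z) (P z))^-1 * euclid (vdy G z) (P z).
Definition slope_im z := (euclid (P z) (P z))^-1 * euclid (vdy G z) (J z (P z)).
Local Notation al := slope_re.
Local Notation be := slope_im.

Let vF1 x : dom c x -> van (F1 c) (coord c x).
Proof. by move=> hx; exact: (van_chart (atlas_local hc) hx a1). Qed.
Let vF2 x : dom c x -> van (F2 c) (coord c x).
Proof. by move=> hx; exact: (van_chart (atlas_local hc) hx a2). Qed.
Let vG x : dom c x -> van G (coord c x).
Proof. by move=> hx; exact: (van_ruling a1 a2 a3 r (atlas_local hc) hx). Qed.

Lemma slope_an x : dom c x -> P (coord c x) <> 0 -> an al (coord c x) /\ an be (coord c x).
Proof.
move=> hx p0; have v1 := vF1 hx; have v2 := vF2 hx; have vg := vG hx.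
have vP := van_mainpart v1 v2 vg.
have vJ := van_tcross v1 v2 vP.
have r0 : euclid (P (coord c x)) (P (coord c x)) != 0 by rewrite gt_eqF // euclid_gt0 //; exact/eqP.
have hr := an_inv r0 (an_euclid vP vP).
have vy := van_vd (0, 1) vg.
by split; [exact: (an_mul hr (an_euclid vy vP))|exact: (an_mul hr (an_euclid vy vJ))].
Qed.

Lemma slopeE x : dom c x -> P (coord c x) <> 0 ->
  pr (coord c x) (vdy G (coord c x)) = al (coord c x) *: P (coord c x) + be (coord c x) *: J (coord c x) (P (coord c x)).
Proof.
move=> hx p0; have h := cayley_tangent r hcay hc hx.
have E z : F1 c (coord c z) = phi1 (param c (coord c z)) by [].
have [u1 u2 u12] := orthonormal_param c (coord c x).
have h' : dep (F1 c (coord c x)) (F2 c (coord c x)) (P (coord c x)) (pr (coord c x) (vdy G (coord c x))).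
  by rewrite /mainpart /= param_coord.
move: h'; move: (coord c x) p0 u1 u2 u12 => z p0 u1 u2 u12 [//|h'].
have p1 : euclid (P z) (F1 c z) = 0 by exact: euclid_pre1.
have p2 : euclid (P z) (F2 c z) = 0 by exact: euclid_pre2.
have /eqP p0' := p0.
have e := inC_span u1 u2 u12 p1 p2 p0' h'.
have prP : pr z (P z) = P z by exact: pr_pr.
rewrite {1}e !prD !prZ pr_e1 // pr_e2 // !scaler0 !addr0 prP pr_J //.
Qed.

(** Passing from r to r + (s, t) changes the derivatives of the ruling by s and t times those of
    phi1 and phi2, so the Cayley condition along the whole fibre is the hypothesis of
    [dep_plane]. *)
Lemma tangent_dichotomy x : dom c x -> P (coord c x) <> 0 ->
  (defect (F1 c) (F2 c) al be (F1 c) (coord c x) = 0 /\ defect (F1 c) (F2 c) al be (F2 c) (coord c x) = 0) \/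
  (tangent_in (F1 c) (F2 c) G (F1 c) (coord c x) /\ tangent_in (F1 c) (F2 c) G (F2 c) (coord c x)).
Proof.
move=> hx p0; have [u1 u2 u12] := orthonormal_param c (coord c x).
have eP := slopeE hx p0.
have hd (s t : R) : dep (F1 c (coord c x)) (F2 c (coord c x))
   (P (coord c x) + s *: pr (coord c x) (vdx (F1 c) (coord c x)) + t *: pr (coord c x) (vdx (F2 c) (coord c x)))
   (pr (coord c x) (vdy G (coord c x)) + s *: pr (coord c x) (vdy (F1 c) (coord c x)) + t *: pr (coord c x) (vdy (F2 c) (coord c x))).
  have ct := cayley_tangent (r.1 + s, r.2 + t) hcay hc hx.
  have e1 : phi1 x = F1 c (coord c x) by rewrite /= param_coord.
  have e2 : phi2 x = F2 c (coord c x) by rewrite /= param_coord.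
  rewrite e1 e2 in ct.
  have L u : vd u (ruling c (r.1 + s, r.2 + t)) (coord c x) = vd u G (coord c x) + s *: vd u (F1 c) (coord c x) + t *: vd u (F2 c) (coord c x).
    rewrite !(vd_ruling a1 a2 a3 _ _ (atlas_local hc) hx) /=.
    by move: (vd u (F1 c) _) (vd u (F2 c) _) (vd u (F3 c) _) => A B C; vec.
  exact: (dep_comb (L (1, 0)) (L (0, 1)) ct).
have prP : pr (coord c x) (P (coord c x)) = P (coord c x) by exact: pr_pr.
have pp v : pr (coord c x) (pr (coord c x) v) = pr (coord c x) v by exact: pr_pr.
have := dep_plane u1 u2 u12 prP (pp _) (pp _) (pp _) (pp _) p0 eP hd.
by case=> [[d1 d2]|[k1 k2 k3 k4]]; [left; exact: (conj d1 d2)|right; exact: (conj (conj k1 k2) (conj k3 k4))].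
Qed.

Lemma mainpart_near x : dom c x -> P (coord c x) <> 0 ->
  \forall w \near coord c x, P w <> 0.
Proof.
move=> hx p0; have vP := van_mainpart (vF1 hx) (vF2 hx) (vG hx).
exact: (van_neq0 vP p0).
Qed.

Lemma van_defect F x : dom c x -> P (coord c x) <> 0 -> van F (coord c x) ->
  van (defect (F1 c) (F2 c) al be F) (coord c x).
Proof.
move=> hx p0 hF; have [hal hbe] := slope_an hx p0.
have x1 := van_prj (vF1 hx) (vF2 hx) (van_vd (1, 0) hF); have x2 := van_prj (vF1 hx) (vF2 hx) (van_vd (0, 1) hF).
exact: (vanB (vanB x2 (vanZ hal x1)) (vanZ hbe (van_tcross (vF1 hx) (vF2 hx) x1))).
Qed.

Lemma near_in_dom x (Q : R * R -> Prop) : dom c x -> (forall y, dom c y -> Q (coord c y)) ->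
  \forall w \near coord c x, Q w.
Proof.
by move=> hx h; apply: filterS (near_cod hx) => w [e dw]; rewrite -e; exact: h.
Qed.

(** A nonzero defect persists near x and forces the tangential alternative there. Each n normal to
    the tangent plane at x is then orthogonal to phi1, phi2 and the displacement of the ruling near
    x by [frame_flat], and everywhere by the identity theorem. *)
Lemma defect_planar F x : connected [set: S] -> dom c x -> P (coord c x) <> 0 ->
  F = F1 c \/ F = F2 c -> defect (F1 c) (F2 c) al be F (coord c x) <> 0 -> planar iota.
Proof.
move=> conn hx p0 hFF d0.
have v1 := vF1 hx; have v2 := vF2 hx; have vg := vG hx; have [hal hbe] := slope_an hx p0.
have vF : van F (coord c x) by case: hFF => ->.
have np := mainpart_near hx p0.
have nd : \forall w \near coord c x, defect (F1 c) (F2 c) al be F w <> 0 :=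
  van_neq0 (van_defect hx p0 vF) d0.
have nt : \forall w \near coord c x, P w <> 0 ->
  (defect (F1 c) (F2 c) al be (F1 c) w = 0 /\ defect (F1 c) (F2 c) al be (F2 c) w = 0) \/
  (tangent_in (F1 c) (F2 c) G (F1 c) w /\ tangent_in (F1 c) (F2 c) G (F2 c) w).
  by apply: (near_in_dom hx) => y hy py; exact: tangent_dichotomy.
have ns : \forall w \near coord c x, P w <> 0 -> pr w (vdy G w) = al w *: P w + be w *: J w (P w).
  by apply: (near_in_dom hx) => y hy py; exact: slopeE.
have hn : \forall w \near coord c x, [/\ orthonormal (F1 c) (F2 c) w, P w <> 0,
    tangent_in (F1 c) (F2 c) G (F1 c) w, tangent_in (F1 c) (F2 c) G (F2 c) w & tangent_in (F1 c) (F2 c) G F w].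
  apply: filterS3 np nd nt => w pw dw tw.
  case: (tw pw) => [[e1 e2]|[t1 t2]]; first by exfalso; apply: dw; case: hFF => ->; [exact: e1|exact: e2].
  split; [exact: orthonormal_param|exact: pw|exact: t1|exact: t2|].
  by case: hFF => ->; [exact: t1|exact: t2].
have hG : \forall w \near coord c x, pr w (vdy G w) = al w *: P w + be w *: J w (P w).
  by apply: filterS2 np ns => w pw; exact.
set e1 := F1 c (coord c x); set e2 := F2 c (coord c x); set p := P (coord c x).
pose a := iota (r, x).
have aeu n H : analytic_map H -> forall d, atlas d -> analytic_in d (fun y => euclid n (H y)).
  move=> hH d hd y hy; apply/anP.
  exact: (an_euclid (van_cst n _) (van_chart (atlas_local hd) hy hH)).
have aG n d : atlas d -> analytic_in d (fun y => euclid n (iota (r, y) - a)).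
  move=> hd y hy; apply/anP.
  have vr := van_ruling a1 a2 a3 r (atlas_local hd) hy.
  exact: (an_euclid (van_cst n _) (vanB vr (van_cst a _))).
have flat n : perp e1 e2 p n -> forall y, [/\ euclid n (phi1 y) = 0, euclid n (phi2 y) = 0 & euclid n (iota (r, y) - a) = 0].
  move=> pn; have ff := frame_flat v1 v2 vg vF hal hbe p0 d0 hn hG pn.
  have fS : \forall y \near x, [/\ euclid n (phi1 y) = 0, euclid n (phi2 y) = 0 & euclid n (iota (r, y) - a) = 0].
    apply: filterS2 (near_coord hx ff) (near_dom hx) => y [k1 k2 k3] hy.
    rewrite -(param_coord hy); split; [exact: k1|exact: k2|].
    move: k3; rewrite {2}/ruling (param_coord hx); exact.
  have g1 := analytic_identity conn (aeu n phi1 a1) (filterS (fun y (k : [/\ _, _ & _]) => let: And3 k1 _ _ := k in k1) fS).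
  have g2 := analytic_identity conn (aeu n phi2 a2) (filterS (fun y (k : [/\ _, _ & _]) => let: And3 _ k1 _ := k in k1) fS).
  have g3 := analytic_identity conn (aG n) (filterS (fun y (k : [/\ _, _ & _]) => let: And3 _ _ k1 := k in k1) fS).
  by move=> y; split; [exact: g1|exact: g2|exact: g3].
have [u1 u2 u12] := orthonormal_param c (coord c x).
have p1 : euclid p e1 = 0 by exact: euclid_pre1.
have p2 : euclid p e2 = 0 by exact: euclid_pre2.
have p0' : p != 0 by apply/eqP; exact: p0.
exists a, (frame e1 e2 ((Num.sqrt (euclid p p))^-1 *: p) ((Num.sqrt (euclid p p))^-1 *: tcross e1 e2 p)).
split; first exact: (complex_frame_free u1 u2 u12 p1 p2 p0').
move=> [s y]; apply: (perp_submx u1 u2 u12 p1 p2 p0') => n pn.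
have [k1 k2 k3] := flat n pn y.
(* The identity theorem was applied at the single parameter r; any other point of the fibre differs
   by a combination of phi1 and phi2. *)
have -> : iota (s, y) - a = (s.1 - r.1) *: phi1 y + (s.2 - r.2) *: phi2 y + (iota (r, y) - a).
  by rewrite /iota_M /= -/a; vec.
by rewrite euclid_comb k1 k2 k3 !mulr0 !addr0.
Qed.

(** The defect is linear and that of G = r1 phi1 + r2 phi2 + psi vanishes by the choice of slope. *)
Lemma defect_psi x : dom c x -> P (coord c x) <> 0 ->
  defect (F1 c) (F2 c) al be (F1 c) (coord c x) = 0 -> defect (F1 c) (F2 c) al be (F2 c) (coord c x) = 0 ->
  defect (F1 c) (F2 c) al be (F3 c) (coord c x) = 0.
Proof.
move=> hx p0; have := slopeE hx p0.
have -> : P (coord c x) = pr (coord c x) (vdx G (coord c x)) by [].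
exact: (defect_comb (vd_ruling a1 a2 a3 r (1, 0) (atlas_local hc) hx) (vd_ruling a1 a2 a3 r (0, 1) (atlas_local hc) hx)).
Qed.

Lemma cayley_slope x : connected [set: S] -> ~ planar iota -> dom c x -> immersion_at iota (r, x) ->
  [/\ an al (coord c x), an be (coord c x) & \forall w \near coord c x,
   [/\ defect (F1 c) (F2 c) al be (F1 c) w = 0, defect (F1 c) (F2 c) al be (F2 c) w = 0,
     defect (F1 c) (F2 c) al be (F3 c) w = 0 & be w != 0]].
Proof.
move=> conn npl hx im.
have rf := immersion_jacobian a1 a2 a3 (atlas_local hc) hx im.
rewrite (jacobianE a1 a2 a3 r (atlas_local hc) hx) in rf.
have [q0 qn] := row_free_frame rf.
have e1 : phi1 x = F1 c (coord c x) by rewrite /= param_coord.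
have e2 : phi2 x = F2 c (coord c x) by rewrite /= param_coord.
rewrite e1 e2 in q0 qn.
have p0 : P (coord c x) <> 0 by exact: q0.
have [hal hbe] := slope_an hx p0.
have be0 : be (coord c x) != 0.
  (* If be were zero, the projections of the two derivatives would be real multiples of each other,
     against the independence of the tangent frame. *)
  apply/eqP => b0; apply: (qn (al (coord c x))).
  by have := slopeE hx p0; rewrite b0 scale0r addr0.
have np := mainpart_near hx p0.
have nf : \forall w \near coord c x, P w <> 0 ->
   [/\ defect (F1 c) (F2 c) al be (F1 c) w = 0, defect (F1 c) (F2 c) al be (F2 c) w = 0 &
     defect (F1 c) (F2 c) al be (F3 c) w = 0].
  apply: (near_in_dom hx) => y hy py.
  have d1 : defect (F1 c) (F2 c) al be (F1 c) (coord c y) = 0.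
    apply: contrapT => d; apply: npl; exact: (defect_planar conn hy py (or_introl (erefl _)) d).
  have d2 : defect (F1 c) (F2 c) al be (F2 c) (coord c y) = 0.
    apply: contrapT => d; apply: npl; exact: (defect_planar conn hy py (or_intror (erefl _)) d).
  split; [exact: d1|exact: d2|exact: defect_psi].
split; [exact: hal|exact: hbe|].
apply: filterS3 np nf (an_nz hbe be0) => w pw fw bw.
by have [d1 d2 d3] := fw pw; split; [exact: d1|exact: d2|exact: d3|exact: bw].
Qed.

End at_point.

End ruled_cayley.

(** * Local coordinates obtained from an analytic change of variables *)

Section new_chart.
Variables (R : realType) (S : analytic_surface R) (c : chart R S).
Variables (F1 F2 G1 G2 : R * R -> R) (Q : R * R -> Prop).
Hypothesis hc : atlas c.
Let F (z : R * R) : R * R := (F1 z, F2 z).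
Let G (z : R * R) : R * R := (G1 z, G2 z).
(** Taking interiors makes the domain [D] open and lets every condition hold on a neighbourhood of
    each of its points, as analytic transitions with the atlas require. *)
Let A := interior [set z | [/\ Q z, an F1 z, an F2 z & G (F z) = z]].
Let B := interior [set z | [/\ an G1 z, an G2 z & F (G z) = z]].
Let D := [set y : S | [/\ dom c y, A (coord c y) & B (F (coord c y))]].
Let co (y : S) := F (coord c y).
Let pa (z : R * R) := param c (G z).

Let an_pair (H1 H2 : R * R -> R) z : an H1 z -> an H2 z -> (fun w => (H1 w, H2 w)) @ z --> (H1 z, H2 z).
Proof. by move=> /an_continuous c1 /an_continuous c2; exact: (cvg_pair c1 c2). Qed.

Let Aat z : A z -> [/\ Q z, an F1 z, an F2 z & G (F z) = z].
Proof. exact: interior_subset. Qed.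
Let Bat z : B z -> [/\ an G1 z, an G2 z & F (G z) = z].
Proof. exact: interior_subset. Qed.

Let Anear z : A z -> \forall w \near z, A w.
Proof. by move=> hz; apply: open_nbhs_nbhs; split=> //; exact: open_interior. Qed.
Let Bnear z : B z -> \forall w \near z, B w.
Proof. by move=> hz; apply: open_nbhs_nbhs; split=> //; exact: open_interior. Qed.

Let co_cvg y : D y -> co @ y --> co y.
Proof.
move=> [hy hA _]; have [_ h1 h2 _] := Aat hA.
exact: (cvg_comp _ _ (cvg_coord hy) (an_pair h1 h2)).
Qed.

Let G_co y : D y -> G (co y) = coord c y.
Proof. by move=> [hy hA _]; have [_ _ _ ->] := Aat hA. Qed.

Let pa_co y : D y -> pa (co y) = y.
Proof. by move=> hy; rewrite /pa G_co //; case: hy => hy _ _; exact: param_coord. Qed.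

Let G_cvg y : D y -> G @ (co y) --> coord c y.
Proof.
by move=> hy; have [_ _ hB] := hy; have [h1 h2 _] := Bat hB; rewrite -(G_co hy); exact: an_pair.
Qed.

Let D_open : open D.
Proof.
rewrite openE => y hy; have [hy1 hA hB] := hy.
have nA := near_coord hy1 (Anear hA).
have nB : \forall w \near y, B (co w) := co_cvg hy (Bnear hB).
by apply: filterS3 (near_dom hy1) nA nB => w; split.
Qed.

Let cod_near y : D y -> \forall z \near co y, (co @` D) z.
Proof.
move=> hy; have [hy1 hA hB] := hy.
have nA : \forall z \near co y, A (G z) := G_cvg hy (Anear hA).
have nC : \forall z \near co y, coord c (param c (G z)) = G z /\ dom c (param c (G z)) := G_cvg hy (near_cod hy1).
apply: filterS3 nA nC (Bnear hB) => z zA [zc zd] zB.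
have [_ _ FG] := Bat zB.
by exists (param c (G z)); [split; rewrite ?zc ?FG|rewrite /co zc].
Qed.

Let cod_open' : open (co @` D).
Proof. by rewrite openE => _ [y hy <-]; exact: cod_near. Qed.

Let coK : {in D, cancel co pa}.
Proof. by move=> y /set_mem hy; exact: pa_co. Qed.

Let co_cont : {in D, continuous co}.
Proof. by move=> y /set_mem hy; exact: co_cvg. Qed.

Let pa_cont : {in co @` D, continuous pa}.
Proof.
move=> z /set_mem [y hy <-]; have [hy1 _ _] := hy.
have h : pa @ (co y) --> y := cvg_comp _ _ (G_cvg hy) (cvg_param hy1).
by move: h; rewrite -{2}(pa_co hy).
Qed.

Let d : chart R S := Chart D_open cod_open' coK co_cont pa_cont.

Let d_local : local_coordinates d.
Proof.
move=> e he; split=> x.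
- move=> hx ex; have [hx1 hA hB] := hx.
  have [t1 t2] := an_transition (atlas_compatible hc he) hx1 ex.
  have [g1 g2 _] := Bat hB.
  rewrite -(G_co hx) in t1 t2.
  split; apply/anP.
    exact: (@an_comp R (fun q => (coord e (param c q)).1) G1 G2 (co x) t1 g1 g2).
  exact: (@an_comp R (fun q => (coord e (param c q)).2) G1 G2 (co x) t2 g1 g2).
- move=> ex hx; have [hx1 hA hB] := hx.
  have [t1 t2] := an_transition (atlas_compatible he hc) ex hx1.
  have [_ f1 f2 _] := Aat hA.
  have E : ((coord c (param e (coord e x))).1, (coord c (param e (coord e x))).2) = coord c x.
    by rewrite -surjective_pairing (param_coord ex).
  have E' H : (fun q => H ((coord c (param e q)).1, (coord c (param e q)).2)) = (fun q => H (coord c (param e q))) :> (R * R -> R).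
    by apply/funext => q; rewrite -surjective_pairing.
  rewrite -E in f1 f2.
  split; apply/anP.
    have := @an_comp R F1 (fun q => (coord c (param e q)).1) (fun q => (coord c (param e q)).2) (coord e x) f1 t1 t2; rewrite E'; exact.
  have := @an_comp R F2 (fun q => (coord c (param e q)).1) (fun q => (coord c (param e q)).2) (coord e x) f2 t1 t2; rewrite E'; exact.
Qed.

Lemma new_chart x0 : dom c x0 ->
  (\forall z \near coord c x0, Q z) -> an F1 (coord c x0) -> an F2 (coord c x0) ->
  an G1 (F (coord c x0)) -> an G2 (F (coord c x0)) ->
  (\forall z \near coord c x0, G (F z) = z) -> (\forall z \near F (coord c x0), F (G z) = z) ->
  exists d : chart R S, [/\ local_coordinates d, dom d x0 &
    forall y, dom d y -> [/\ dom c y, Q (coord c y) &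
      \forall z \near coord c y, coord d (param c z) = (F1 z, F2 z)]].
Proof.
move=> hx hQ f1 f2 g1 g2 hGF hFG; exists d; split; first exact: d_local.
- split; first exact: hx.
    by apply: filterS3 hQ (filterI (an_near f1) (an_near f2)) hGF => z ? [? ?] ?; split.
  by apply: filterS3 (an_near g1) (an_near g2) hFG => z ? ? ?; split.
move=> y [hy hA hB]; split; [exact: hy|by have [] := Aat hA|].
by apply: filterS (near_cod hy) => z [e _]; rewrite /= /co e.
Qed.

End new_chart.

Lemma sign_near (R : realType) (T : topologicalType) (f : T -> R) p :
  f @ p --> f p -> f p != 0 -> \forall q \near p, 0 < f q <-> 0 < f p.
Proof.
move=> cv nz; have [pos|neg] := ltP 0 (f p).
  by apply: filterS (cvgr_gt _ cv _ pos).
have {}neg : f p < 0 by rewrite lt_neqAle nz.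
apply: filterS (cvgr_lt _ cv _ neg) => q hq; split=> // h.
by have := lt_trans h hq; rewrite ltxx.
Qed.

(** * The equations in adapted coordinates, and the converse *)

Section equations.
Variables (R : realType) (S : analytic_surface R) (phi1 phi2 psi : S -> 'rV[R]_8).
Hypotheses (a1 : analytic_map phi1) (a2 : analytic_map phi2) (a3 : analytic_map psi).
Hypotheses (n1 : forall x, euclid (phi1 x) (phi1 x) = 1) (n2 : forall x, euclid (phi2 x) (phi2 x) = 1).
Hypothesis n12 : forall x, euclid (phi1 x) (phi2 x) = 0.
Local Notation iota := (iota_M phi1 phi2 psi).
Local Notation ruling := (ruling phi1 phi2 psi).
Implicit Types (c d : chart R S) (x y : S) (r : R * R) (H : S -> 'rV[R]_8).

(** Let D = H_t - J H_s modulo e1 and e2. Substituting the Beltrami relations turns the vanishing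
    defect into be (sx - tx J) D = 0; applying sx + tx J gives (sx^2 + tx^2) D = 0. *)
Lemma cauchy_riemann (e1 e2 Hx Hy Hs Ht : 'rV[R]_8) (al be sx tx : R) :
  euclid e1 e1 = 1 -> euclid e2 e2 = 1 -> euclid e1 e2 = 0 -> be != 0 -> sx != 0 ->
  Hx = sx *: Hs + tx *: Ht -> Hy = (al * sx - be * tx) *: Hs + (be * sx + al * tx) *: Ht ->
  prj e1 e2 Hy - al *: prj e1 e2 Hx - be *: tcross e1 e2 (prj e1 e2 Hx) = 0 ->
  prj e1 e2 Ht = tcross e1 e2 Hs.
Proof.
move=> u1 u2 u12 b0 s0 -> ->; rewrite !prD !prZ -(J_pr e1 e2 Hs).
have := pr_pr u1 u2 u12 Hs; have := pr_pr u1 u2 u12 Ht.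
move: (prj e1 e2 Hs) (prj e1 e2 Ht) => hs ht pt ps; rewrite JD !JZ => E.
pose D := ht - tcross e1 e2 hs.
have JD' : tcross e1 e2 D = tcross e1 e2 ht + hs by rewrite JD JN JJ // ps opprK.
have prD' : prj e1 e2 D = D by rewrite prD prN pt pr_J.
have E1 : sx *: D = tx *: tcross e1 e2 D.
  apply/eqP; rewrite -subr_eq0; apply/eqP; apply: (scalerI b0); rewrite scaler0 -[RHS]E JD' /D.
  by move: (tcross e1 e2 hs) (tcross e1 e2 ht) => A B; vec.
have E2 : sx *: tcross e1 e2 D = - (tx *: D).
  by rewrite -JZ E1 JZ JJ // prD' scalerN.
have E3 : (sx ^+ 2 + tx ^+ 2) *: D = 0.
  have : sx *: (sx *: D) = tx *: (sx *: tcross e1 e2 D) by rewrite E1 scalerA mulrC -scalerA.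
  by rewrite E2 scalerN !scalerA => h; rewrite scalerDl !expr2 h addNr.
have st : sx ^+ 2 + tx ^+ 2 != 0.
  by rewrite paddr_eq0 ?sqr_ge0 // !sqrf_eq0 (negbTE s0).
by move/eqP: E3; rewrite scaler_eq0 (negbTE st) /= subr_eq0 => /eqP.
Qed.

(** The coefficients of phi1 and phi2 are written as inner products: this makes them analytic and
    lets orthonormality determine those of phi1 and phi2. *)
Definition ruled_equation d H y := dt d H y = tcross (phi1 y) (phi2 y) (ds d H y)
  + euclid (dt d H y) (phi1 y) *: phi1 y + euclid (dt d H y) (phi2 y) *: phi2 y.

Lemma new_chart_equation c d H (al be F1 F2 : R * R -> R) y : analytic_map H ->
  atlas c -> local_coordinates d -> dom c y -> dom d y ->
  (\forall z \near coord c y, coord d (param c z) = (F1 z, F2 z)) ->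
  pdy F1 (coord c y) = al (coord c y) * pdx F1 (coord c y) - be (coord c y) * pdx F2 (coord c y) ->
  pdy F2 (coord c y) = be (coord c y) * pdx F1 (coord c y) + al (coord c y) * pdx F2 (coord c y) ->
  be (coord c y) != 0 -> pdx F1 (coord c y) != 0 ->
  defect (phi1 \o param c) (phi2 \o param c) al be (H \o param c) (coord c y) = 0 ->
  ruled_equation d H y.
Proof.
move=> aH hc hd cy dy hF ey1 ey2 b0 s0 df.
have [_ t] := hd c hc.
have [es et] := dsE hd dy aH.
have ch u := vd_change u t dy cy (van_chart hd dy aH).
have d1 u : 'D_u (fun q => (coord d (param c q)).1) (coord c y) = 'D_u F1 (coord c y).
  by apply: near_eq_derive; apply: filterS hF => z ->.
have d2 u : 'D_u (fun q => (coord d (param c q)).2) (coord c y) = 'D_u F2 (coord c y).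
  by apply: near_eq_derive; apply: filterS hF => z ->.
have chx : vdx (H \o param c) (coord c y) = pdx F1 (coord c y) *: ds d H y + pdx F2 (coord c y) *: dt d H y.
  by rewrite es et /vdx [LHS]ch d1 d2.
have chy : vdy (H \o param c) (coord c y) = pdy F1 (coord c y) *: ds d H y + pdy F2 (coord c y) *: dt d H y.
  by rewrite es et /vdy [LHS]ch d1 d2.
rewrite ey1 ey2 in chy.
have e1 : phi1 y = (phi1 \o param c) (coord c y) by rewrite /= param_coord.
have e2 : phi2 y = (phi2 \o param c) (coord c y) by rewrite /= param_coord.
rewrite /defect -e1 -e2 in df.
have := cauchy_riemann (n1 y) (n2 y) (n12 y) b0 s0 chx chy df.
rewrite /ruled_equation => <-; exact: prK.
Qed.

Lemma an_param_euclid d H K y : analytic_map H -> analytic_map K -> local_coordinates d -> dom d y ->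
  analytic_at ((fun y => euclid (dt d H y) (K y)) \o param d) (coord d y).
Proof.
move=> aH aK hd dy; apply/anP.
have vH := van_chart hd dy aH; have vK := van_chart hd dy aK.
apply: an_ext (an_euclid (van_vd (0, 1) vH) vK).
apply: filterS (near_cod dy) => z [e dz].
by have [_ et] := dsE hd dz aH; rewrite /= et e.
Qed.

(** Differentiates the constant inner product. It makes the matrix of phi-components of the
    t-derivatives of phi1, phi2 skew, which is why a single f appears with opposite signs. *)
Lemma euclid_dt d H K y (k : R) : analytic_map H -> analytic_map K -> local_coordinates d -> dom d y ->
  (forall x, euclid (H x) (K x) = k) -> euclid (dt d H y) (K y) = - euclid (dt d K y) (H y).
Proof.
move=> aH aK hd dy hk; have [_ eH] := dsE hd dy aH; have [_ eK] := dsE hd dy aK.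
have vH := van_chart hd dy aH; have vK := van_chart hd dy aK.
have := d_euclid (0, 1) vH vK.
rewrite (_ : (fun q => _) = (fun=> k)); last by apply/funext => z; exact: hk.
rewrite derive_cst /= (param_coord dy) -[vd _ _ _]eH -[X in _ + euclid _ X]eK => h.
by apply/eqP; rewrite -addr_eq0 (euclidC (dt d K y)) -h.
Qed.

Lemma ruling_equation d y r : local_coordinates d -> dom d y ->
  (forall H, H = phi1 \/ H = phi2 \/ H = psi -> exists a b, dt d H y = tcross (phi1 y) (phi2 y) (ds d H y) + a *: phi1 y + b *: phi2 y) ->
  exists a b, vdy (ruling d r) (coord d y) =
    tcross (phi1 y) (phi2 y) (vdx (ruling d r) (coord d y)) + a *: phi1 y + b *: phi2 y.
Proof.
move=> hd dy h.
have [b1 [c1 E1]] := h phi1 (or_introl erefl).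
have [b2 [c2 E2]] := h phi2 (or_intror (or_introl erefl)).
have [b3 [c3 E3]] := h psi (or_intror (or_intror erefl)).
have [s1 t1] := dsE hd dy a1; have [s2 t2] := dsE hd dy a2; have [s3 t3] := dsE hd dy a3.
rewrite s1 t1 in E1; rewrite s2 t2 in E2; rewrite s3 t3 in E3.
exists (r.1 * b1 + r.2 * b2 + b3), (r.1 * c1 + r.2 * c2 + c3).
have Ly := vd_ruling a1 a2 a3 r (0, 1) hd dy; have Lx := vd_ruling a1 a2 a3 r (1, 0) hd dy.
rewrite -!/(vdx _ _) -!/(vdy _ _) in Ly Lx.
rewrite Ly Lx E1 E2 E3 !JD !JZ.
move: (vdx (phi1 \o _) _) (vdx (phi2 \o _) _) (vdx (psi \o _) _) => A B C.
by move: (tcross _ _ A) (tcross _ _ B) (tcross _ _ C) => A' B' C'; move: (phi1 y) (phi2 y) => e f; vec.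
Qed.

Lemma cayley_coordinates x0 : connected [set: S] -> singular_set_nowhere_dense iota ->
  ~ planar iota -> cayley iota -> exists d, [/\ local_coordinates d, dom d x0 &
    forall y, dom d y -> [/\ ruled_equation d phi1 y, ruled_equation d phi2 y & ruled_equation d psi y]].
Proof.
move=> conn sing npl cay.
have [r im] := immersion_exists x0 sing.
have [c hc cx] := atlas_cover x0.
have [hal hbe good] := cayley_slope a1 a2 a3 n1 n2 n12 hc cay conn npl cx im.
set al := slope_re phi1 phi2 psi c r in hal good; set be := slope_im phi1 phi2 psi c r in hbe good.
have [F1 [F2 [f1 f2 bel fx1 fx2]]] := beltrami hal hbe.
have b0 : be (coord c x0) != 0 by have [_ _ _] := nbhs_singleton good.
have [e1 e2] := nbhs_singleton bel.
(* By the initial derivatives 1 and 0, this determinant is be at x0. *)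
have jac : pdx F1 (coord c x0) * pdy F2 (coord c x0) - pdy F1 (coord c x0) * pdx F2 (coord c x0) != 0.
  by rewrite e2 fx1 fx2 !mulr0 subr0 mulr1 mul1r addr0.
have [G1 [G2 [g1 g2 gE FG GF]]] := an_inverse f1 f2 jac.
have nx : \forall z \near coord c x0, pdx F1 z != 0.
  by apply: an_nz; [exact: an_pdx|rewrite fx1 oner_neq0].
have hQ := filterI good (filterI bel nx).
have {}hQ := hQ (nbhs_filter _) (nbhs_filter _).
have GF' : \forall z \near coord c x0, (G1 (F1 z, F2 z), G2 (F1 z, F2 z)) = z.
  by apply: filterS GF => z [-> ->]; rewrite -surjective_pairing.
have FG' : \forall z \near (F1 (coord c x0), F2 (coord c x0)), (F1 (G1 z, G2 z), F2 (G1 z, G2 z)) = z.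
  by apply: filterS FG => z [-> ->]; rewrite -surjective_pairing.
have [d [hd dx hdy]] := new_chart hc cx hQ f1 f2 g1 g2 GF' FG'.
exists d; split=> // y dy; have [cy [[k1 k2 k3 kb] [[m1 m2] ks]] hF] := hdy y dy.
have eq H (aH : analytic_map H) := new_chart_equation aH hc hd cy dy hF m1 m2 kb ks.
by split; [exact: (eq _ a1 k1)|exact: (eq _ a2 k2)|exact: (eq _ a3 k3)].
Qed.

Lemma equation_oriented d : local_coordinates d ->
  (forall y, dom d y -> forall H, H = phi1 \/ H = phi2 \/ H = psi ->
    exists a b, dt d H y = tcross (phi1 y) (phi2 y) (ds d H y) + a *: phi1 y + b *: phi2 y) ->
  forall r x, dom d x -> immersion_at iota (r, x) ->
  [/\ row_free (jacobian iota d (r, x)), 0 < PhiM (jacobian iota d (r, x)) &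
    forall E : 'M[R]_(4, 8), E *m E^T = 1%:M -> (E <= jacobian iota d (r, x))%MS ->
      PhiM E = 1 \/ PhiM E = - 1].
Proof.
move=> hd heq r x dx im.
have rf := immersion_jacobian a1 a2 a3 hd dx im.
have [a [b E]] := ruling_equation r hd dx (heq x dx).
move: rf; rewrite (jacobianE a1 a2 a3 r hd dx) => rf.
have [pos h] := cayley_frame (n1 x) (n2 x) (n12 x) E rf.
by split; [exact: rf|exact: pos|exact: h].
Qed.

Section converse.
Hypothesis hloc : forall x, exists d, [/\ local_coordinates d, dom d x &
  forall y, dom d y -> forall H, H = phi1 \/ H = phi2 \/ H = psi ->
    exists a b, dt d H y = tcross (phi1 y) (phi2 y) (ds d H y) + a *: phi1 y + b *: phi2 y].

(** A tangent frame in any chart is an invertible combination of the Jacobian in the adapted chart,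
    and Phi scales by the determinant of that combination. *)
Lemma tangent_PhiM p E : immersion_at iota p -> tangent_frame iota p E ->
  PhiM E != 0 /\ (E *m E^T = 1%:M -> PhiM E = 1 \/ PhiM E = - 1).
Proof.
case: p => r x im [rE [c [hc cx EJ]]].
have [d [hd dx heq]] := hloc x.
have [rf pos h] := equation_oriented hd heq dx im.
have [_ t] := hd c hc.
have sub : (E <= jacobian iota d (r, x))%MS.
  have /andP[EJ1 _] := EJ.
  exact: (submx_trans EJ1 (jacobian_sub a1 a2 a3 r hd (atlas_local hc) t dx cx)).
split; last by move=> EE; exact: h.
have /submxP [B EB] := sub.
have uB : B \in unitmx.
  rewrite -row_free_unit -row_leq_rank; move: rE; rewrite /row_free => /eqP {1}<-.
  by rewrite EB mxrankM_maxl.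
rewrite EB PhiM_mul mulf_neq0 ?(gt_eqF pos) //.
by move: uB; rewrite unitmxE unitfE.
Qed.

(** Phi on the Jacobian is a polynomial in r of degree at most two, whose coefficients are analytic
    functions of the coordinates. *)
Lemma PhiM_jacobian_continuous c p : atlas c -> dom c p.2 ->
  (fun q => PhiM (jacobian iota c q)) @ p --> PhiM (jacobian iota c p).
Proof.
move=> hc cx; case: p cx => r x /= cx.
pose V (i : 'I_3) u := vd u (nth (fun=> 0) [:: phi1 \o param c; phi2 \o param c; psi \o param c] i).
(* The constant third entry treats psi on the same footing as phi1 and phi2. *)
pose rho (i : 'I_3) (s : R * R) : R := nth 0 [:: s.1; s.2; 1] i.
pose B i j z := euclid (tcross (phi1 (param c z)) (phi2 (param c z)) (V i (1, 0) z)) (V j (0, 1) z).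
pose f (q : (R * R) * S) := \sum_(i < 3) \sum_(j < 3) rho i q.1 * rho j q.1 * B i j (coord c q.2).
have fE (s : R * R) y : dom c y -> PhiM (jacobian iota c (s, y)) = f (s, y).
  move=> cy; rewrite (jacobianE a1 a2 a3 s (atlas_local hc) cy) -[PhiM _]/(Phi _ _ _ _) -euclid_tcross.
  rewrite /f /B /= (param_coord cy).
  have L u : vd u (ruling c s) (coord c y) = \sum_(i < 3) rho i s *: V i u (coord c y).
    rewrite (vd_ruling a1 a2 a3 s u (atlas_local hc) cy) !big_ord_recl big_ord0 /rho /V /=.
    by rewrite scale1r addr0 addrA.
  rewrite /vdx /vdy !L.
  have sl (w : 'rV[R]_8) (g : 'I_3 -> 'rV[R]_8) : euclid (\sum_(i < 3) g i) w = \sum_(i < 3) euclid (g i) w.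
    by rewrite !big_ord_recl !big_ord0 !euclidDl euclid0l.
  have sr (w : 'rV[R]_8) (g : 'I_3 -> 'rV[R]_8) : euclid w (\sum_(i < 3) g i) = \sum_(i < 3) euclid w (g i).
    by rewrite !big_ord_recl !big_ord0 !euclidDr euclid0r.
  have sJ (g : 'I_3 -> 'rV[R]_8) : tcross (phi1 y) (phi2 y) (\sum_(i < 3) g i) = \sum_(i < 3) tcross (phi1 y) (phi2 y) (g i).
    by rewrite !big_ord_recl !big_ord0 !JD J0.
  rewrite sJ sl; apply: eq_bigr => i _; rewrite sr; apply: eq_bigr => j _.
  by rewrite JZ euclidZl euclidZr mulrA.
have cB i j : B i j (coord c q.2) @[q --> (r, x)] --> B i j (coord c x).
  have vv k u : van (V k u) (coord c x).
    apply: van_vd; case: k => [[|[|[|k]]] hk] //=.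
    - exact: (van_chart (atlas_local hc) cx a1).
    - exact: (van_chart (atlas_local hc) cx a2).
    - exact: (van_chart (atlas_local hc) cx a3).
  have aB : an (B i j) (coord c x).
    apply: an_euclid => //; apply: van_tcross => //.
      exact: (van_chart (atlas_local hc) cx a1).
    exact: (van_chart (atlas_local hc) cx a2).
  have h2 : (fun q : (R * R) * S => coord c q.2) @ (r, x) --> coord c x.
    by apply: (cvg_comp _ _ _ (cvg_coord cx)); exact: cvg_snd.
  exact: (cvg_comp _ _ h2 (an_continuous aB)).
have cr i : rho i q.1 @[q --> ((r, x) : (R * R) * S)] --> rho i r.
  have h1 : (fun q : (R * R) * S => q.1) @ (r, x) --> r by exact: cvg_fst.
  case: i => [[|[|[|i]]] hi] //; rewrite /rho /=.
  - exact: (cvg_comp _ _ h1 cvg_fst).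
  - exact: (cvg_comp _ _ h1 cvg_snd).
  - exact: cvg_cst.
have cf : f q @[q --> (r, x)] --> f (r, x).
  apply: cvg_big => [|i _]; first exact: add_continuous.
  apply: cvg_big => [|j _]; first exact: add_continuous.
  exact: (cvgM (cvgM (cr i) (cr j)) (cB i j)).
rewrite fE //; apply: cvg_trans cf; apply: near_eq_cvg.
have : \forall q \near (r, x), dom c q.2 by exact: (cvg_snd (near_dom cx)).
by apply: filterS => -[s y] /= cy; rewrite fE.
Qed.

(** The orientation is defined by positivity of Phi. As Phi does not vanish on tangent frames, this
    selects one orientation class at each point, and continuity makes the choice locally
    constant. *)
Lemma equations_cayley : cayley iota.
Proof.
exists (fun _ E => 0 < PhiM E); last first.
  move=> p E im tf EE pos; have [_ /(_ EE) [//|e]] := tangent_PhiM im tf.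
  by move: pos; rewrite e ltr0N1.
split.
  move=> p E A im tf uA; have [nz _] := tangent_PhiM im tf.
  rewrite PhiM_mul; have [dA|dA] := ltP 0 (\det A); first by rewrite pmulr_rgt0.
  have dA0 : \det A < 0.
    by rewrite lt_neqAle dA andbT -unitfE -unitmxE.
  rewrite nmulr_rgt0 //; split=> [h1 h2|/negP]; first by have := lt_trans h1 h2; rewrite ltxx.
  by rewrite -leNgt le_eqVlt (negbTE nz).
move=> c p hc cp im.
have nz : PhiM (jacobian iota c p) != 0.
  have rf : row_free (jacobian iota c p).
    by case: p cp im => r x cp im; exact: (immersion_jacobian a1 a2 a3 (atlas_local hc) cp im).
  have tf : tangent_frame iota p (jacobian iota c p).
    by split=> //; exists c; split=> //; rewrite submx_refl.
  by have [] := tangent_PhiM im tf.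
exact: (sign_near (PhiM_jacobian_continuous hc cp) nz).
Qed.

End converse.

End equations.

Theorem theorem4p6 (R : realType) (S : analytic_surface R)
    (phi1 phi2 psi : S -> 'rV[R]_8)
    (S_connected : connected [set: S])
    (phi1_analytic : analytic_map phi1)
    (phi2_analytic : analytic_map phi2)
    (psi_analytic : analytic_map psi)
    (phi1_unit : forall x, euclid (phi1 x) (phi1 x) = 1)
    (phi2_unit : forall x, euclid (phi2 x) (phi2 x) = 1)
    (phi_orthogonal : forall x, euclid (phi1 x) (phi2 x) = 0)
    (M_singularities : singular_set_nowhere_dense (iota_M phi1 phi2 psi))
    (M_nonplanar : ~ planar (iota_M phi1 phi2 psi)) :
  cayley (iota_M phi1 phi2 psi) <->
  (forall x0 : S, exists c : chart R S,
     [/\ local_coordinates c, dom c x0, oriented_coordinates phi1 phi2 psi c &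
      exists f g1 g2 : S -> R,
        [/\ analytic_in c f, analytic_in c g1, analytic_in c g2 &
         forall x, dom c x ->
           [/\ dt c phi1 x
                 = tcross (phi1 x) (phi2 x) (ds c phi1 x) + f x *: phi2 x,
               dt c phi2 x
                 = tcross (phi1 x) (phi2 x) (ds c phi2 x) - f x *: phi1 x &
               dt c psi x
                 = tcross (phi1 x) (phi2 x) (ds c psi x)
                   + g1 x *: phi1 x + g2 x *: phi2 x]]]).
Proof.
split=> [cay x0|h].
  have [d [hd dx heq]] := cayley_coordinates phi1_analytic phi2_analytic psi_analytic
    phi1_unit phi2_unit phi_orthogonal x0 S_connected M_singularities M_nonplanar cay.
  have heq' y : dom d y -> forall H : S -> 'rV[R]_8, H = phi1 \/ H = phi2 \/ H = psi ->
      exists a b, dt d H y = tcross (phi1 y) (phi2 y) (ds d H y) + a *: phi1 y + b *: phi2 y.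
    move=> dy H hH; exists (euclid (dt d H y) (phi1 y)), (euclid (dt d H y) (phi2 y)).
    by have [k1 k2 k3] := heq y dy; case: hH => [->|[->|->]]; [exact: k1|exact: k2|exact: k3].
  exists d; split; [exact: hd|exact: dx| |].
    move=> r x dx' im.
    have [_ pos _] := equation_oriented phi1_analytic phi2_analytic psi_analytic
      phi1_unit phi2_unit phi_orthogonal hd heq' dx' im.
    rewrite (jacobianE phi1_analytic phi2_analytic psi_analytic r hd dx') in pos.
    have [es et] := ds_iota phi1_analytic phi2_analytic psi_analytic r hd dx'.
    by rewrite es et.
  (* The functions f, g1, g2 are components of the t-derivatives. Differentiating orthonormality
     shows that phi1 and phi2 have no component along themselves and that the phi1-component for
     phi2 is - f. *)
  exists (fun y => euclid (dt d phi1 y) (phi2 y)), (fun y => euclid (dt d psi y) (phi1 y)),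
    (fun y => euclid (dt d psi y) (phi2 y)).
  split.
  - by move=> y dy; exact: an_param_euclid.
  - by move=> y dy; exact: an_param_euclid.
  - by move=> y dy; exact: an_param_euclid.
  move=> y dy; have [k1 k2 k3] := heq y dy.
  have z1 : euclid (dt d phi1 y) (phi1 y) = 0.
    have := euclid_dt phi1_analytic phi1_analytic hd dy phi1_unit.
    by move: (euclid _ _) => t e; lra.
  have z2 : euclid (dt d phi2 y) (phi2 y) = 0.
    have := euclid_dt phi2_analytic phi2_analytic hd dy phi2_unit.
    by move: (euclid _ _) => t e; lra.
  have z3 : euclid (dt d phi2 y) (phi1 y) = - euclid (dt d phi1 y) (phi2 y).
    by rewrite (euclid_dt phi1_analytic phi2_analytic hd dy phi_orthogonal) opprK.
  split; last exact: k3.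
    by move: k1; rewrite /ruled_equation z1 scale0r addr0; exact.
  by move: k2; rewrite /ruled_equation z2 z3 scale0r addr0 scaleNr; exact.
apply: (equations_cayley phi1_analytic phi2_analytic psi_analytic phi1_unit phi2_unit phi_orthogonal) => x.
have [d [hd dx _ [f [g1 [g2 [_ _ _ heq]]]]]] := h x.
exists d; split=> // y dy H hH; have [k1 k2 k3] := heq y dy.
case: hH => [->|[->|->]].
- by exists 0, (f y); rewrite scale0r addr0; exact: k1.
- by exists (- f y), 0; rewrite scale0r addr0 scaleNr; exact: k2.
- by exists (g1 y), (g2 y); exact: k3.
Qed.
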